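(* Let $\kappa$ be a consistent (positive definite) kernel on $\mathbf X$, $g:\mathbf X\to(0,\infty)$ continuous, $a=(a_i)_{i\in I}$ with all $a_i>0$, and $\mathcal A=(A_i)_{i\in I}$ an $(m,p)$-condenser with $\mathrm{cap}\,(\mathcal A,a,g)>0$. Assume that either $I^-=\varnothing$, or both $\inf_{x\in A}g(x)>0$ and $\sup_{x\in A^+,\,y\in A^-}\kappa(x,y)<\infty$. Then $$\|\hat\Gamma(\mathcal A,a,g)\|^2=\mathrm{cap}\,(\mathcal A,a,g),$$ where $\hat\Gamma(\mathcal A,a,g)$ is the class of all $\nu\in\mathcal E$ for which there exist real numbers $c_i(\nu)$, $i\in I$, such that $$\alpha_ia_i\kappa(x,\nu)\geqslant c_i(\nu)g(x)\ \text{ n.e. in } A_i,\ i\in I,\qquad\text{and}\qquad \sum_{i\in I}c_i(\nu)\geqslant1.$$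
   Context: $\mathbf X$ is a locally compact Hausdorff space; $\mathfrak M$ is the space of all real-valued (signed) Radon measures on $\mathbf X$ with the vague topology (pointwise convergence on continuous real functions with compact support). A kernel is a lower semicontinuous $\kappa:\mathbf X\times\mathbf X\to(-\infty,\infty]$, assumed $\geqslant0$ unless $\mathbf X$ is compact. Write $\kappa(\nu,\nu_1)=\int\kappa\,d(\nu\otimes\nu_1)$ (mutual energy; energy if $\nu_1=\nu$) and $\kappa(x,\nu)=\int\kappa(x,y)\,d\nu(y)$ (potential) whenever well defined. $\mathcal E$ is the set of $\nu\in\mathfrak M$ with finite energy. $\kappa$ is positive definite: symmetric with $\kappa(\nu,\nu)\geqslant0$ whenever defined; then $\mathcal E$ is a pre-Hilbert space with scalar product $\kappa(\nu,\nu_1)$ and seminorm $\|\nu\|=\kappa(\nu,\nu)^{1/2}$, defining the strong topology. A nonnegative measure is concentrated on $E\subset\mathbf X$ if $\mathbf X\setminus E$ is locally negligible for it; $\mathfrak M^+(E)$ is the set of such measures, $\mathcal E^+(E)=\mathfrak M^+(E)\cap\mathcal E$, $\mathcal E^+=\mathcal E^+(\mathbf X)$. $\kappa$ is consistent if every strong Cauchy net in $\mathcal E^+$ converges strongly to each of its vague cluster points. Interior capacity of a set: $C(E)=1/\inf\{\|\nu\|^2:\nu\in\mathcal E^+(E),\ \nu(\mathbf X)=1\}$. A relation holds n.e. (nearly everywhere) in $E$ if the set of $x\in E$ where it fails has interior capacity zero; for $\nu\in\mathcal E$ the potential $\kappa(\cdot,\nu)$ is defined and finite n.e. in $\mathbf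 X$. Conventions: $\inf\varnothing=+\infty$, $1/0=+\infty$, $1/(+\infty)=0$. Fix integers $m\geqslant1$, $p\geqslant0$; $I=\{1,\dots,m+p\}$, $I^+=\{1,\dots,m\}$, $I^-=I\setminus I^+$; $\alpha_i=+1$ for $i\in I^+$, $\alpha_i=-1$ for $i\in I^-$. An $(m,p)$-condenser is an ordered collection $\mathcal A=(A_i)_{i\in I}$ of nonempty subsets of $\mathbf X$ with $\overline{A_i}\cap\overline{A_j}=\varnothing$ for all $i\in I^+$, $j\in I^-$. $A=\bigcup_{i\in I}A_i$, $A^+=\bigcup_{i\in I^+}A_i$, $A^-=\bigcup_{i\in I^-}A_i$. $\mathfrak M(\mathcal A)$ is the set of formal combinations $\mu=\sum_{i\in I}\alpha_i\mu^i$ with $\mu^i\in\mathfrak M^+(A_i)$, identified with tuples $(\mu^i)_{i\in I}$; $R\mu\in\mathfrak M$ is the signed measure $\sum_i\alpha_i\mu^i$; potentials and energies of $\mu$ are those of $R\mu$. $\mathcal E(\mathcal A)$ is the set of $\mu\in\mathfrak M(\mathcal A)$ with finite energy $\|\mu\|^2:=\kappa(R\mu,R\mu)$. $\mathcal E(\mathcal A,a,g)=\{\mu\in\mathcal E(\mathcal A):\int g\,d\mu^i=a_i\ \forall i\in I\}$. For a set $\mathcal H$ in $\mathcal E$ or $\mathcal E(\mathcal A)$, $\|\mathcal H\|^2:=\inf_{\nu\in\mathcal H}\|\nu\|^2$ ($+\infty$ if $\mathcal H=\varnothing$). $\mathrm{cap}\,(\mathcal A,a,g):=1/\|\mathcal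 E(\mathcal A,a,g)\|^2\in[0,\infty]$. *)

(* Defs.v *)
From HB Require Import structures.
From mathcomp Require Import all_boot all_order all_algebra.
From mathcomp Require Import all_classical all_reals all_analysis.
Import Order.TTheory GRing.Theory Num.Theory.
Import numFieldNormedType.Exports.

Set Implicit Arguments.
Unset Strict Implicit.
Unset Printing Implicit Defensive.

Local Open Scope classical_set_scope.
Local Open Scope ring_scope.

(* A (real, signed) Radon measure is taken in the sense of Bourbaki: a linear
   form on the continuous functions with compact support that is bounded on
   the functions supported in any given compact set.  It is encoded by a total
   functional on T -> R of which only the restriction to Cc is relevant. *)

Section Measures.
Context {R : realType} {T : topologicalType}.
Implicit Types (nu : (T -> R) -> R) (f phi : T -> R) (h : T -> \bar R).

Definition Cc : set (T -> R) :=
  [set f | continuous f /\ compact (closure [set x | f x != 0])].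

Definition radon : set ((T -> R) -> R) := [set nu |
  (forall (c : R) f1 f2, Cc f1 -> Cc f2 ->
     nu (fun x => c * f1 x + f2 x) = c * nu f1 + nu f2) /\
  (forall K : set T, compact K -> exists M : R, forall f (b : R), Cc f ->
     [set x | f x != 0] `<=` K -> (forall x, `|f x| <= b) ->
     `|nu f| <= M * b)].

Definition nonneg_measure nu :=
  forall f, Cc f -> (forall x, 0 <= f x) -> 0 <= nu f.

(* nu^+ and nu^- of the Jordan decomposition: nu^+ is determined by
   nu^+(f) = sup {nu(phi) : 0 <= phi <= f} for nonnegative f in Cc, and extended
   linearly. *)
Definition sup_below nu f : R :=
  sup [set nu phi | phi in [set phi | Cc phi /\ forall x, 0 <= phi x <= f x]].

Definition mpos nu f : R := sup_below nu f^\+ - sup_below nu f^\-.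

Definition mneg nu : (T -> R) -> R := mpos (fun f => - nu f).

(* Integral against a nonnegative measure of a lower semicontinuous function
   which is nonnegative unless T is compact. *)
Definition pos_integral nu h : \bar R :=
  ereal_sup [set (nu phi)%:E |
    phi in [set phi | Cc phi /\ forall x, ((phi x)%:E <= h x)%E]].

Definition radon_integral_defined nu h : bool :=
  (pos_integral (mpos nu) h +? - pos_integral (mneg nu) h)%E.

(* Meaningful only under [radon_integral_defined] (the value is -oo in the case
   +oo - +oo); the latter holds automatically when nu is nonnegative. *)
Definition radon_integral nu h : \bar R :=
  (pos_integral (mpos nu) h - pos_integral (mneg nu) h)%E.

Definition total_mass nu : \bar R := radon_integral nu (cst 1%E).

Definition outer_mass nu (N : set T) : \bar R :=
  ereal_inf [set radon_integral nu (EFin \o \1_G) |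
    G in [set G : set T | open G /\ N `<=` G]].

Definition locally_negligible nu (N : set T) :=
  forall K : set T, compact K -> outer_mass nu (N `&` K) = 0%E.

Definition Mplus (E : set T) : set ((T -> R) -> R) :=
  [set nu | [/\ radon nu, nonneg_measure nu & locally_negligible nu (~` E)]].

(* The vague topology is induced from pointwise convergence on Cc. *)
Definition vague nu : {ptws Cc -> R} := fun u => nu (\val u).

End Measures.

Definition tensor (R : realType) (X Y : topologicalType)
    (nu : (X -> R) -> R) (nu1 : (Y -> R) -> R) : (X * Y -> R) -> R :=
  fun phi => nu (fun x => nu1 (fun y => phi (x, y))).

Section Energy.
Context {R : realType} {X : topologicalType}.
Variable kappa : X * X -> \bar R.
Local Notation measure := ((X -> R) -> R).
Implicit Types (nu : measure) (x : X) (E : set X).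

Definition is_kernel :=
  [/\ lower_semicontinuous kappa,
      forall z, kappa z != -oo%E
    & ~ compact [set: X] -> forall z, (0 <= kappa z)%E].

Definition mutual_energy nu nu1 : \bar R := radon_integral (tensor nu nu1) kappa.

Definition mutual_energy_defined nu nu1 : bool :=
  radon_integral_defined (tensor nu nu1) kappa.

Definition energy nu : \bar R := mutual_energy nu nu.

Definition energy_defined nu : bool := mutual_energy_defined nu nu.

Definition potential nu x : \bar R := radon_integral nu (fun y => kappa (x, y)).

Definition potential_defined nu x : bool :=
  radon_integral_defined nu (fun y => kappa (x, y)).

Definition finite_energy : set measure :=
  [set nu | [/\ radon nu, energy_defined nu & energy nu \is a fin_num]].

Definition Eplus E : set measure := Mplus E `&` finite_energy.

Definition positive_definite :=
  (forall x y, kappa (x, y) = kappa (y, x)) /\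
  (forall nu, radon nu -> energy_defined nu -> (0 <= energy nu)%E).

Definition snorm nu : R := Num.sqrt (fine (energy nu)).

Definition sdist nu nu1 : R := snorm (fun f => nu f - nu1 f).

Definition directed (J : Type) (le : J -> J -> Prop) :=
  [/\ inhabited J, forall j, le j j,
      forall j k l, le j k -> le k l -> le j l
    & forall j k, exists2 l, le j l & le k l].

Definition tails (J : Type) (le : J -> J -> Prop) : set_system J :=
  [set B | exists j0, forall j, le j0 j -> B j].

Definition consistent :=
  forall (J : Type) (le : J -> J -> Prop) (nu : J -> measure) (nu0 : measure),
    directed le -> (forall j, Eplus setT (nu j)) ->
    (forall e : R, 0 < e -> exists j0, forall j k, le j0 j -> le j0 k ->
       sdist (nu j) (nu k) < e) ->
    radon nu0 -> cluster ((fun j => vague (nu j)) @ tails le) (vague nu0) ->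
    finite_energy nu0 /\ (fun j => sdist (nu j) nu0) @ tails le --> (0 : R).

Definition capacity E : \bar R :=
  ((ereal_inf [set energy nu |
     nu in [set nu | Eplus E nu /\ total_mass nu = 1%E]])^-1)%E.

Definition nearly_everywhere E (P : X -> Prop) :=
  capacity (E `&` [set x | ~ P x]) = 0%E.

End Energy.

Section Condensers.
Context {R : realType} {X : topologicalType} {m p : nat}.
Variable kappa : X * X -> \bar R.
Local Notation measure := ((X -> R) -> R).
Local Notation I := 'I_(m + p).
Variables (A : I -> set X) (a : I -> R) (g : X -> R).

Definition alpha (i : I) : R := if (i < m)%N then 1 else -1.

Definition is_condenser :=
  (forall i, A i !=set0) /\
  (forall i j : I, (i < m)%N -> (m <= j)%N ->
     closure (A i) `&` closure (A j) = set0).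

Definition plates : set X := \bigcup_(i in [set: I]) A i.
Definition plates_pos : set X := \bigcup_(i in [set i : I | (i < m)%N]) A i.
Definition plates_neg : set X := \bigcup_(i in [set i : I | (m <= i)%N]) A i.

Definition Rmeasure (mu : I -> measure) : measure :=
  fun f => \sum_(i < m + p) alpha i * mu i f.

Definition cond_measures : set (I -> measure) :=
  [set mu | forall i, Mplus (A i) (mu i)].

Definition cond_energy : set (I -> measure) :=
  [set mu | cond_measures mu /\ finite_energy kappa (Rmeasure mu)].

Definition cond_admissible : set (I -> measure) :=
  [set mu | cond_energy mu /\
            forall i, radon_integral (mu i) (EFin \o g) = (a i)%:E].

Definition cond_capacity : \bar R :=
  ((ereal_inf [set energy kappa (Rmeasure mu) | mu in cond_admissible])^-1)%E.

Definition Gamma_hat : set measure :=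
  [set nu | finite_energy kappa nu /\
    exists c : I -> R,
      (forall i, nearly_everywhere kappa (A i) (fun x =>
         potential_defined kappa nu x /\
         ((c i * g x)%:E <= (alpha i * a i)%:E * potential kappa nu x)%E)) /\
      1 <= \sum_(i < m + p) c i].

End Condensers.

(* Main.v *)
Require Import Defs.
From HB Require Import structures.
From mathcomp Require Import all_boot all_order all_algebra.
From mathcomp Require Import all_classical all_reals all_analysis.
From mathcomp Require Import ring lra.
Import Order.TTheory GRing.Theory Num.Theory.
Import numFieldNormedType.Exports.
Set Implicit Arguments.
Unset Strict Implicit.
Unset Printing Implicit Defensive.
Local Open Scope classical_set_scope.
Local Open Scope ring_scope.

(* All integrals are taken directly with respect to positive linear forms on Cc:
   [pos_integral] is additive and commutes with suprema of directed families
   (Dini), which gives a Tonelli theorem for lower semicontinuous kernels and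
   turns the energy into a positive semidefinite bilinear form [inner].

   Lower bound: for [nu] in the class and [mu] admissible, integrating the
   inequalities defining the class with respect to the components of [mu] gives
   [inner mu nu >= sum_i c_i >= 1], so [|nu|^2 |mu|^2 >= 1] by Cauchy-Schwarz.

   Upper bound: let [r > 0] be the infimum of the energies of admissible [mu].
   A suitable minimizing sequence has strongly Cauchy positive and negative
   parts, and by consistency it converges strongly to some [sigma] with
   [|sigma|^2 = r] and, by convexity, [inner mu sigma >= r] for all admissible
   [mu].  As the components of [mu] vary independently, the last inequality
   splits over the plates, and testing it on measures carried by the exceptional
   sets shows that [t sigma] belongs to the class for every [t > 1 / r]; its
   energy is [t^2 r]. *)

(** * Continuous functions with compact support *)

(** Consistency speaks of positive measures only, and a strongly Cauchy sequence of signed measures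
    may lack a strong limit; so convergence has to be won for the two sides separately. A bound on
    the energy of [mu] bounds the energies of its sides only if their mutual energy is bounded, and
    this is what the alternative on [I^-], [g] and [kappa] provides. The plates need not be closed
    and mass may escape to infinity, so [sigma] need not come from an admissible measure: it enters
    only through its energy and its inner products with admissible measures. The factor [t] exceeds
    [1 / r] strictly because an inequality that fails at every point of an exceptional set yields,
    once integrated, only a weak inequality; the surplus [t r - 1], shared among the plates, makes
    it contradictory. If [r = 0] the class is empty, since a member would force [r > 0], and both
    sides of the equality are infinite. As measures are linear forms, sets enter through open
    majorants and bumps, and Hahn sets are replaced by approximate splittings of functions in
    [Cc]. *)

(** Directedness absorbs the choice of a finite subcover: local constructions are glued by maxima or
    sums, without ever being indexed. *)
Lemma compact_directed_cover (T : topologicalType) (J : Type) (D : set J)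
    (P : J -> T -> Prop) (K : set T) :
  D !=set0 ->
  (forall i j, D i -> D j ->
     exists2 k, D k & forall x, P i x \/ P j x -> P k x) ->
  compact K -> (forall x, K x -> exists2 i, D i & nbhs x (P i)) ->
  exists2 i, D i & K `<=` P i.
Proof.
move=> D0 dirD /compact_near_coveringP cK hK.
(* The tails of [D], ordered by inclusion of the [P i], form a filter; the near-covering form of
   compactness then selects a single index. *)
pose F := filter_from D (fun i => [set j | D j /\ P i `<=` P j]).
have FF : Filter F.
  apply: filter_from_filter => // i j Di Dj.
  have [k Dk ijk] := dirD i j Di Dj; exists k => // l [Dl kl].
  by split; split=> // x ix; apply: kl; apply: ijk; [left|right].
have [|i Di Ki] := cK _ F P FF.
  move=> x /hK [i Di Pi].
  exists (P i, [set j | D j /\ P i `<=` P j]); first by split=> //; exists i.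
  by case=> y j /= [Piy [_]]; exact.
exists i => //; have {}Ki : K `<=` P i by apply: (Ki i); split.
exact: Ki.
Qed.

Section prod_topology.
Context {X Y : topologicalType}.

Lemma hausdorff_prod :
  hausdorff_space X -> hausdorff_space Y -> hausdorff_space (X * Y)%type.
Proof.
move=> hX hY [x y] [x' y'] cl; congr pair.
- apply: hX => A B nA nB.
  have [||[u v] [/= [Au _] [Bu _]]] := cl (A `*` setT) (B `*` setT).
  + by exists (A, setT) => //=; split=> //; exact: filterT.
  + by exists (B, setT) => //=; split=> //; exact: filterT.
  by exists u.
- apply: hY => A B nA nB.
  have [||[u v] [/= [_ Au] [_ Bu]]] := cl (setT `*` A) (setT `*` B).
  + by exists (setT, A) => //=; split=> //; exact: filterT.
  + by exists (setT, B) => //=; split=> //; exact: filterT.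
  by exists v.
Qed.

Lemma locally_compact_prod : hausdorff_space X -> hausdorff_space Y ->
  locally_compact [set: X] -> locally_compact [set: Y] ->
  locally_compact [set: X * Y].
Proof.
move=> hX hY lX lY [x y] _.
have [U + [cU clU]] := lX x I; rewrite withinET => Ux.
have [V + [cV clV]] := lY y I; rewrite withinET => Vy.
exists (U `*` V); first by rewrite withinET; exists (U, V).
have cUV : compact (U `*` V) by exact: compact_setX.
by split=> //; apply: compact_closed => //; exact: hausdorff_prod.
Qed.

End prod_topology.

Section Cc_theory.
Context {R : realType} {T : topologicalType}.
Implicit Types (f g : T -> R).

Lemma CcP f : hausdorff_space T ->
  Cc f <-> continuous f /\ exists2 K, compact K & forall x, ~ K x -> f x = 0.
Proof.
move=> hT; split=> [[cf cK]|[cf [K cK fK]]]; split=> //.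
  exists (closure [set x | f x != 0]) => // x.
  by apply: contra_notP => /eqP fx; exact: subset_closure.
have clK : closed K by exact: compact_closed.
apply: (subclosed_compact _ cK); first exact: closed_closure.
move/closure_id: clK => ->; apply: closureS => x /= fx.
by apply: contrapT => /fK /eqP; rewrite (negPf fx).
Qed.

Lemma Cc_continuous f : Cc f -> continuous f. Proof. by case. Qed.

Context (hT : hausdorff_space T).

Lemma Cc_dom f1 f2 f : Cc f1 -> Cc f2 -> continuous f ->
  (forall x, f1 x = 0 -> f2 x = 0 -> f x = 0) -> Cc f.
Proof.
move=> /(CcP _ hT) [_ [K cK fK]] /(CcP _ hT) [_ [L cL gL]] cf f0.
apply/(CcP _ hT); split=> //; exists (K `|` L); first exact: compactU.
by move=> x /not_orP [/fK ? /gL ?]; exact: f0.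
Qed.

Lemma Cc0 : Cc (fun _ : T => 0 : R).
Proof.
apply/(CcP _ hT); split; first by move=> x; exact: cvg_cst.
by exists set0 => //; exact: compact0.
Qed.

Lemma Cc_mul f g : continuous f -> Cc g -> Cc (fun x => f x * g x).
Proof.
move=> cf Cg; apply: (Cc_dom Cg Cg) => [x|x ->]; last by rewrite mulr0.
by apply: cvgM; [exact: cf|exact: Cc_continuous].
Qed.

Lemma CcZ c f : Cc f -> Cc (fun x => c * f x).
Proof. by move=> Cf; apply: Cc_mul => // x; exact: cvg_cst. Qed.

Lemma CcD f g : Cc f -> Cc g -> Cc (fun x => f x + g x).
Proof.
move=> Cf Cg; apply: (Cc_dom Cf Cg) => [x|x -> ->]; last by rewrite addr0.
by apply: cvgD; exact: Cc_continuous.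
Qed.

Lemma CcN f : Cc f -> Cc (fun x => - f x).
Proof.
move=> Cf; apply: (Cc_dom Cf Cf) => [x|x ->]; last by rewrite oppr0.
by apply: cvgN; exact: Cc_continuous.
Qed.

Lemma CcB f g : Cc f -> Cc g -> Cc (fun x => f x - g x).
Proof. by move=> Cf Cg; apply: CcD => //; exact: CcN. Qed.

Lemma Cc_max f g : Cc f -> Cc g -> Cc (fun x => Num.max (f x) (g x)).
Proof.
move=> Cf Cg; apply: (Cc_dom Cf Cg) => [|x -> ->]; last by rewrite maxxx.
by apply: max_fun_continuous; exact: Cc_continuous.
Qed.

Lemma Cc_min f g : Cc f -> Cc g -> Cc (fun x => Num.min (f x) (g x)).
Proof.
move=> Cf Cg; apply: (Cc_dom Cf Cg) => [|x -> ->]; last by rewrite minxx.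
by apply: min_fun_continuous; exact: Cc_continuous.
Qed.

Lemma Cc_abs f : Cc f -> Cc (fun x => `|f x|).
Proof.
move=> Cf; apply: (Cc_dom Cf Cf) => [x|x ->]; last by rewrite normr0.
by apply: cvg_norm; exact: Cc_continuous.
Qed.

Lemma Cc_pos f : Cc f -> Cc f^\+.
Proof. by move=> Cf; apply: Cc_max => //; exact: Cc0. Qed.

Lemma Cc_neg f : Cc f -> Cc f^\-.
Proof. by move=> Cf; apply: Cc_max; [exact: CcN|exact: Cc0]. Qed.

Lemma Cc_bounded f : Cc f -> exists2 M, 0 <= M & forall x, `|f x| <= M.
Proof.
move=> /(CcP _ hT) [cf [K cK fK]].
have [|i j i0 _|x Kx|M /= M0 fM] :=
  @compact_directed_cover T R [set M | 0 <= M] (fun M x => `|f x| <= M) K _ _ cK.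
- by exists 0 => /=.
- exists (Num.max i j); first by rewrite /= le_max i0.
  by move=> x [] fx; rewrite le_max fx ?orbT.
- exists (`|f x| + 1); first by rewrite /= addr_ge0.
  near=> y; apply: ltW; near: y.
  have : (fun y => `|f y|) @ x --> `|f x| by apply: cvg_norm; exact: cf.
  by move=> /cvgr_lt; apply; rewrite ltrDl.
exists M => // x; have [/fM //|/fK ->] := pselect (K x).
by rewrite normr0.
Unshelve. all: end_near. Qed.

Hypothesis lT : locally_compact [set: T].

(** Urysohn's lemma for locally compact spaces. Complete regularity separates only points from
    closed sets; maxima of the resulting functions exceed 1/2 on all of [K], and doubling and
    truncating at 1 gives the exact value 1. *)
Lemma Cc_bump (K U : set T) : compact K -> open U -> K `<=` U ->
  exists F : T -> R, [/\ Cc F, forall x, 0 <= F x <= 1,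
    forall x, K x -> F x = 1 & forall x, ~ U x -> F x = 0].
Proof.
move=> cK oU KU.
pose D := [set F : T -> R | [/\ Cc F, forall x, 0 <= F x <= 1
   & forall x, ~ U x -> F x = 0]].
have [||x Kx|F [CF F01 FU] KF] :=
  @compact_directed_cover T _ D (fun F x => 1 < 2 * F x) K _ _ cK.
- exists (fun=> 0); split => //; first exact: Cc0.
  by move=> x; rewrite lexx ler01.
- move=> f g [Cf f01 fU] [Cg g01 gU].
  exists (fun x => Num.max (f x) (g x)); last first.
    move=> x [] /lt_le_trans; apply; rewrite ler_pM2l// le_max lexx//.
    by rewrite orbT.
  split; first exact: Cc_max.
    move=> x; have /andP[f0 f1] := f01 x; have /andP[g0 g1] := g01 x.
    by rewrite le_max f0 ge_max f1 g1.
  by move=> x /[dup] /fU -> /gU ->; rewrite maxxx.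
(* Separating [x] from the complement of [U] and of the interior of a compact neighbourhood [V]
   makes the function vanish off [U] and have compact support. *)
- have [V + [cV clV]] := @lT x I; rewrite withinET => Vx.
  have := @locally_compact_completely_regular T R lT hT x
    (~` (U `&` interior V)).
  case=> [||uT [E UE]].
  - by apply: open_closedC; apply: openI => //; exact: open_interior.
  - by apply; split; [exact: KU|exact: Vx].
  have /(@uniform_separatorP _ R) [f [cf f01 f0 f1]] :
    uniform_separator [set x] (~` (U `&` interior V)) by exists uT, E.
  have f1' y : ~ (U `&` interior V) y -> 1 - f y = 0.
    by move=> Ny; rewrite (f1 (f y)) ?subrr//; exists y.
  have cf1 : continuous (fun y => 1 - f y).
    by move=> y; apply: cvgB; [exact: cvg_cst|exact: cf].
  exists (fun y => 1 - f y).
    split.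
    - apply/(CcP _ hT); split => //; exists V => // y Vy; apply: f1' => -[_].
      by move/interior_subset.
    - move=> y; have /= := f01 (f y); rewrite in_itv/= => /(_ _)/andP[].
        by exists y.
      by move=> a b; rewrite subr_ge0 b gerBl a.
    - by move=> y Uy; apply: f1' => -[].
  have : (fun y => 2 * (1 - f y)) @ x --> 2 * (1 - f x).
    by apply: cvgM; [exact: cvg_cst|exact: cf1].
  rewrite (f0 (f x)); last by exists x.
  by move=> /cvgr_gt; apply; lra.
exists (fun x => Num.min (2 * F x) 1); split.
- apply: (Cc_dom CF CF).
    apply: min_fun_continuous => x; last exact: cvg_cst.
    by apply: cvgM; [exact: cvg_cst|exact: Cc_continuous].
  by move=> x -> _; rewrite mulr0 minEle ler01.
- move=> x; have /andP[F0 F1] := F01 x.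
  by rewrite le_min ler01 ge_min lexx orbT !andbT mulr_ge0.
- by move=> x /KF Fx; rewrite minEle leNgt Fx.
- by move=> x /FU ->; rewrite mulr0 minEle ler01.
Unshelve. all: end_near. Qed.

End Cc_theory.

(** * Linear forms on Cc and their Jordan decomposition *)

Section functionals.
Context {R : realType} {T : topologicalType}.
Hypotheses (hT : hausdorff_space T) (lT : locally_compact [set: T]).
Implicit Types (nu : (T -> R) -> R) (f g phi : T -> R) (h : T -> \bar R).

Definition linear_Cc nu := forall (c : R) f1 f2, Cc f1 -> Cc f2 ->
  nu (fun x => c * f1 x + f2 x) = c * nu f1 + nu f2.

Definition posf nu := radon nu /\ nonneg_measure nu.

(** Functionals are total on [T -> R] but meaningful on [Cc] only, so this relation plays the role
    of equality of measures. *)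
Definition eq_Cc nu nu1 := forall f, Cc f -> nu f = nu1 f.

Lemma eq_Cc_sym nu nu1 : eq_Cc nu nu1 -> eq_Cc nu1 nu.
Proof. by move=> e f Cf; rewrite e. Qed.

Lemma radon_linear nu : radon nu -> linear_Cc nu. Proof. by case. Qed.

Section linear.
Variable nu : (T -> R) -> R.
Hypothesis lnu : linear_Cc nu.

Lemma lin0 : nu (fun=> 0) = 0.
Proof.
have C0 := @Cc0 R _ hT.
have := lnu (-1) C0 C0.
rewrite (_ : (fun x => _) = fun=> 0); last by apply/funext => x; rewrite mulr0 addr0.
by rewrite mulN1r addNr.
Qed.

Lemma linZ c f : Cc f -> nu (fun x => c * f x) = c * nu f.
Proof.
move=> Cf; have := lnu c Cf (@Cc0 R _ hT); rewrite lin0 addr0 => <-.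
by congr nu; apply/funext => x; rewrite addr0.
Qed.

Lemma linD f g : Cc f -> Cc g -> nu (fun x => f x + g x) = nu f + nu g.
Proof.
move=> Cf Cg; rewrite -[nu f]mul1r -lnu//.
by congr nu; apply/funext => x; rewrite mul1r.
Qed.

Lemma linN f : Cc f -> nu (fun x => - f x) = - nu f.
Proof.
by move=> Cf; rewrite -mulN1r -linZ//; congr nu; apply/funext => x; rewrite mulN1r.
Qed.

Lemma linB f g : Cc f -> Cc g -> nu (fun x => f x - g x) = nu f - nu g.
Proof.
move=> Cf Cg; rewrite (@linD f (fun x => - g x)) ?linN//.
exact: CcN.
Qed.

Lemma linear_eq nu1 : eq_Cc nu nu1 -> linear_Cc nu1.
Proof.
move=> e c f g Cf Cg; rewrite -!e//; first exact: lnu.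
by apply: CcD => //; exact: CcZ.
Qed.

Hypothesis pnu : nonneg_measure nu.

Lemma lin_le f g : Cc f -> Cc g -> (forall x, f x <= g x) -> nu f <= nu g.
Proof.
move=> Cf Cg fg; rewrite -subr_ge0 -linB//; apply: pnu; first exact: CcB.
by move=> x; rewrite subr_ge0.
Qed.

Lemma lin_norm_le f g : Cc f -> Cc g -> (forall x, `|f x| <= g x) ->
  `|nu f| <= nu g.
Proof.
move=> Cf Cg fg; rewrite ler_norml -linN//.
by apply/andP; split; apply: lin_le => //; (try exact: CcN) => x;
  have := fg x; rewrite ler_norml => /andP[].
Qed.

(** Positivity implies the local bound: a bump equal to 1 on [K], multiplied by [b], dominates
    [|f|]. *)
Lemma pos_radon : posf nu.
Proof.
split=> //; split=> // K cK.
have [F [CF F01 F1 _]] := @Cc_bump R _ hT lT K setT cK openT (@subsetT _ _).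
exists (nu F) => f b Cf fK fb.
rewrite mulrC -linZ//; apply: lin_norm_le => //; first exact: CcZ.
move=> x; have [Kx|nKx] := pselect (K x); first by rewrite F1// mulr1.
have -> : f x = 0 by apply: contra_notP nKx => /eqP fx; exact: fK.
rewrite normr0 mulr_ge0//; last by case/andP: (F01 x).
by apply: le_trans (fb x).
Qed.

End linear.

Lemma posf_linear nu : posf nu -> linear_Cc nu. Proof. by case=> [[]]. Qed.

Lemma posf_le nu f g : posf nu -> Cc f -> Cc g -> (forall x, f x <= g x) ->
  nu f <= nu g.
Proof. by move=> [[l _] p]; exact: lin_le. Qed.

Lemma posf_eq nu nu1 : eq_Cc nu nu1 -> posf nu -> posf nu1.
Proof.
move=> e [[l _] p]; apply: pos_radon; first exact: (linear_eq l).
by move=> f Cf f0; rewrite -e//; exact: p.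
Qed.

Lemma posf0 : posf (fun=> 0).
Proof. by apply: pos_radon => // c f g _ _; rewrite mulr0 addr0. Qed.

Lemma posfD nu nu1 : posf nu -> posf nu1 -> posf (fun f => nu f + nu1 f).
Proof.
move=> [[l _] p] [[l1 _] p1]; apply: pos_radon.
  by move=> c f g Cf Cg; rewrite l// l1//; ring.
by move=> f Cf f0; rewrite addr_ge0//; [exact: p|exact: p1].
Qed.

Lemma posfZ c nu : 0 <= c -> posf nu -> posf (fun f => c * nu f).
Proof.
move=> c0 [[l _] p]; apply: pos_radon.
  by move=> d f g Cf Cg; rewrite l//; ring.
by move=> f Cf f0; rewrite mulr_ge0//; exact: p.
Qed.

Lemma radon_sub nu nu1 : posf nu -> posf nu1 -> radon (fun f => nu f - nu1 f).
Proof.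
move=> [[l r] p] [[l1 r1] p1]; split.
  by move=> c f g Cf Cg; rewrite l// l1//; ring.
move=> K cK; have [M hM] := r K cK; have [M1 hM1] := r1 K cK.
exists (M + M1) => f b Cf fK fb; apply: le_trans (ler_normB _ _) _.
by rewrite mulrDl lerD//; [exact: hM|exact: hM1].
Qed.

Lemma radon_opp nu : radon nu -> radon (fun f => - nu f).
Proof.
move=> [l r]; split; first by move=> c f g Cf Cg; rewrite l//; ring.
move=> K cK; have [M hM] := r K cK; exists M => f b Cf fK fb.
by rewrite normrN hM.
Qed.

Lemma radon_eq nu nu1 : eq_Cc nu nu1 -> radon nu -> radon nu1.
Proof.
move=> e [l r]; split; first exact: (linear_eq l).
move=> K cK; have [M hM] := r K cK; exists M => f b Cf fK fb.
by rewrite -e// hM.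
Qed.

(** Serves twice: for the positive part [mpos], where [S] is a supremum, and for the restriction to
    a compact set, where it is an infimum. *)
Lemma cone_extension (S : (T -> R) -> R) :
  (forall f g, Cc f -> Cc g -> (forall x, 0 <= f x) -> (forall x, 0 <= g x) ->
     S (fun x => f x + g x) = S f + S g) ->
  (forall c f, 0 <= c -> Cc f -> (forall x, 0 <= f x) ->
     S (fun x => c * f x) = c * S f) ->
  (forall f, Cc f -> (forall x, 0 <= f x) -> 0 <= S f) ->
  posf (fun f => S f^\+ - S f^\-) /\
  (forall f, Cc f -> (forall x, 0 <= f x) -> S f^\+ - S f^\- = S f).
Proof.
move=> SD SZ S0.
have SE f : Cc f -> (forall x, 0 <= f x) -> S f^\+ - S f^\- = S f.
  move=> Cf f0; have -> : f^\+ = f by apply/funext => x; rewrite /funrpos max_l.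
  have -> : f^\- = (fun x => 0 * f x).
    by apply/funext => x; rewrite /funrneg max_r ?mul0r// oppr_le0.
  by rewrite SZ// mul0r subr0.
split=> //; apply: pos_radon; last first.
  by move=> f Cf f0; rewrite SE//; exact: S0.
have pn (f : T -> R) x : f x = f^\+ x - f^\- x.
  by rewrite -[in LHS](funrposBneg f).
have D3 f1 f2 f3 : Cc f1 -> Cc f2 -> Cc f3 -> (forall x, 0 <= f1 x) ->
    (forall x, 0 <= f2 x) -> (forall x, 0 <= f3 x) ->
    S (fun x => f1 x + f2 x + f3 x) = S f1 + S f2 + S f3.
  move=> C1 C2 C3 p1 p2 p3; rewrite (SD (fun x => f1 x + f2 x))//.
  - by rewrite SD.
  - exact: CcD.
  - by move=> x; rewrite addr_ge0.
move=> c f1 f2 C1 C2; set k := fun x => _.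
have Ck : Cc k by apply: CcD => //; exact: CcZ.
have [c0|c0] := leP 0 c.
  (* The relation defining [k] is rearranged into an equality between sums of nonnegative functions,
     where [S] is additive. For negative [c] the two parts of [f1] exchange places. *)
  have : S (fun x => c * f1^\+ x + f2^\+ x + k^\- x) =
         S (fun x => c * f1^\- x + f2^\- x + k^\+ x).
    congr S; apply/funext => x.
    by have := pn k x; rewrite {1}/k (pn f1) (pn f2); lra.
  rewrite !D3 ?SZ//.
  all: try by [exact: Cc_pos|exact: Cc_neg|apply: CcZ => //; exact: Cc_pos
    |apply: CcZ => //; exact: Cc_neg|move=> x; rewrite mulr_ge0].
  by lra.
have {}c0 : 0 <= - c by lra.
have : S (fun x => - c * f1^\- x + f2^\+ x + k^\- x) =
       S (fun x => - c * f1^\+ x + f2^\- x + k^\+ x).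
  congr S; apply/funext => x.
  by have := pn k x; rewrite {1}/k (pn f1) (pn f2); lra.
rewrite !D3 ?SZ//.
all: try by [exact: Cc_pos|exact: Cc_neg|apply: CcZ => //; exact: Cc_pos
  |apply: CcZ => //; exact: Cc_neg|move=> x; rewrite mulr_ge0].
by lra.
Qed.

Lemma sup_below_has_sup nu f : radon nu -> Cc f -> (forall x, 0 <= f x) ->
  has_sup [set nu phi | phi in [set phi | Cc phi /\ forall x, 0 <= phi x <= f x]].
Proof.
move=> [l r] Cf f0; split.
  exists (nu (fun=> 0)); exists (fun=> 0) => //; split; first exact: Cc0.
  by move=> x; rewrite lexx f0.
have [M M0 fM] := Cc_bounded hT Cf.
have [_ [K cK fK]] := (CcP _ hT).1 Cf.
have [N hN] := r K cK.
exists (N * M) => _ [phi [Cphi phif] <-]; apply: le_trans (ler_norm _) _.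
apply: hN => // x; have /andP[p0 pf] := phif x.
  move=> /= /eqP px; apply: contra_notP px => /fK fx.
  by apply/eqP; rewrite eq_le p0 andbT -fx.
by rewrite ger0_norm// (le_trans pf)// (le_trans (ler_norm _) (fM x)).
Qed.

Lemma sup_below_ge nu f phi : radon nu -> Cc f -> Cc phi ->
  (forall x, 0 <= phi x <= f x) -> nu phi <= sup_below nu f.
Proof.
move=> rnu Cf Cphi phif; apply: ub_le_sup; last by exists phi.
apply: (sup_below_has_sup rnu Cf _).2 => x.
by have /andP[] := phif x; exact: le_trans.
Qed.

Lemma sup_below_le nu f (M : R) : (forall x, 0 <= f x) ->
  (forall phi, Cc phi -> (forall x, 0 <= phi x <= f x) -> nu phi <= M) ->
  sup_below nu f <= M.
Proof.
move=> f0 H; apply: ge_sup.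
  exists (nu (fun=> 0)); exists (fun=> 0) => //; split; first exact: Cc0.
  by move=> x; rewrite lexx f0.
by move=> _ [phi [Cphi phif] <-]; exact: H.
Qed.

Lemma sup_below_approx nu f (e : R) : radon nu -> Cc f -> (forall x, 0 <= f x) ->
  0 < e -> exists2 phi, Cc phi /\ (forall x, 0 <= phi x <= f x) &
    sup_below nu f - e < nu phi.
Proof.
move=> rnu Cf f0 e0.
have [_ [phi Hphi <-] ?] := sup_adherent e0 (sup_below_has_sup rnu Cf f0).
by exists phi.
Qed.

Lemma mpos_posf nu : radon nu -> posf (mpos nu) /\
  forall f, Cc f -> (forall x, 0 <= f x) -> mpos nu f = sup_below nu f.
Proof.
move=> rnu; have l := rnu.1; apply: cone_extension.
- move=> f g Cf Cg f0 g0; apply/eqP; rewrite eq_le; apply/andP; split.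
    apply: sup_below_le => [x|phi Cphi phifg]; first by rewrite addr_ge0.
    (* Riesz decomposition: a function between 0 and [f + g] is the sum of one below [f] and one
       below [g]. *)
    have C1 : Cc (fun x => Num.min (phi x) (f x)) by exact: Cc_min.
    have C2 : Cc (fun x => phi x - Num.min (phi x) (f x)) by exact: CcB.
    have -> : phi = fun x => Num.min (phi x) (f x) +
                             (phi x - Num.min (phi x) (f x)).
      by apply/funext => x; rewrite addrC subrK.
    rewrite linD// lerD//; apply: sup_below_ge => // x;
      have /andP[p0 pfg] := phifg x.
      by rewrite le_min p0 f0/= ge_min lexx orbT.
    by rewrite subr_ge0 ge_min lexx/= minElt; case: ltP => ?; rewrite ?subrr//; lra.
  apply/ler_addgt0Pr => e e0; have e20 : 0 < e / 2 by lra.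
  have [p [Cp pf] hp] := sup_below_approx rnu Cf f0 e20.
  have [q [Cq qg] hq] := sup_below_approx rnu Cg g0 e20.
  have : nu (fun x => p x + q x) <= sup_below nu (fun x => f x + g x).
    apply: sup_below_ge => //; [exact: CcD|exact: CcD|move=> x].
    have /andP[? ?] := pf x; have /andP[? ?] := qg x.
    by rewrite addr_ge0//= lerD.
  by rewrite linD//; lra.
- move=> c f c0 Cf f0; have [->|cn0] := eqVneq c 0.
    rewrite mul0r; apply/eqP; rewrite eq_le; apply/andP; split.
      apply: sup_below_le => [x|phi Cphi phi0]; first by rewrite mul0r.
      rewrite (_ : phi = fun=> 0) ?lin0//; apply/funext => x; apply/eqP.
      by have := phi0 x; rewrite mul0r eq_le andbC.
    rewrite -[leLHS](lin0 l); apply: sup_below_ge => //; [exact: CcZ|exact: Cc0|].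
    by move=> x; rewrite mul0r lexx.
  have {cn0}c0 : 0 < c by rewrite lt_neqAle eq_sym cn0.
  apply/eqP; rewrite eq_le; apply/andP; split.
    apply: sup_below_le => [x|phi Cphi phif]; first by rewrite mulr_ge0// ltW.
    have -> : phi = fun x => c * (c^-1 * phi x).
      by apply/funext => x; rewrite mulrA divff ?mul1r// gt_eqF.
    rewrite linZ//; last exact: CcZ.
    rewrite ler_pM2l//; apply: sup_below_ge => //; first exact: CcZ.
    move=> x; have /andP[p0 pf] := phif x.
    by rewrite ler_pdivrMl// pf andbT mulr_ge0// invr_ge0 ltW.
  rewrite mulrC -ler_pdivlMr//; apply: sup_below_le => // phi Cphi phif.
  rewrite ler_pdivlMr// mulrC -linZ//; apply: sup_below_ge => //; try exact: CcZ.
  move=> x; have /andP[p0 pf] := phif x.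
  by rewrite ler_pM2l// pf mulr_ge0// ltW.
- move=> f Cf f0; rewrite -(lin0 l); apply: sup_below_ge => //.
    exact: Cc0.
  by move=> x; rewrite lexx f0.
Qed.

Lemma mposP nu : radon nu -> posf (mpos nu).
Proof. by move=> /mpos_posf[]. Qed.

Lemma mposE nu f : radon nu -> Cc f -> (forall x, 0 <= f x) ->
  mpos nu f = sup_below nu f.
Proof. by move=> /mpos_posf[_]; exact. Qed.

Lemma mnegP nu : radon nu -> posf (mneg nu).
Proof. by move=> /radon_opp/mposP. Qed.

Lemma eq_Cc_ge0 nu nu1 : linear_Cc nu -> linear_Cc nu1 ->
  (forall f, Cc f -> (forall x, 0 <= f x) -> nu f = nu1 f) -> eq_Cc nu nu1.
Proof.
move=> l l1 e f Cf; rewrite (_ : f = fun x => f^\+ x - f^\- x); last first.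
  by apply/funext => x; rewrite -[in LHS](funrposBneg f).
by rewrite !linB ?e//; try exact: Cc_pos; exact: Cc_neg.
Qed.

(** The substitution of [f - phi] for [phi] turns the supremum defining the negative part into the
    one defining the positive part, shifted by [nu f]. *)
Lemma jordan nu : radon nu -> eq_Cc nu (fun f => mpos nu f - mneg nu f).
Proof.
move=> rnu; have rN := radon_opp rnu; have l := rnu.1.
apply: eq_Cc_ge0 => //.
  have [[lp _] _] := mposP rnu; have [[ln _] _] := mnegP rnu.
  by move=> c f g Cf Cg; rewrite lp// ln//; ring.
move=> f Cf f0; rewrite /mneg !mposE//.
suff : sup_below (fun f => - nu f) f = sup_below nu f - nu f by move=> ->; ring.
apply/eqP; rewrite eq_le; apply/andP; split.
  apply: sup_below_le => // phi Cphi phif.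
  have := sup_below_ge rnu Cf (CcB hT Cf Cphi); rewrite linB// => H.
  suff {H}/H : forall x, 0 <= f x - phi x <= f x by lra.
  by move=> x; have /andP[? ?] := phif x; rewrite subr_ge0 gerBl; apply/andP.
rewrite lerBlDr; apply: sup_below_le => // phi Cphi phif.
have := sup_below_ge rN Cf (CcB hT Cf Cphi); rewrite linB// => H.
suff {H}/H : forall x, 0 <= f x - phi x <= f x by lra.
by move=> x; have /andP[? ?] := phif x; rewrite subr_ge0 gerBl; apply/andP.
Qed.

(** Mutual singularity without measurable sets: every nonnegative [f] splits into a part [u] almost
    null for [nu1] and a part [f - u] almost null for [nu]. *)
Definition singular nu nu1 := forall f (e : R), Cc f -> (forall x, 0 <= f x) ->
  0 < e -> exists u, [/\ Cc u, forall x, 0 <= u x <= f x, nu1 u <= e &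
    nu (fun x => f x - u x) <= e].

(** Take [u] nearly attaining the supremum that defines [mpos nu f]: both quantities to be bounded
    are at most [mpos nu f - nu u]. *)
Lemma singular_jordan nu : radon nu -> singular (mpos nu) (mneg nu).
Proof.
move=> rnu f e Cf f0 e0.
have [u [Cu uf] hu] := sup_below_approx rnu Cf f0 e0.
have u0 x : 0 <= u x by have /andP[] := uf x.
have fu0 x : 0 <= f x - u x by have /andP[_] := uf x; rewrite subr_ge0.
have mu_u : sup_below nu u <= sup_below nu f.
  apply: sup_below_le => // phi Cphi phiu; apply: sup_below_ge => // x.
  by have /andP[-> /le_trans->] := phiu x; have /andP[] := uf x.
have pu := jordan rnu Cu; have pf := jordan rnu Cf.
have := mposE rnu Cu u0; have := mposE rnu Cf f0.
have [[lp _] _] := mposP rnu.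
have nun : nu u <= mpos nu u.
  by rewrite mposE//; apply: sup_below_ge => // x; rewrite lexx u0.
exists u; split => //; first by lra.
by rewrite linB//; lra.
Qed.

(** Uniqueness of the Jordan decomposition: a singular representation identifies [mpos], which is
    otherwise accessible only as a supremum. *)
Lemma singularE nu P Q : posf P -> posf Q -> singular P Q ->
  eq_Cc nu (fun f => P f - Q f) -> eq_Cc (mpos nu) P.
Proof.
move=> pP pQ sPQ e; have rnu : radon nu.
  by apply: (radon_eq (eq_Cc_sym e)); exact: radon_sub.
apply: eq_Cc_ge0; [exact: posf_linear (mposP rnu)|exact: posf_linear|].
move=> f Cf f0; rewrite mposE//; apply/eqP; rewrite eq_le; apply/andP; split.
  apply: sup_below_le => // phi Cphi phif; rewrite e//.
  have := @posf_le _ phi f pP Cphi Cf; have := pQ.2 phi Cphi.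
  move=> /(_ (fun x => proj1 (andP (phif x)))).
  by move=> ? /(_ (fun x => proj2 (andP (phif x)))); lra.
apply/ler_addgt0Pr => d d0; have d20 : 0 < d / 2 by lra.
have [u [Cu uf Qu Pu]] := sPQ f _ Cf f0 d20.
have := sup_below_ge rnu Cf Cu uf; rewrite e//.
by move: Pu; rewrite linB//; [lra|exact: posf_linear].
Qed.

Lemma singular_sym P Q : posf P -> posf Q -> singular P Q -> singular Q P.
Proof.
move=> [[lP _] _] [[lQ _] _] s f e Cf f0 e0.
have [u [Cu uf Qu Pu]] := s f e Cf f0 e0.
exists (fun x => f x - u x); split=> //; first exact: CcB.
  by move=> x; have /andP[? ?] := uf x; rewrite subr_ge0 gerBl; apply/andP.
rewrite (_ : (fun x => _) = u)//.
by apply/funext => x; rewrite opprB addrC subrK.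
Qed.

(** Minimality of the Jordan decomposition among all representations as a difference of positive
    forms. *)
Lemma mpos_le nu P Q : posf P -> posf Q -> eq_Cc nu (fun f => P f - Q f) ->
  posf (fun f => P f - mpos nu f).
Proof.
move=> pP pQ e; have rnu : radon nu.
  by apply: (radon_eq (eq_Cc_sym e)); exact: radon_sub.
have [lr _] := radon_sub pP (mposP rnu).
apply: pos_radon => // f Cf f0; rewrite subr_ge0 mposE//.
apply: sup_below_le => // phi Cphi phif; rewrite e//.
have := @posf_le _ phi f pP Cphi Cf; have := pQ.2 phi Cphi.
move=> /(_ (fun x => proj1 (andP (phif x)))).
by move=> ? /(_ (fun x => proj2 (andP (phif x)))); lra.
Qed.

End functionals.

(** * Integration of lower semicontinuous functions *)

Section ereal_aux.
Context {R : realType}.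
Implicit Types (x y : \bar R) (r : R).

Lemma lee_ltP x y : (forall r, (r%:E < x)%E -> (r%:E <= y)%E) -> (x <= y)%E.
Proof.
case: x => [x||] H; last by rewrite leNye.
- case: y H => [y||] H; last first.
  + by have := H (x - 1); rewrite lte_fin ltrBlDr ltrDl ltr01 => /(_ isT).
  + by rewrite leey.
  + rewrite lee_fin leNgt; apply/negP => yx.
    have /H : (((x + y) / 2)%:E < x%:E)%E by rewrite lte_fin; lra.
    by rewrite lee_fin; lra.
- case: y H => [y||] // H; last by have := H 0; rewrite ltry => /(_ isT).
  by have := H (y + 1); rewrite ltry lee_fin gerDl ler10 => /(_ isT).
Qed.

Lemma lte_add_split x y r : (-oo < x)%E -> (-oo < y)%E -> (r%:E < x + y)%E ->
  exists r1 r2 : R, [/\ (r1%:E < x)%E, (r2%:E < y)%E & r = r1 + r2].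
Proof.
case: x => [x||]//; case: y => [y||]// _ _.
- rewrite -EFinD lte_fin => rxy; exists (x - (x + y - r) / 2), (y - (x + y - r) / 2).
  by rewrite !lte_fin; split; lra.
- move=> _; exists (x - 1), (r - (x - 1)).
  by rewrite lte_fin ltry; split=> //; lra.
- move=> _; exists (r - (y - 1)), (y - 1).
  by rewrite lte_fin ltry; split=> //; lra.
- by move=> _; exists r, 0; rewrite !ltry addr0.
Qed.

End ereal_aux.

Section integrals.
Context {R : realType} {T : topologicalType}.
Hypotheses (hT : hausdorff_space T) (lT : locally_compact [set: T]).
Implicit Types (nu : (T -> R) -> R) (f g phi : T -> R) (h : T -> \bar R).
Local Notation Int := pos_integral.

(** Unites the two cases in the definition of a kernel: a nonnegative function has the minorant 0,
    and on a compact space constants lie in [Cc]. It keeps integrals away from [-oo]. *)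
Definition Cc_bounded_below h := exists2 chi : T -> R, Cc chi &
  forall x, ((chi x)%:E <= h x)%E.

Lemma Cc_bounded_below_ge0 h : (forall x, (0 <= h x)%E) -> Cc_bounded_below h.
Proof. by move=> h0; exists (fun=> 0) => //; exact: Cc0. Qed.

Lemma int_ub nu h phi : Cc phi -> (forall x, ((phi x)%:E <= h x)%E) ->
  ((nu phi)%:E <= Int nu h)%E.
Proof. by move=> Cphi phih; apply: ereal_sup_ubound; exists phi. Qed.

Lemma int_le nu h y :
  (forall phi, Cc phi -> (forall x, ((phi x)%:E <= h x)%E) ->
    ((nu phi)%:E <= y)%E) -> (Int nu h <= y)%E.
Proof. by move=> H; apply: ge_ereal_sup => _ [phi [? ?] <-]; exact: H. Qed.

Lemma int_gt nu h (r : R) : (r%:E < Int nu h)%E ->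
  exists2 phi, Cc phi /\ (forall x, ((phi x)%:E <= h x)%E) & r < nu phi.
Proof. by move=> /ereal_sup_gt[_ [phi Hphi <-]] rphi; exists phi. Qed.

Lemma int_gtNy nu h : Cc_bounded_below h -> (-oo < Int nu h)%E.
Proof.
move=> [chi Cchi chih]; apply: lt_le_trans (int_ub nu Cchi chih).
exact: ltNyr.
Qed.

Lemma int_fin nu h : Cc_bounded_below h -> (Int nu h < +oo)%E ->
  Int nu h \is a fin_num.
Proof. by move=> ch ?; rewrite fin_real// int_gtNy. Qed.

Lemma int_ge0 nu h : linear_Cc nu -> (forall x, (0 <= h x)%E) ->
  (0 <= Int nu h)%E.
Proof.
move=> l h0; have := int_ub nu (@Cc0 R _ hT) h0.
by rewrite lin0.
Qed.

Lemma int_mono nu h1 h2 : (forall x, (h1 x <= h2 x)%E) ->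
  (Int nu h1 <= Int nu h2)%E.
Proof.
move=> h12; apply: int_le => phi Cphi phih; apply: int_ub => // x.
exact: le_trans (h12 x).
Qed.

Lemma int_eq_Cc nu nu1 h : eq_Cc nu nu1 -> Int nu h = Int nu1 h.
Proof.
by move=> e; congr ereal_sup; apply/seteqP; split=> _ [phi [Cphi ?] <-];
  exists phi; rewrite ?e.
Qed.

Lemma int_EFin nu f : posf nu -> Cc f -> Int nu (EFin \o f) = (nu f)%:E.
Proof.
move=> pnu Cf; apply/eqP; rewrite eq_le int_ub ?andbT//.
by apply: int_le => phi Cphi phif; rewrite lee_fin; apply: posf_le => // x;
  rewrite -lee_fin; exact: phif.
Qed.

Lemma int0 h : Cc_bounded_below h -> Int (fun=> 0) h = 0%E.
Proof.
move=> [chi Cchi chih]; apply/eqP; rewrite eq_le; apply/andP; split.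
  exact: int_le.
exact: (int_ub (fun=> 0) Cchi chih).
Qed.

Lemma int_addf nu nu1 h : posf nu -> posf nu1 -> Cc_bounded_below h ->
  Int (fun f => nu f + nu1 f) h = (Int nu h + Int nu1 h)%E.
Proof.
move=> pnu pnu1 ch; apply/eqP; rewrite eq_le; apply/andP; split.
  by apply: int_le => phi Cphi phih; rewrite EFinD leeD// int_ub.
apply: lee_ltP => r /lte_add_split; move=> /(_ (int_gtNy _ ch) (int_gtNy _ ch)).
move=> [r1 [r2 [/int_gt[p [Cp ph] rp] /int_gt[q [Cq qh] rq] ->]]].
(* The maximum of the two near-optimal minorants is again a minorant of [h] and serves both measures
   at once. *)
have Cm : Cc (fun x => Num.max (p x) (q x)) by exact: Cc_max.
apply: le_trans (int_ub _ Cm _); last first.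
  by move=> x; rewrite EFin_max ge_max ph qh.
rewrite lee_fin lerD//; [apply: le_trans (ltW rp) _|apply: le_trans (ltW rq) _];
  by apply: posf_le => // x; rewrite le_max lexx ?orbT.
Qed.

Lemma int_scalef nu c h : 0 < c -> posf nu ->
  Int (fun f => c * nu f) h = (c%:E * Int nu h)%E.
Proof.
move=> c0 pnu; apply/eqP; rewrite eq_le; apply/andP; split.
  by apply: int_le => phi Cphi phih; rewrite EFinM lee_pmul2l ?lte_fin// int_ub.
rewrite -lee_pdivlMl//; apply: int_le => phi Cphi phih.
by rewrite lee_pdivlMl// -EFinM; exact: (int_ub (fun f => c * nu f)).
Qed.

Lemma int_scale nu c h : 0 < c -> posf nu ->
  Int nu (fun x => c%:E * h x)%E = (c%:E * Int nu h)%E.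
Proof.
move=> c0 pnu; have l := posf_linear pnu.
apply/eqP; rewrite eq_le; apply/andP; split.
  apply: int_le => phi Cphi phih; rewrite -lee_pdivrMl// -EFinM -linZ//.
  by apply: int_ub => [|x]; [exact: CcZ|rewrite EFinM lee_pdivrMl].
rewrite -lee_pdivlMl//; apply: int_le => phi Cphi phih.
rewrite lee_pdivlMl// -EFinM -linZ//; apply: int_ub => [|x]; first exact: CcZ.
by rewrite EFinM lee_pmul2l.
Qed.

(* Dini's argument: off a compact set containing the supports of [phi] and [chi]
   both vanish, and the members of [D] may be assumed to lie above [chi]. *)
Lemma directed_Cc_approx nu (D : set (T -> R)) phi (e : R) : posf nu ->
  D !=set0 -> (forall f, D f -> Cc f) ->
  (forall f g, D f -> D g ->
     exists2 k, D k & forall x, f x <= k x /\ g x <= k x) ->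
  Cc phi -> (forall x r, r < phi x -> exists2 f, D f & r < f x) -> 0 < e ->
  exists2 f, D f & nu phi <= nu f + e.
Proof.
move=> pnu [chi Dchi] DCc Ddir Cphi phiD e0; have l := posf_linear pnu.
have [_ [K cK phiK]] := (CcP _ hT).1 Cphi.
have [_ [L cL chiL]] := (CcP _ hT).1 (DCc _ Dchi).
have [F [CF F01 F1 _]] := @Cc_bump R _ hT lT (K `|` L) setT (compactU cK cL)
  openT (@subsetT _ _).
have F0 : 0 <= nu F by apply: pnu.2 => // x; case/andP: (F01 x).
(* A pointwise error [d] on the compact set costs at most [d * nu F <= e]; the [+ 1] guards against
   [nu F = 0]. *)
pose d := e / (nu F + 1).
have d0 : 0 < d by rewrite divr_gt0// ltr_wpDl.
pose D' := [set f | D f /\ forall x, chi x <= f x].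
have [|||f [Df chif] Kf] := @compact_directed_cover T _ D'
    (fun f x => phi x - d < f x) (K `|` L) _ _ (compactU cK cL).
- by exists chi.
- move=> f g [Df cf] [Dg cg]; have [k Dk fgk] := Ddir f g Df Dg.
  exists k; first by split=> // x; rewrite (le_trans (cf x))//; case: (fgk x).
  by move=> x []/lt_le_trans; apply; case: (fgk x).
- move=> x _; have [f Df fx] := phiD x (phi x - d) (ltac:(by rewrite ltrBlDr ltrDl)).
  have [k Dk fck] := Ddir f chi Df Dchi.
  exists k; first by split=> // y; case: (fck y).
  have : (fun y => k y - phi y) @ x --> k x - phi x.
    by apply: cvgB; apply: Cc_continuous => //; exact: DCc.
  move=> /cvgr_gt /(_ (- d)); have [fk _] := fck x.
  rewrite ltrBrDr addrC (lt_le_trans fx)// => /(_ isT).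
  by apply: filterS => y; rewrite ltrBrDr addrC.
exists f => //; have Cf := DCc _ Df.
have : nu phi <= nu (fun x => d * F x + f x).
  apply: posf_le => //; first by apply: CcD => //; exact: CcZ.
  move=> x; have [Kx|] := pselect ((K `|` L) x).
    by rewrite F1// mulr1 -lerBlDl ltW// Kf.
  move=> /not_orP[/phiK -> /chiL chix].
  rewrite addr_ge0//; last by rewrite -chix.
  by rewrite mulr_ge0//; [exact: ltW|case/andP: (F01 x)].
rewrite l// addrC => /le_trans; apply; rewrite lerD2l.
by rewrite /d mulrAC ler_pdivrMr ?ltr_wpDl// ler_pM2l// lerDl.
Qed.

(** The nontrivial half of monotone convergence for directed families: [h] is assumed only to lie
    below the pointwise supremum of [D]. *)
Lemma int_directed_sup nu (D : set (T -> R)) h (r : R) : posf nu ->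
  D !=set0 -> (forall f, D f -> Cc f) ->
  (forall f g, D f -> D g ->
     exists2 k, D k & forall x, f x <= k x /\ g x <= k x) ->
  (forall x (s : R), (s%:E < h x)%E -> exists2 f, D f & s < f x) ->
  (r%:E < Int nu h)%E -> exists2 f, D f & r < nu f.
Proof.
move=> pnu D0 DCc Ddir hD /int_gt[phi [Cphi phih] rphi].
have [||f Df] := @directed_Cc_approx nu D phi ((nu phi - r) / 2) pnu D0 DCc Ddir Cphi.
- by move=> x s sphi; apply: hD; apply: lt_le_trans (phih x); rewrite lte_fin.
- by lra.
by move=> ?; exists f => //; lra.
Qed.

Definition lscb h := lower_semicontinuous h /\ Cc_bounded_below h.

Lemma lscb_approx h x (r : R) : lscb h -> (r%:E < h x)%E ->
  exists2 phi, Cc phi /\ (forall y, ((phi y)%:E <= h y)%E) & r < phi x.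
Proof.
move=> [lh [chi Cchi chih]] rh.
have [s [rs sh]] : exists s : R, r < s /\ (s%:E < h x)%E.
  case: (h x) rh => [y||]//.
    by rewrite lte_fin => ry; exists ((r + y) / 2); rewrite lte_fin; lra.
  by move=> _; exists (r + 1); rewrite ltry; lra.
have oV : open [set y | (s%:E < h y)%E] by move/lower_semicontinuousP : lh.
have [b [Cb b01 b1 bV]] := @Cc_bump R _ hT lT [set x] _ (@compact_set1 _ x) oV
  (ltac:(by move=> _ ->)).
(* The minorant [chi] is raised to the level [s] at [x] by a bump that vanishes off the open set
   where [h > s]; elsewhere it is left unchanged. *)
exists (fun y => Num.max (s - chi y) 0 * b y + chi y).
  split.
    apply: CcD => //; apply: Cc_mul => //; apply: max_fun_continuous => y.
      by apply: cvgB; [exact: cvg_cst|exact: Cc_continuous].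
    exact: cvg_cst.
  move=> y; have /andP[by0 by1] := b01 y.
  have [/= sy|/bV ->] := pselect ((s%:E < h y)%E); last by rewrite mulr0 add0r.
  apply: (@le_trans _ _ (Num.max s (chi y))%:E); last first.
    by rewrite EFin_max ge_max chih ltW.
  rewrite lee_fin; case: (leP (s - chi y) 0) => sc; case: (leP s (chi y)) => ?;
    try (by lra).
  by rewrite -lerBrDr ler_piMr// ltW.
rewrite b1// mulr1; apply: lt_le_trans rs _.
by case: (leP (s - chi x) 0); lra.
Qed.

Lemma lscbD h1 h2 : lscb h1 -> lscb h2 -> lscb (fun x => h1 x + h2 x)%E.
Proof.
move=> [l1 [c1 C1 ch1]] [l2 [c2 C2 ch2]]; split; last first.
  exists (fun x => c1 x + c2 x); first exact: CcD.
  by move=> x; rewrite EFinD leeD.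
move=> x r /lte_add_split; case=> [||r1 [r2 [r1h r2h ->]]].
- exact: lt_le_trans (ltNyr _) (ch1 x).
- exact: lt_le_trans (ltNyr _) (ch2 x).
have [V Vx h1V] := l1 _ _ r1h; have [W Wx h2W] := l2 _ _ r2h.
exists (V `&` W); first exact: filterI.
by move=> y [/h1V ? /h2W ?]; rewrite EFinD lteD.
Qed.

Lemma lscbZ c h : 0 < c -> lscb h -> lscb (fun x => c%:E * h x)%E.
Proof.
move=> c0 [l [chi Cchi chih]]; split; last first.
  exists (fun x => c * chi x); first exact: CcZ.
  by move=> x; rewrite EFinM lee_pmul2l// lte_fin.
move=> x r; rewrite -lte_pdivrMl// => rh.
have [V Vx hV] := l x (c^-1 * r) rh; exists V => // y /hV.
by rewrite EFinM lte_pdivrMl.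
Qed.

Lemma lscb_EFin f : continuous f -> (forall x, 0 <= f x) -> lscb (EFin \o f).
Proof.
move=> cf f0; split; last by apply: Cc_bounded_below_ge0 => x; rewrite lee_fin.
move=> x r; rewrite lte_fin => rf; exists [set y | r < f y].
  by have /cvgr_gt := cf x; apply.
by move=> y /=; rewrite lte_fin.
Qed.

Lemma lscb_Cc f : Cc f -> lscb (EFin \o f).
Proof.
move=> Cf; split; last by exists f.
move=> x r; rewrite lte_fin => rf; exists [set y | r < f y].
  by have /cvgr_gt := @Cc_continuous _ _ _ Cf x; apply.
by move=> y /=; rewrite lte_fin.
Qed.

Lemma lscb_indic (G : set T) : open G -> lscb (EFin \o \1_G).
Proof.
move=> oG; split; last by apply: Cc_bounded_below_ge0 => x; rewrite lee_fin.
move=> x r /=; rewrite lte_fin indicE => rG.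
have [Gx|nGx] := pselect (G x).
  exists G; first exact: open_nbhs_nbhs.
  by move=> y Gy; move: rG; rewrite lte_fin indicE !mem_set.
exists setT; first exact: filterT.
by move=> y _; move: rG; rewrite memNset// lte_fin => /lt_le_trans; apply.
Qed.

Lemma int_add nu h1 h2 : posf nu -> lscb h1 -> lscb h2 ->
  Int nu (fun x => h1 x + h2 x)%E = (Int nu h1 + Int nu h2)%E.
Proof.
move=> pnu l1 l2; apply/eqP; rewrite eq_le; apply/andP; split; last first.
  apply: lee_ltP => r /lte_add_split.
  move=> /(_ (int_gtNy _ l1.2) (int_gtNy _ l2.2)).
  move=> [r1 [r2 [/int_gt[p [Cp ph] rp] /int_gt[q [Cq qh] rq] ->]]].
  apply: le_trans (_ : ((nu (fun x => p x + q x))%:E <= _)%E).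
    by rewrite (linD (posf_linear pnu))// lee_fin lerD// ltW.
  apply: int_ub => [|x]; first exact: CcD.
  by rewrite EFinD leeD.
(* A minorant of [h1 + h2] need not split into minorants of the summands, but the sums that do split
   form a directed family with supremum [h1 + h2]. *)
pose D := [set f : T -> R | exists p q : T -> R, [/\ Cc p, Cc q,
  forall x, ((p x)%:E <= h1 x)%E, forall x, ((q x)%:E <= h2 x)%E
  & f = fun x => p x + q x]].
apply: lee_ltP => r rI.
have [|f|f g|x s|f [p [q [Cp Cq ph qh ->]]] rf] :=
  @int_directed_sup nu D _ r pnu _ _ _ _ rI.
- have [[_ [c1 ? ?]] [_ [c2 ? ?]]] := (l1, l2).
  by exists (fun x => c1 x + c2 x); exists c1, c2.
- by move=> [p [q [Cp Cq _ _ ->]]]; exact: CcD.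
- move=> [p [q [Cp Cq ph qh ->]]] [p' [q' [Cp' Cq' ph' qh' ->]]].
  exists (fun x => Num.max (p x) (p' x) + Num.max (q x) (q' x)).
    exists (fun x => Num.max (p x) (p' x)), (fun x => Num.max (q x) (q' x)).
    split => //; try exact: Cc_max.
      by move=> x; rewrite EFin_max ge_max ph ph'.
    by move=> x; rewrite EFin_max ge_max qh qh'.
  by move=> x; split; rewrite lerD// le_max lexx ?orbT.
- have [[_ [c1 ? ch1]] [_ [c2 ? ch2]]] := (l1, l2).
  move=> /lte_add_split; case=> [||r1 [r2 [r1h r2h ->]]].
  + exact: lt_le_trans (ltNyr _) (ch1 x).
  + exact: lt_le_trans (ltNyr _) (ch2 x).
  have [p [Cp ph] rp] := lscb_approx l1 r1h.
  have [q [Cq qh] rq] := lscb_approx l2 r2h.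
  by exists (fun y => p y + q y); [exists p, q|exact: ltrD].
move: rf; rewrite (linD (posf_linear pnu))// => rf.
apply: le_trans (_ : ((nu p + nu q)%:E <= _)%E); first by rewrite lee_fin ltW.
by rewrite EFinD leeD// int_ub.
Qed.

(** A positive form is singular to the zero form, so by uniqueness its Jordan decomposition has
    negative part zero. *)
Lemma radon_integral_posf nu h : posf nu -> Cc_bounded_below h ->
  radon_integral nu h = Int nu h.
Proof.
move=> pnu ch; rewrite /radon_integral.
have s : singular nu (fun=> 0).
  move=> f e Cf f0 e0; exists f; split=> //; last first.
  - rewrite (_ : (fun x => _) = fun=> 0); last by apply/funext => x; rewrite subrr.
    by rewrite lin0// ?ltW//; exact: posf_linear.
  - exact: ltW.
  - by move=> x; rewrite f0 lexx.
have p0 := @posf0 R T hT lT.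
rewrite (int_eq_Cc h (singularE hT lT pnu p0 s _)); last by move=> f _; rewrite subr0.
rewrite (int_eq_Cc h (singularE hT lT p0 pnu (singular_sym hT pnu p0 s) _)).
  by rewrite int0// sube0.
by move=> f _; rewrite sub0r.
Qed.

(** Evaluates a signed integral through any representation [L1 - L2], not only the Jordan one, by
    comparing [L1] plus the negative part with [L2] plus the positive part. The first alternative in
    the last clause is there for positive definiteness, which then yields the finiteness of the
    second integral. *)
Lemma jordan_integral L L1 L2 h : posf L1 -> posf L2 ->
  eq_Cc L (fun f => L1 f - L2 f) -> Cc_bounded_below h ->
  (Int L1 h < +oo)%E ->
  [/\ (Int (mpos L) h < +oo)%E, radon_integral_defined L h &
   (-oo < radon_integral L h)%E || (Int L2 h < +oo)%E ->
   (Int L2 h < +oo)%E /\ radon_integral L h = (Int L1 h - Int L2 h)%E].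
Proof.
move=> p1 p2 e ch fin1; have rL : radon L.
  by apply: (radon_eq hT (eq_Cc_sym e)); exact: radon_sub.
have pp := mposP hT lT rL; have pn := mnegP hT lT rL.
have pd := mpos_le hT lT p1 p2 e.
have E1 : Int L1 h = (Int (mpos L) h + Int (fun f => L1 f - mpos L f)%R h)%E.
  rewrite -int_addf//; apply: int_eq_Cc => f _.
  by rewrite addrC subrK.
have fp : (Int (mpos L) h < +oo)%E.
  rewrite ltNge leye_eq; apply: contraTN fin1 => /eqP Ey.
  by rewrite E1 Ey addye ?ltxx// gt_eqF// int_gtNy.
have Fp := int_fin ch fp.
split => //; first by rewrite /radon_integral_defined fin_num_adde_defr.
have E2 : (Int L1 h + Int (mneg L) h)%E = (Int L2 h + Int (mpos L) h)%E.
  rewrite -!int_addf//; apply: int_eq_Cc => f Cf.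
  have := jordan hT lT rL Cf; rewrite e//.
  by move=> ?; rewrite -[LHS](addrNK (L2 f)); lra.
have F1 := int_fin ch fin1.
rewrite /radon_integral; move: (int_gtNy (mneg L) ch) (int_gtNy L2 ch) E2.
case: (Int L1 h) F1 => // a _; case: (Int (mpos L) h) Fp => // b _.
case: (Int (mneg L) h) => [c||] //; case: (Int L2 h) => [d||] // _ _ //= [] E _.
by rewrite ltry -!EFinB; split=> //; congr EFin; lra.
Qed.

Lemma Mplus_posf E nu : Mplus E nu -> posf nu. Proof. by case. Qed.

Lemma outer_mass_small nu N (e : R) : posf nu -> outer_mass nu N = 0%E -> 0 < e ->
  exists G, [/\ open G, N `<=` G & (Int nu (EFin \o \1_G) < e%:E)%E].
Proof.
move=> pnu o0 e0.
have : (outer_mass nu N < e%:E)%E by rewrite o0 lte_fin.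
move=> /ereal_inf_lt[_ [G [oG NG] <-]].
rewrite radon_integral_posf//; last exact: (lscb_indic oG).2.
by exists G.
Qed.

(** For a test function [phi <= u], the difference [phi - chi] is bounded by [B] and vanishes off a
    compact [K], while [chi <= v] everywhere. So the inequality can fail only on [K] outside [E],
    which is covered by an open [G] of small mass; adding [B + 1] on [G] repairs it at small
    cost. *)
Lemma Mplus_le nu E u v : Mplus E nu -> lscb u -> lscb v ->
  (forall x, E x -> (u x <= v x)%E) -> (Int nu u <= Int nu v)%E.
Proof.
move=> M lu lv uv; have pnu := Mplus_posf M; have [_ _ lnE] := M.
apply: int_le => phi Cphi phiu.
have [_ [chi Cchi chiv]] := lv.
have Cd := CcB hT Cphi Cchi; have [B B0 dB] := Cc_bounded hT Cd.
have [_ [K cK dK]] := (CcP _ hT).1 Cd.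
apply/lee_addgt0Pr => e e0.
pose d := e / (B + 1); have d0 : 0 < d by rewrite divr_gt0// ltr_wpDl.
have [G [oG NG Gd]] := outer_mass_small pnu (lnE K cK) d0.
have B1 : 0 < B + 1 by rewrite ltr_wpDl.
apply: (@le_trans _ _ (Int nu (fun x => v x + (B + 1)%:E * (EFin \o \1_G) x)%E)).
  apply: int_ub => // x.
  have Be : (0 <= (B + 1)%:E * (EFin \o \1_G) x)%E.
    apply: mule_ge0; rewrite lee_fin; first exact: ltW.
    by rewrite indicE ler0n.
  have [Ex|nEx] := pselect (E x).
    by rewrite (le_trans (le_trans (phiu x) (uv x Ex)))// leeDl.
  have [Kx|/dK dx] := pselect (K x); last first.
    have -> : phi x = chi x by apply/eqP; rewrite -subr_eq0 dx.
    by rewrite (le_trans (chiv x))// leeDl.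
  rewrite /= indicE mem_set ?mule1; last by apply: NG.
  apply: le_trans (leeD (chiv x) (lexx _)).
  rewrite -EFinD lee_fin.
  by have := dB x; rewrite ler_norml => /andP[]; lra.
rewrite int_add//; last by apply: lscbZ => //; exact: lscb_indic.
rewrite leeD2l// int_scale//.
by rewrite -lee_pdivlMl// -EFinM mulrC ltW.
Qed.

Lemma Mplus_Cc_le nu E f g : Mplus E nu -> Cc f -> Cc g ->
  (forall x, E x -> f x <= g x) -> nu f <= nu g.
Proof.
move=> M Cf Cg fg; have pnu := Mplus_posf M.
rewrite -lee_fin -!int_EFin//; apply: (Mplus_le M) => //; exact: lscb_Cc.
Qed.

End integrals.

(** * Product measures *)

Section slices.
Context {R : realType} {X Y : topologicalType}.
Hypotheses (hX : hausdorff_space X) (lX : locally_compact [set: X]).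
Hypotheses (hY : hausdorff_space Y) (lY : locally_compact [set: Y]).
Implicit Types (P : (X -> R) -> R) (Q : (Y -> R) -> R) (phi : X * Y -> R).

Let hXY := hausdorff_prod hX hY.
Let lXY := locally_compact_prod hX hY lX lY.

Lemma Cc_prod_support phi : Cc phi -> exists K L,
  [/\ compact K, compact L & forall x y, ~ K x \/ ~ L y -> phi (x, y) = 0].
Proof.
move=> /(CcP _ hXY)[_ [S cS phiS]]; exists (fst @` S), (snd @` S); split.
- apply: continuous_compact => //; apply: continuous_subspaceT => x.
  exact: cvg_fst.
- apply: continuous_compact => //; apply: continuous_subspaceT => x.
  exact: cvg_snd.
- by move=> x y [] nS; apply: phiS; apply: contra_not nS => Sxy; exists (x, y).
Qed.

Lemma pair_continuous (x : X) : continuous (fun y : Y => (x, y)).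
Proof. by move=> y; apply: cvg_pair => /=; [exact: cvg_cst|exact: cvg_id]. Qed.

Lemma Cc_slice phi x : Cc phi -> Cc (fun y => phi (x, y)).
Proof.
move=> Cphi; have [K [L [cK cL phi0]]] := Cc_prod_support Cphi.
apply/(CcP _ hY); split.
  move=> y; apply: (@continuous_comp _ _ _ (fun y => (x, y)) phi).
    exact: pair_continuous.
  exact: Cc_continuous.
by exists L => // y Ly; apply: phi0; right.
Qed.

(** Compactness of the projection [L] of the support makes continuity in [x] uniform in [y]. *)
Lemma slice_unif phi x0 (e : R) : Cc phi -> 0 < e ->
  \forall x \near x0, forall y, `|phi (x, y) - phi (x0, y)| <= e.
Proof.
move=> Cphi e0; have [K [L [cK cL phi0]]] := Cc_prod_support Cphi.
have /compact_near_coveringP cov := cL.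
have := cov X (nbhs x0) (fun x y => `|phi (x, y) - phi (x0, y)| <= e) _.
have H : forall y, L y -> \forall y' \near y & x \near x0,
    `|phi (x, y') - phi (x0, y')| <= e.
  move=> y Ly.
  have e20 : 0 < e / 2 by lra.
  have [[U V] /= [Ux Vy] UV] : \forall z \near (x0, y), `|phi (x0, y) - phi z| < e / 2.
    by have /cvgrPdist_lt := @Cc_continuous _ _ _ Cphi (x0, y); apply.
  exists (V, U) => //= -[y' x] /= [Vy' Ux'].
  have h1 := UV (x, y') (conj Ux' Vy').
  have h2 := UV (x0, y') (conj (nbhs_singleton Ux) Vy').
  move: h1 h2 => /=; rewrite !ltr_norml ler_norml => /andP[? ?] /andP[? ?].
  by apply/andP; split; lra.
move=> /(_ _ H); apply: filterS => x Lx y; have [/Lx //|nLy] := pselect (L y).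
by rewrite !phi0 ?subrr ?normr0 ?ltW//; right.
Qed.

Lemma Cc_marginal Q phi : posf Q -> Cc phi -> Cc (fun x => Q (fun y => phi (x, y))).
Proof.
move=> pQ Cphi; have [K [L [cK cL phi0]]] := Cc_prod_support Cphi.
have lQ := posf_linear pQ.
apply/(CcP _ hX); split; last first.
  exists K => // x Kx; rewrite (_ : (fun y => _) = fun=> 0) ?lin0//.
  by apply/funext => y; apply: phi0; left.
have [F [CF F01 F1 _]] := @Cc_bump R _ hY lY L setT cL openT (@subsetT _ _).
have F0 : 0 <= Q F by apply: pQ.2 => // y; case/andP: (F01 y).
move=> x0; apply/cvgrPdist_le => e e0.
have d0 : 0 < e / (Q F + 1) by rewrite divr_gt0// ltr_wpDl.
near=> x.
have unif : forall y, `|phi (x, y) - phi (x0, y)| <= e / (Q F + 1).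
  by near: x; exact: slice_unif.
rewrite -linB//; try exact: Cc_slice.
apply: le_trans (_ : Q (fun y => (e / (Q F + 1)) * F y) <= _); last first.
  by rewrite linZ// mulrAC ler_pdivrMr ?ltr_wpDl// ler_pM2l// lerDl.
apply: (lin_norm_le hY lQ pQ.2); [|exact: CcZ|move=> y].
  by apply: CcB => //; exact: Cc_slice.
have [Ly|nLy] := pselect (L y); first by rewrite F1// mulr1 distrC.
rewrite !phi0; [|by right|by right].
by rewrite subrr normr0 mulr_ge0 ?(ltW d0)//; case/andP: (F01 y).
Unshelve. all: end_near. Qed.

Lemma tensor_posf P Q : posf P -> posf Q -> posf (tensor P Q).
Proof.
move=> pP pQ; apply: (pos_radon hXY lXY).
  move=> c f g Cf Cg; rewrite /tensor.
  rewrite -(posf_linear pP _ (Cc_marginal pQ Cf) (Cc_marginal pQ Cg)).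
  congr P; apply/funext => x.
  by rewrite -(posf_linear pQ _ (Cc_slice x Cf) (Cc_slice x Cg)).
move=> f Cf f0; apply: pP.2; first exact: (Cc_marginal pQ Cf).
by move=> x; apply: pQ.2; first exact: (Cc_slice x Cf).
Qed.

Lemma tensor_eq P P1 Q Q1 : posf Q1 -> eq_Cc P P1 -> eq_Cc Q Q1 ->
  eq_Cc (tensor P Q) (tensor P1 Q1).
Proof.
move=> pQ1 eP eQ f Cf; rewrite /tensor.
rewrite (_ : (fun x => Q _) = fun x => Q1 (fun y => f (x, y))).
  by apply: eP; exact: (Cc_marginal pQ1 Cf).
by apply/funext => x; apply: eQ; exact: (Cc_slice x Cf).
Qed.

Lemma tensor_mul P Q u v : posf P -> posf Q -> Cc u -> Cc v ->
  tensor P Q (fun z => u z.1 * v z.2) = P u * Q v.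
Proof.
move=> pP pQ Cu Cv; rewrite /tensor /= mulrC -linZ//; last exact: posf_linear.
congr P; apply/funext => x; rewrite linZ 1?mulrC//; exact: posf_linear.
Qed.

Lemma Cc_mul_prod u v : Cc u -> Cc v -> Cc (fun z : X * Y => u z.1 * v z.2 : R).
Proof.
move=> Cu Cv; have [_ [K cK u0]] := (CcP _ hX).1 Cu.
have [_ [L cL v0]] := (CcP _ hY).1 Cv.
apply/(CcP _ hXY); split.
  move=> [x y]; apply: cvgM.
    apply: (@continuous_comp _ _ _ fst u); [exact: cvg_fst|exact: Cc_continuous].
  apply: (@continuous_comp _ _ _ snd v); [exact: cvg_snd|exact: Cc_continuous].
exists (K `*` L); first exact: compact_setX.
by move=> [x y] /= /not_andP[/u0|/v0] ->; rewrite ?mul0r ?mulr0.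
Qed.

Section kernel_integral.
Variable k : X * Y -> \bar R.
Hypothesis lk : lscb k.

Lemma lscb_slice x : lscb (fun y => k (x, y)).
Proof.
have [l [chi Cchi chik]] := lk; split; last first.
  by exists (fun y => chi (x, y)) => //; exact: (Cc_slice x Cchi).
move=> y r rk; have [V Vxy kV] := l _ _ rk.
by exists (fun y' => V (x, y')); [exact: (@pair_continuous x y V Vxy)|move=> y' /kV].
Qed.

Let minor := [set phi : X * Y -> R | Cc phi /\ forall z, ((phi z)%:E <= k z)%E].

(** A minorant of the slice need not come from a minorant of [k], but the slices of minorants of [k]
    form a directed family whose supremum is the slice of [k]. Semicontinuity of potentials and the
    Tonelli theorem both rest on this. *)
Lemma int_slice_gt Q x (r : R) : posf Q ->
  (r%:E < pos_integral Q (fun y => k (x, y)))%E ->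
  exists2 phi, minor phi & r < Q (fun y => phi (x, y)).
Proof.
move=> pQ rI; have [_ [chi Cchi chik]] := lk.
pose D := [set f : Y -> R | exists2 phi, minor phi & f = fun y => phi (x, y)].
have [|f|f g|y s|f [phi mphi ->]] :=
  @int_directed_sup _ _ hY lY Q D _ r pQ _ _ _ _ rI.
- by exists (fun y => chi (x, y)), chi.
- by move=> [phi [Cphi _] ->]; exact: (Cc_slice x Cphi).
- move=> [phi [C1 k1] ->] [psi [C2 k2] ->].
  exists (fun y => Num.max (phi (x, y)) (psi (x, y))); last first.
    by move=> y; rewrite !le_max !lexx orbT.
  exists (fun z => Num.max (phi z) (psi z)) => //; split; first exact: Cc_max.
  by move=> z; rewrite EFin_max ge_max k1 k2.
- move=> /(lscb_approx hXY lXY lk)[phi [Cphi phik] sphi].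
  by exists (fun y => phi (x, y)) => //; exists phi.
by exists phi.
Qed.

Lemma lscb_int Q : posf Q -> lscb (fun x => pos_integral Q (fun y => k (x, y))).
Proof.
move=> pQ; have [_ [chi Cchi chik]] := lk; split; last first.
  exists (fun x => Q (fun y => chi (x, y))); first exact: (Cc_marginal pQ Cchi).
  by move=> x; apply: int_ub => //; exact: (Cc_slice x Cchi).
move=> x r /(int_slice_gt pQ)[phi [Cphi phik] rphi].
exists [set x' | r < Q (fun y => phi (x', y))].
  by have /cvgr_gt/(_ _ rphi) := @Cc_continuous _ _ _ (Cc_marginal pQ Cphi) x.
move=> x' /=; rewrite -lte_fin => /lt_le_trans; apply.
by apply: int_ub => //; exact: (Cc_slice x' Cphi).
Qed.

(** One inequality is immediate on test functions; for the other, the marginals of minorants of [k]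
    form a directed family with supremum the inner integral. *)
Lemma int_tensor P Q : posf P -> posf Q -> pos_integral (tensor P Q) k =
  pos_integral P (fun x => pos_integral Q (fun y => k (x, y))).
Proof.
move=> pP pQ; have [_ [chi Cchi chik]] := lk.
apply/eqP; rewrite eq_le; apply/andP; split.
  apply: int_le => phi Cphi phik; apply: int_ub; first exact: (Cc_marginal pQ Cphi).
  by move=> x; apply: int_ub => //; exact: (Cc_slice x Cphi).
pose D := [set f : X -> R | exists2 phi, minor phi &
  f = fun x => Q (fun y => phi (x, y))].
apply: lee_ltP => r rI.
have [|f|f g|x s|f [phi [Cphi phik] ->] rf] :=
  @int_directed_sup _ _ hX lX P D _ r pP _ _ _ _ rI.
- by exists (fun x => Q (fun y => chi (x, y))), chi.
- by move=> [phi [Cphi _] ->]; exact: (Cc_marginal pQ Cphi).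
- move=> [phi [C1 k1] ->] [psi [C2 k2] ->].
  exists (fun x => Q (fun y => Num.max (phi (x, y)) (psi (x, y)))).
    exists (fun z => Num.max (phi z) (psi z)) => //; split; first exact: Cc_max.
    by move=> z; rewrite EFin_max ge_max k1 k2.
  have Cs x := Cc_slice x C1; have Cs' x := Cc_slice x C2.
  have Cm x := Cc_max hY (Cs x) (Cs' x).
  by move=> x; split; apply: (posf_le hY pQ (_ x) (Cm x)) => // y;
    rewrite le_max lexx ?orbT.
- move=> /(int_slice_gt pQ)[phi mphi sphi].
  by exists (fun x => Q (fun y => phi (x, y))) => //; exists phi.
by apply: le_trans (_ : ((tensor P Q phi)%:E <= _)%E);
  [rewrite lee_fin ltW|exact: int_ub].
Qed.

End kernel_integral.

End slices.

(** * Exchange of iterated integrals on [Cc] *)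

Section fubini.
Context {R : realType} {X Y : topologicalType}.
Hypotheses (hX : hausdorff_space X) (lX : locally_compact [set: X]).
Hypotheses (hY : hausdorff_space Y) (lY : locally_compact [set: Y]).

Lemma Cc_swap (phi : X * Y -> R) : Cc phi -> Cc (fun z : Y * X => phi (z.2, z.1)).
Proof.
move=> Cphi; have [K [L [cK cL phi0]]] := Cc_prod_support hX hY Cphi.
apply/(CcP _ (hausdorff_prod hY hX)); split.
  move=> z; apply: (@continuous_comp _ _ _ (fun z : Y * X => (z.2, z.1)) phi).
    exact: swap_continuous.
  exact: Cc_continuous.
exists (L `*` K); first exact: compact_setX.
by move=> [y x] /= /not_andP[?|?]; apply: phi0; [right|left].
Qed.

(* The two iterated integrals of [q b phi] are close to each other when [b] is a
   bump at a point [x], since there [phi] is close to [phi (x, _)]; this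
   property is stable under sums of such [b]'s, and finitely many of them cover
   the support of [phi]. *)
Lemma tensor_fubini (P : (X -> R) -> R) (Q : (Y -> R) -> R) phi :
  posf P -> posf Q -> Cc phi ->
  P (fun x => Q (fun y => phi (x, y))) = Q (fun y => P (fun x => phi (x, y))).
Proof.
move=> pP pQ Cphi; have [K [L [cK cL phi0]]] := Cc_prod_support hX hY Cphi.
have lP := posf_linear pP; have lQ := posf_linear pQ.
have [F [CF F01 F1 _]] := @Cc_bump R _ hX lX K setT cK openT (@subsetT _ _).
have [G [CG G01 G1 _]] := @Cc_bump R _ hY lY L setT cL openT (@subsetT _ _).
have F0 x : 0 <= F x by case/andP: (F01 x).
have G0 y : 0 <= G y by case/andP: (G01 y).
pose T1 psi := tensor P Q psi.
pose T2 psi := tensor Q P (fun z => psi (z.2, z.1)).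
have pT2 : posf T2.
  have [[l _] p] := tensor_posf hY lY hX lX pQ pP.
  apply: pos_radon; [exact: hausdorff_prod|exact: locally_compact_prod| |].
    by move=> c f g Cf Cg; rewrite /T2 -l//; exact: Cc_swap.
  by move=> f Cf f0; apply: p => //; exact: Cc_swap.
have lT2 := posf_linear pT2.
have pT1 : posf T1 := tensor_posf hX lX hY lY pP pQ.
have lT1 := posf_linear pT1.
have T12 u v : Cc u -> Cc v -> T1 (fun z => u z.1 * v z.2) = T2 (fun z => u z.1 * v z.2).
  move=> Cu Cv; rewrite /T1 tensor_mul// /T2 /=.
  rewrite mulrC -(tensor_mul hY hX pQ pP Cv Cu).
  by congr (tensor Q P); apply/funext => z; rewrite mulrC.
apply/eqP; rewrite -subr_eq0 -normr_le0; apply/ler_addgt0Pr => e e0; rewrite add0r.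
have PQ0 : 0 <= P F * Q G by rewrite mulr_ge0//; [exact: pP.2|exact: pQ.2].
pose d := e / (2 * (P F * Q G + 1)).
have d0 : 0 < d by rewrite divr_gt0// mulr_gt0// ltr_wpDl.
(* The weight [q] is quantified so that the normalization can be chosen after the cover is found,
   and the error is proportional to the mass of [q b], hence additive in [b]. *)
pose good (b : X -> R) := [/\ Cc b, forall x, 0 <= b x &
  forall q : X -> R, continuous q -> (forall x, 0 <= q x) ->
  `|T1 (fun z => (q z.1 * b z.1) * phi z) - T2 (fun z => (q z.1 * b z.1) * phi z)|
   <= 2 * d * (P (fun x => q x * b x) * Q G)].
have hXY := hausdorff_prod hX hY.
have Cqbphi (b : X -> R) : continuous b -> Cc (fun z => b z.1 * phi z).
  move=> cb; apply: Cc_mul => //; case=> x y.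
  apply: (@continuous_comp _ _ _ fst b); [exact: cvg_fst|exact: cb].
have [|b b' [Cb b0 gb] [Cb' b'0 gb']|x Kx|b [Cb b0 gb] bK] :=
  @compact_directed_cover X _ good (fun b x => 1 < 2 * b x) K _ _ cK.
- exists (fun=> 0); split => //; first exact: Cc0.
  move=> q _ _.
  have -> : (fun x => q x * 0) = fun=> 0 by apply/funext => x; rewrite mulr0.
  have -> : (fun z : X * Y => q z.1 * 0 * phi z) = fun=> 0.
    by apply/funext => x; rewrite mulr0 mul0r.
  by rewrite !lin0// subrr normr0 mul0r mulr0.
- exists (fun x => b x + b' x); last first.
    move=> x; have := b0 x; have := b'0 x.
    by move=> ? ? []; lra.
  split; [exact: CcD|by move=> x; rewrite addr_ge0|move=> q cq q0].
  have cb := Cc_continuous Cb; have cb' := Cc_continuous Cb'.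
  have cqb : continuous (fun x => q x * b x).
    by move=> x; apply: cvgM; [exact: cq|exact: cb].
  have cqb' : continuous (fun x => q x * b' x).
    by move=> x; apply: cvgM; [exact: cq|exact: cb'].
  have -> : (fun z : X * Y => q z.1 * (b z.1 + b' z.1) * phi z) =
      fun z => (q z.1 * b z.1) * phi z + (q z.1 * b' z.1) * phi z.
    by apply/funext => z; ring.
  have -> : (fun x => q x * (b x + b' x)) = fun x => q x * b x + q x * b' x.
    by apply/funext => z; ring.
  have CE := Cqbphi _ cqb; have CE' := Cqbphi _ cqb'.
  rewrite (linD lT1 CE CE') (linD lT2 CE CE').
  rewrite (linD lP)//; try exact: Cc_mul.
  have := gb q cq q0; have := gb' q cq q0.
  set X1 := T1 _; set X2 := T2 _; set X3 := T1 _; set X4 := T2 _ => h1 h2.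
  rewrite (_ : X3 + X1 - (X4 + X2) = (X3 - X4) + (X1 - X2)); last by ring.
  by apply: le_trans (ler_normD _ _) _; lra.
- have U := slice_unif hX hY x Cphi d0.
  pose V := interior (fun x' => forall y, `|phi (x', y) - phi (x, y)| <= d).
  have [b [Cb b01 b1 bV]] := @Cc_bump R _ hX lX [set x] V (@compact_set1 _ x)
    (@open_interior _ _) (ltac:(by move=> _ ->)).
  exists b; last first.
    have : (fun y => 2 * b y) @ x --> 2 * b x.
      by apply: cvgM; [exact: cvg_cst|exact: (@Cc_continuous _ _ _ Cb x)].
    by move=> /cvgr_gt; apply; rewrite b1// mulr1; lra.
  split => //; first by move=> y; case/andP: (b01 y).
  move=> q cq q0; set p := fun x => q x * b x.
  have p0 y : 0 <= p y by rewrite mulr_ge0//; case/andP: (b01 y).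
  have Cp : Cc p by exact: Cc_mul.
  have Cs := Cc_slice hX hY x Cphi.
  pose psi (z : X * Y) := p z.1 * phi (x, z.2).
  have Cpsi : Cc psi := Cc_mul_prod hX hY Cp Cs.
  have CE := Cqbphi p (Cc_continuous Cp).
  have CG' : Cc (fun z : X * Y => p z.1 * (d * G z.2)).
    exact: (Cc_mul_prod hX hY Cp (CcZ hY d CG)).
  have bound z : `|p z.1 * phi z - psi z| <= p z.1 * (d * G z.2).
    case: z => x' y /=; rewrite /psi -mulrBr normrM ger0_norm//=.
    have [Vx|/bV bx] := pselect (V x'); last by rewrite /p bx mulr0 !mul0r.
    rewrite ler_wpM2l//; have [Ly|nLy] := pselect (L y).
      by rewrite G1// mulr1; exact: (interior_subset Vx).
    by rewrite !phi0; [rewrite subrr normr0 mulr_ge0// ltW|right|right].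
  have b1' : `|T1 (fun z => p z.1 * phi z) - T1 psi| <= d * (P p * Q G).
    rewrite -linB//.
    apply: le_trans (lin_norm_le hXY lT1 pT1.2 (CcB hXY CE Cpsi) CG' bound) _.
    by rewrite /T1 (tensor_mul hX hY pP pQ Cp (CcZ hY d CG)) linZ// mulrCA.
  have b2' : `|T2 (fun z => p z.1 * phi z) - T2 psi| <= d * (P p * Q G).
    rewrite -linB//.
    apply: le_trans (lin_norm_le hXY lT2 pT2.2 (CcB hXY CE Cpsi) CG' bound) _.
    rewrite -(T12 _ _ Cp (CcZ hY d CG)).
    by rewrite /T1 (tensor_mul hX hY pP pQ Cp (CcZ hY d CG)) linZ// mulrCA.
  move: b1' b2'; rewrite [T1 psi](T12 _ _ Cp Cs) !ler_norml.
  by move=> /andP[? ?] /andP[? ?]; apply/andP; split; lra.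
(* Stands in for a partition of unity: on [K], where [b > 1/2], the quotient [q = F / m] satisfies
   [q b = 1], and [q b <= F] everywhere. The bound 1/2 keeps [q] continuous. *)
pose m x := Num.max (b x) (1 / 2 : R).
have m0 x : 0 < m x by rewrite lt_max; apply/orP; right; lra.
have cm : continuous m.
  by apply: max_fun_continuous => x; [exact: Cc_continuous|exact: cvg_cst].
pose q x := F x / m x.
have cq : continuous q.
  move=> x; apply: cvgM; first exact: Cc_continuous.
  by apply: cvgV; [rewrite gt_eqF|exact: cm].
have q0 x : 0 <= q x by rewrite divr_ge0// ltW.
have := gb q cq q0.
have -> : (fun z : X * Y => q z.1 * b z.1 * phi z) = phi.
  apply/funext => -[x y] /=; have [Kx|nKx] := pselect (K x); last first.
    by rewrite phi0 ?mulr0//; left.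
  have mb : m x = b x by rewrite /m; have := bK x Kx; case: (leP (b x)); lra.
  by rewrite /q F1// mul1r -mb mulVf ?mul1r// gt_eqF.
move=> /le_trans; apply.
have PqF : P (fun x => q x * b x) <= P F.
  apply: posf_le => //; first exact: Cc_mul.
  move=> x; rewrite /q mulrAC ler_pdivrMr// ler_wpM2l//.
  by rewrite /m le_max lexx.
have QG0 : 0 <= Q G by exact: pQ.2.
apply: (@le_trans _ _ (2 * d * (P F * Q G))).
  by apply: ler_wpM2l; [rewrite mulr_ge0// ltW|exact: ler_wpM2r].
have w1 : 0 < P F * Q G + 1 by rewrite ltr_wpDl.
rewrite (_ : 2 * d * _ = e * (P F * Q G) / (P F * Q G + 1)).
  by rewrite ler_pdivrMr// ler_pM2l// lerDl.
by rewrite /d; field; rewrite gt_eqF.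
Qed.

End fubini.

(** * Symmetry and singularity of product measures *)

Section tensor_square.
Context {R : realType} {X : topologicalType}.
Hypotheses (hX : hausdorff_space X) (lX : locally_compact [set: X]).
Implicit Types (P Q : (X -> R) -> R).

Lemma int_tensor_sym (k : X * X -> \bar R) P Q :
  (forall x y, k (x, y) = k (y, x)) -> posf P -> posf Q ->
  pos_integral (tensor P Q) k = pos_integral (tensor Q P) k.
Proof.
move=> ksym pP pQ.
suff H (P1 Q1 : (X -> R) -> R) : posf P1 -> posf Q1 ->
    (pos_integral (tensor P1 Q1) k <= pos_integral (tensor Q1 P1) k)%E.
  by apply/eqP; rewrite eq_le !H.
move=> p q; apply: int_le => phi Cphi phik.
rewrite /tensor (tensor_fubini hX lX hX lX p q Cphi).
apply: (@int_ub _ _ (tensor Q1 P1) k (fun z => phi (z.2, z.1))).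
  exact: (Cc_swap hX hX Cphi).
by case=> x y; rewrite ksym; exact: phik.
Qed.

(* If [F = u + v] equals 1 on the projections of the support of [f], and [Q u]
   and [P v] are small, then [f (u (x) u + v (x) v)] is the function sought. *)
Lemma tensor_singular P Q : posf P -> posf Q -> singular P Q ->
  singular (fun f => tensor P P f + tensor Q Q f)
           (fun f => tensor P Q f + tensor Q P f).
Proof.
move=> pP pQ s f e Cf f0 e0.
have [K [L [cK cL fKL]]] := Cc_prod_support hX hX Cf.
have [M M0 fM] := Cc_bounded (hausdorff_prod hX hX) Cf.
have [F [CF F01 F1 _]] := @Cc_bump R _ hX lX (K `|` L) setT (compactU cK cL)
  openT (@subsetT _ _).
have F0 x : 0 <= F x by case/andP: (F01 x).
have PF0 : 0 <= P F by exact: pP.2.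
have QF0 : 0 <= Q F by exact: pQ.2.
pose w := M * (P F + Q F); have w0 : 0 <= w by rewrite mulr_ge0// addr_ge0.
pose d := e / (2 * (w + 1)).
have d0 : 0 < d by rewrite divr_gt0// mulr_gt0// ltr_wpDl.
have [u [Cu uF Qu Pv]] := s F d CF F0 d0.
pose v x := F x - u x; have Cv : Cc v by exact: CcB.
have u0 x : 0 <= u x by case/andP: (uF x).
have v0 x : 0 <= v x by rewrite subr_ge0; case/andP: (uF x).
have hXX := hausdorff_prod hX hX.
have lXX := locally_compact_prod hX hX lX lX.
pose c (z : X * X) := u z.1 * u z.2 + v z.1 * v z.2.
have Cc_ : Cc c by apply: CcD => //; exact: Cc_mul_prod.
pose c' (z : X * X) := u z.1 * v z.2 + v z.1 * u z.2.
have Cc'_ : Cc c' by apply: CcD => //; exact: Cc_mul_prod.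
have c0 z : 0 <= c z by rewrite addr_ge0// mulr_ge0.
have c'0 z : 0 <= c' z by rewrite addr_ge0// mulr_ge0.
have cc' z : f z = f z * (c z + c' z).
  case: z => x y; have [[Kx Ly]|nKL] := pselect (K x /\ L y); last first.
    by rewrite fKL ?mul0r//; apply/not_andP.
  rewrite (_ : c (x, y) + c' (x, y) = F x * F y); last first.
    by rewrite /c /c' /v /=; ring.
  by rewrite !F1 ?mulr1//; [right|left].
have Cfc : Cc (fun z => f z * c z) by apply: Cc_mul => //; exact: Cc_continuous.
have fle z : f z <= M by rewrite (le_trans (ler_norm _)).
have lPu : P u <= P F by apply: posf_le => // x; case/andP: (uF x).
have lQv : Q v <= Q F.
  by apply: posf_le => // x; rewrite /v gerBl.
have Pu0 : 0 <= P u by exact: pP.2.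
have Qu0 : 0 <= Q u by exact: pQ.2.
have Pv0 : 0 <= P v by exact: pP.2.
have Qv0 : 0 <= Q v by exact: pQ.2.
have bnd (P1 Q1 : (X -> R) -> R) g c1 : posf P1 -> posf Q1 -> Cc g -> Cc c1 ->
    (forall z, g z <= M * c1 z) -> tensor P1 Q1 g <= M * tensor P1 Q1 c1.
  move=> p1 q1 Cg Cc1 gc; have pt := tensor_posf hX lX hX lX p1 q1.
  rewrite -(linZ hXX (posf_linear pt))//; apply: posf_le => //; exact: CcZ.
have tc (P1 Q1 : (X -> R) -> R) : posf P1 -> posf Q1 ->
    tensor P1 Q1 c = P1 u * Q1 u + P1 v * Q1 v.
  move=> p1 q1; have pt := tensor_posf hX lX hX lX p1 q1.
  rewrite /c (linD (posf_linear pt)); try exact: Cc_mul_prod.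
  by rewrite !tensor_mul.
have tc' (P1 Q1 : (X -> R) -> R) : posf P1 -> posf Q1 ->
    tensor P1 Q1 c' = P1 u * Q1 v + P1 v * Q1 u.
  move=> p1 q1; have pt := tensor_posf hX lX hX lX p1 q1.
  rewrite /c' (linD (posf_linear pt)); try exact: Cc_mul_prod.
  by rewrite !tensor_mul.
have fin : M * (2 * (d * (P F + Q F))) <= e.
  rewrite (_ : M * _ = e * w / (w + 1)); last first.
    by rewrite /d /w; field; rewrite gt_eqF// ltr_wpDl.
  by rewrite ler_pdivrMr ?ltr_wpDl// ler_pM2l// lerDl.
exists (fun z => f z * c z); split => //.
- move=> z; rewrite mulr_ge0//= [leRHS]cc' ler_wpM2l//.
  by rewrite lerDl.
- apply: le_trans fin.
  have gc z : f z * c z <= M * c z by rewrite ler_wpM2r.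
  have := bnd P Q _ _ pP pQ Cfc Cc_ gc; have := bnd Q P _ _ pQ pP Cfc Cc_ gc.
  rewrite !tc// => h1 h2.
  apply: le_trans (lerD h2 h1) _.
  rewrite -mulrDr ler_wpM2l//.
  have ? : P u * Q u <= P F * d by rewrite ler_pM.
  have ? : P v * Q v <= d * Q F by rewrite ler_pM.
  by lra.
- apply: le_trans fin.
  have -> : (fun z => f z - f z * c z) = (fun z => f z * c' z).
    by apply/funext => z; rewrite {1}cc'; ring.
  have Cfc' : Cc (fun z => f z * c' z) by apply: Cc_mul => //; exact: Cc_continuous.
  have gc z : f z * c' z <= M * c' z by rewrite ler_wpM2r.
  have := bnd P P _ _ pP pP Cfc' Cc'_ gc; have := bnd Q Q _ _ pQ pQ Cfc' Cc'_ gc.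
  rewrite !tc'// => h1 h2.
  apply: le_trans (lerD h2 h1) _.
  rewrite -mulrDr ler_wpM2l//.
  have ? : P u * P v <= P F * d by rewrite ler_pM.
  have ? : Q u * Q v <= d * Q F by rewrite ler_pM.
  by lra.
Qed.

End tensor_square.

(** * Energy *)

Lemma lte_addl_pinfty (R : realType) (x y : \bar R) :
  (-oo < y)%E -> (x + y < +oo)%E -> (x < +oo)%E.
Proof. by case: x => [x||] //; [rewrite ltry|case: y]. Qed.

Section energy.
Context {R : realType} {X : topologicalType}.
Hypotheses (hX : hausdorff_space X) (lX : locally_compact [set: X]).
Variable k : X * X -> \bar R.
Hypotheses (kerk : is_kernel k) (pdk : positive_definite k).
Local Notation measure := ((X -> R) -> R).
Implicit Types (P Q nu : measure).
Local Notation Int := pos_integral.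

Let hXX := hausdorff_prod hX hX.
Let lXX := locally_compact_prod hX hX lX lX.

Lemma kernel_lscb : lscb k.
Proof.
have [lk kNy kge0] := kerk; split=> //.
have [cX|/kge0 k0] := pselect (compact [set: X]); last first.
  exact: Cc_bounded_below_ge0.
have cXX : compact [set: X * X] by rewrite -setXTT; exact: compact_setX.
have [||z _|c _ kc] := @compact_directed_cover _ R setT
  (fun c z => (c%:E < k z)%E) _ _ _ cXX.
- by exists 0.
- move=> i j _ _; exists (Num.min i j) => // z [] h; apply: le_lt_trans h;
    by rewrite lee_fin ge_min lexx ?orbT.
- have [c ck] : exists c : R, (c%:E < k z)%E.
    move: (kNy z); case: (k z) => [r||] // _.
      by exists (r - 1); rewrite lte_fin ltrBlDr ltrDl.
    by exists 0; rewrite ltry.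
  exists c => //; have [V Vz Vk] := lk _ _ ck.
  by apply: filterS Vz.
exists (fun=> c); last by move=> z; rewrite ltW// kc.
apply/(CcP _ hXX); split; first by move=> z; exact: cvg_cst.
by exists setT => // z; case.
Qed.

Let ck : Cc_bounded_below k := kernel_lscb.2.

(** Positive measures of finite energy, described without the Jordan decomposition of the product;
    [Ep_finite_energy] identifies them with those of [finite_energy]. *)
Definition Ep P := posf P /\ (Int (tensor P P) k < +oo)%E.

Definition mutual P Q : R := fine (Int (tensor P Q) k).

Lemma posf_tensor P Q : posf P -> posf Q -> posf (tensor P Q).
Proof. exact: tensor_posf. Qed.

Lemma tensor_diff nu P Q nu1 P1 Q1 : posf P -> posf Q -> posf P1 -> posf Q1 ->
  eq_Cc nu (fun f => P f - Q f) -> eq_Cc nu1 (fun f => P1 f - Q1 f) ->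
  eq_Cc (tensor nu nu1) (fun f =>
    (tensor P P1 f + tensor Q Q1 f) - (tensor P Q1 f + tensor Q P1 f)).
Proof.
move=> pP pQ pP1 pQ1 e e1 f Cf.
have M1 := Cc_marginal hX hX lX pP1 Cf; have M2 := Cc_marginal hX hX lX pQ1 Cf.
rewrite /tensor (_ : (fun x => nu1 _) =
  fun x => P1 (fun y => f (x, y)) - Q1 (fun y => f (x, y))); last first.
  by apply/funext => x; rewrite e1//; exact: (Cc_slice hX hX x Cf).
rewrite e; last exact: CcB.
by rewrite !linB//; [ring|exact: posf_linear|exact: posf_linear].
Qed.

(* Positive definiteness is applied to [P - Q]. *)
Lemma mutual_lt_pinfty P Q : Ep P -> Ep Q -> (Int (tensor P Q) k < +oo)%E.
Proof.
move=> [pP fP] [pQ fQ].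
have rs := radon_sub pP pQ.
have te := @tensor_diff (fun f => P f - Q f) P Q (fun f => P f - Q f) P Q pP pQ pP pQ
  (fun f _ => erefl) (fun f _ => erefl).
have pPP := posf_tensor pP pP; have pQQ := posf_tensor pQ pQ.
have pPQ := posf_tensor pP pQ; have pQP := posf_tensor pQ pP.
have f1 : (Int (fun f => tensor P P f + tensor Q Q f)%R k < +oo)%E.
  by rewrite (int_addf hXX)// lte_add_pinfty.
have p1 : posf (fun f => tensor P P f + tensor Q Q f) by exact: posfD.
have p2 : posf (fun f => tensor P Q f + tensor Q P f) by exact: posfD.
have [_ def] := jordan_integral hXX lXX p1 p2 te ck f1.
have e0 : (-oo < energy k (fun f => P f - Q f)%R)%E.
  by apply: lt_le_trans (pdk.2 _ rs def).
case; first by rewrite [X in X || _]e0.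
rewrite (int_addf hXX)// => + _.
have := int_gtNy (tensor P Q) ck; have := int_gtNy (tensor Q P) ck.
by case: (Int (tensor P Q) k) => [a||]//; case: (Int (tensor Q P) k).
Qed.

Lemma mutualE P Q : Ep P -> Ep Q -> Int (tensor P Q) k = (mutual P Q)%:E.
Proof.
move=> eP eQ; rewrite /mutual fineK//; apply: int_fin => //.
exact: mutual_lt_pinfty.
Qed.

Lemma EpP P : Ep P -> posf P. Proof. by case. Qed.

Lemma mutual_sym P Q : Ep P -> Ep Q -> mutual P Q = mutual Q P.
Proof.
move=> [pP _] [pQ _]; rewrite /mutual (int_tensor_sym hX lX)//.
exact: pdk.1.
Qed.

Lemma Ep_eq P Q : eq_Cc P Q -> Ep P -> Ep Q.
Proof.
move=> e [pP fP]; have pQ : posf Q by exact: (posf_eq hX lX e).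
split=> //; rewrite (int_eq_Cc k (_ : eq_Cc (tensor Q Q) (tensor P P)))//.
by apply: tensor_eq => //; exact: eq_Cc_sym.
Qed.

Lemma Ep0 : Ep (fun=> 0).
Proof.
split; first exact: posf0.
by rewrite (_ : tensor _ _ = fun=> 0)// (int0 ck) ltry.
Qed.

Lemma int_tensorDl P P1 Q : posf P -> posf P1 -> posf Q ->
  Int (tensor (fun f => P f + P1 f) Q) k =
  (Int (tensor P Q) k + Int (tensor P1 Q) k)%E.
Proof. by move=> ? ? ?; rewrite -(int_addf hXX)//; exact: posf_tensor. Qed.

Lemma int_tensorZl c P Q : 0 < c -> posf P -> posf Q ->
  Int (tensor (fun f => c * P f) Q) k = (c%:E * Int (tensor P Q) k)%E.
Proof. by move=> ? ? ?; rewrite -int_scalef//; exact: posf_tensor. Qed.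

Lemma EpD P Q : Ep P -> Ep Q -> Ep (fun f => P f + Q f).
Proof.
move=> eP eQ; have [pP _] := eP; have [pQ _] := eQ; split; first exact: posfD.
have pS : posf (fun f => P f + Q f) by exact: posfD.
rewrite int_tensorDl// !(int_tensor_sym hX lX pdk.1 _ pS)// !int_tensorDl//.
by rewrite !lte_add_pinfty//; exact: mutual_lt_pinfty.
Qed.

Lemma EpZ c P : 0 <= c -> Ep P -> Ep (fun f => c * P f).
Proof.
rewrite le_eqVlt => /predU1P[<- eP|c0 [pP fP]].
  rewrite (_ : (fun f => _) = fun=> 0); first exact: Ep0.
  by apply/funext => f; rewrite mul0r.
have pZ : posf (fun f => c * P f) by apply: posfZ => //; exact: ltW.
split=> //; rewrite int_tensorZl// (int_tensor_sym hX lX pdk.1 _ pZ)//.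
by rewrite int_tensorZl// muleA -EFinM lte_mul_pinfty// lee_fin mulr_ge0// ltW.
Qed.

Lemma Ep_sum n (P : 'I_n -> measure) : (forall i, Ep (P i)) ->
  Ep (fun f => \sum_(i < n) P i f).
Proof.
elim: n P => [|n IH] P eP.
  rewrite (_ : (fun f => _) = fun=> 0); first exact: Ep0.
  by apply/funext => f; rewrite big_ord0.
rewrite (_ : (fun f => _) = fun f =>
  \sum_(i < n) P (widen_ord (leqnSn n) i) f + P ord_max f).
  by apply: EpD => //; exact: IH.
by apply/funext => f; rewrite big_ord_recr.
Qed.

(** The kernel may take negative values when the space is compact, so domination does not compare
    energies directly. Instead the tensor square of [P] is that of [Q] plus a positive form, whose
    integral exceeds [-oo]. *)
Lemma Ep_le P Q : posf Q -> posf (fun f => P f - Q f) -> Ep P -> Ep Q.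
Proof.
move=> pQ pD [pP fP]; split=> //.
have pDD : posf (fun f =>
    tensor (fun f => P f - Q f) P f + tensor Q (fun f => P f - Q f) f).
  by apply: posfD => //; exact: posf_tensor.
move: fP; rewrite (int_eq_Cc k (_ : eq_Cc _ (fun f => tensor Q Q f +
  (tensor (fun f => P f - Q f) P f + tensor Q (fun f => P f - Q f) f)))); last first.
  move=> f Cf; have lQ := posf_linear pQ.
  have M1 := Cc_marginal hX hX lX pP Cf; have M2 := Cc_marginal hX hX lX pQ Cf.
  by rewrite /tensor (linB hX lQ M1 M2); ring.
rewrite (int_addf hXX)//; last exact: posf_tensor.
exact: lte_addl_pinfty (int_gtNy _ ck).
Qed.

Lemma mutualDl P P1 Q : Ep P -> Ep P1 -> Ep Q ->
  mutual (fun f => P f + P1 f) Q = mutual P Q + mutual P1 Q.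
Proof.
move=> eP eP1 eQ; apply: EFin_inj; rewrite EFinD -!mutualE//; last exact: EpD.
by rewrite int_tensorDl//; exact: EpP.
Qed.

Lemma mutualZl c P Q : 0 <= c -> Ep P -> Ep Q ->
  mutual (fun f => c * P f) Q = c * mutual P Q.
Proof.
rewrite le_eqVlt => /predU1P[<- eP eQ|c0 eP eQ].
  rewrite mul0r /mutual (_ : tensor _ _ = fun=> 0); first by rewrite (int0 ck).
  by apply/funext => f; rewrite /tensor mul0r.
apply: EFin_inj; rewrite EFinM -!mutualE//; last by apply: EpZ => //; exact: ltW.
by rewrite int_tensorZl//; exact: EpP.
Qed.

Definition represents nu P Q := [/\ Ep P, Ep Q & eq_Cc nu (fun f => P f - Q f)].

Definition inner nu nu1 : R := fine (mutual_energy k nu nu1).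

Lemma inner_represents nu P Q nu1 P1 Q1 :
  represents nu P Q -> represents nu1 P1 Q1 ->
  [/\ mutual_energy_defined k nu nu1, mutual_energy k nu nu1 \is a fin_num &
   inner nu nu1 = mutual P P1 + mutual Q Q1 - (mutual P Q1 + mutual Q P1)].
Proof.
move=> [eP eQ e] [eP1 eQ1 e1].
have te := tensor_diff (EpP eP) (EpP eQ) (EpP eP1) (EpP eQ1) e e1.
have pPP := posf_tensor (EpP eP) (EpP eP1); have pQQ := posf_tensor (EpP eQ) (EpP eQ1).
have pPQ := posf_tensor (EpP eP) (EpP eQ1); have pQP := posf_tensor (EpP eQ) (EpP eP1).
have p1 := posfD hXX lXX pPP pQQ; have p2 := posfD hXX lXX pPQ pQP.
have E1 : Int (fun f => tensor P P1 f + tensor Q Q1 f) k =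
    (mutual P P1 + mutual Q Q1)%:E.
  by rewrite (int_addf hXX)// EFinD -!mutualE.
have E2 : Int (fun f => tensor P Q1 f + tensor Q P1 f) k =
    (mutual P Q1 + mutual Q P1)%:E.
  by rewrite (int_addf hXX)// EFinD -!mutualE.
have [|_ def] := jordan_integral hXX lXX p1 p2 te ck; first by rewrite E1 ltry.
rewrite E2 ltry orbT => -[//|_]; rewrite E1 -EFinB => E.
by rewrite /inner /mutual_energy E.
Qed.

(* By [tensor_singular], the positive part of [tensor nu nu] dominates the
   tensor squares of both parts of [nu]. *)
Lemma finite_energy_represents nu : finite_energy k nu ->
  represents nu (mpos nu) (mneg nu).
Proof.
move=> [rnu _ fin]; have pp := mposP hX lX rnu; have pn := mnegP hX lX rnu.
have ej := jordan hX lX rnu; have sj := singular_jordan hX lX rnu.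
have te := tensor_diff pp pn pp pn ej ej.
have p1 := posfD hXX lXX (posf_tensor pp pp) (posf_tensor pn pn).
have p2 := posfD hXX lXX (posf_tensor pp pn) (posf_tensor pn pp).
have e1 := singularE hXX lXX p1 p2 (tensor_singular hX lX pp pn sj) te.
move: fin; rewrite /energy /mutual_energy /radon_integral fin_numB => /andP[+ _].
rewrite (int_eq_Cc k e1) (int_addf hXX)//; try exact: posf_tensor.
rewrite fin_numD => /andP[f1 f2].
by split=> //; split=> //; rewrite ltey_eq ?f1 ?f2.
Qed.

Lemma singular_finite_energy nu P Q : posf P -> posf Q -> singular P Q ->
  eq_Cc nu (fun f => P f - Q f) -> finite_energy k nu -> Ep P /\ Ep Q.
Proof.
move=> pP pQ s e /finite_energy_represents[eP eQ _].
have e1 := singularE hX lX pP pQ s e.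
have e2 := singularE hX lX pQ pP (singular_sym hX pP pQ s).
split; first exact: Ep_eq e1 eP.
apply: Ep_eq eQ; apply: e2 => f Cf; rewrite e//; ring.
Qed.

Lemma represents_finite_energy nu P Q : represents nu P Q -> finite_energy k nu.
Proof.
move=> rep; have [d f _] := inner_represents rep rep; split=> //.
have [eP eQ e] := rep; apply: (radon_eq hX (eq_Cc_sym e)).
exact: radon_sub (EpP eP) (EpP eQ).
Qed.

Lemma represents_pos P : Ep P -> represents P P (fun=> 0).
Proof. by move=> eP; split=> //; [exact: Ep0|move=> f _; rewrite subr0]. Qed.

Lemma Ep_finite_energy P : posf P -> Ep P <-> finite_energy k P.
Proof.
move=> pP; split=> [/represents_pos/represents_finite_energy//|fP].
have p0 := @posf0 R X hX lX.
have [] // := @singular_finite_energy P P (fun=> 0) pP p0 _ _ fP.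
  move=> f e Cf f0 e0; exists f; split=> //; [|exact: ltW|].
    by move=> x; rewrite f0 lexx.
  rewrite (_ : (fun x => _) = fun=> 0); last by apply/funext => x; rewrite subrr.
  by rewrite (lin0 hX (posf_linear pP)) ltW.
by move=> f _; rewrite subr0.
Qed.

Lemma represents_comb c nu P Q nu1 P1 Q1 : 0 <= c ->
  represents nu P Q -> represents nu1 P1 Q1 ->
  represents (fun f => c * nu f + nu1 f)
    (fun f => c * P f + P1 f) (fun f => c * Q f + Q1 f).
Proof.
move=> c0 [eP eQ e] [eP1 eQ1 e1]; split.
- by apply: EpD => //; exact: EpZ.
- by apply: EpD => //; exact: EpZ.
- by move=> f Cf; rewrite e// e1//; ring.
Qed.

Lemma represents_opp nu P Q : represents nu P Q ->
  represents (fun f => - nu f) Q P.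
Proof. by move=> [eP eQ e]; split=> // f Cf; rewrite e//; ring. Qed.

Lemma inner_energy nu : finite_energy k nu -> energy k nu = (inner nu nu)%:E.
Proof. by move=> [_ _ f]; rewrite /inner fineK. Qed.

Lemma inner_ge0 nu : finite_energy k nu -> 0 <= inner nu nu.
Proof.
move=> fnu; have [r d f] := fnu.
by rewrite -lee_fin -inner_energy//; exact: pdk.2.
Qed.

Lemma inner_sym nu nu1 : finite_energy k nu -> finite_energy k nu1 ->
  inner nu nu1 = inner nu1 nu.
Proof.
move=> /finite_energy_represents r /finite_energy_represents r1.
have [_ _ ->] := inner_represents r r1; have [_ _ ->] := inner_represents r1 r.
have [eP eQ _] := r; have [eP1 eQ1 _] := r1.
rewrite !(mutual_sym eP)// !(mutual_sym eQ)//; ring.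
Qed.

Lemma finite_energy_comb c nu nu1 : finite_energy k nu -> finite_energy k nu1 ->
  finite_energy k (fun f => c * nu f + nu1 f).
Proof.
move=> /finite_energy_represents r /finite_energy_represents r1.
have [c0|/ltW c0] := leP 0 c.
  exact: represents_finite_energy (represents_comb c0 r r1).
have c0' : 0 <= - c by rewrite oppr_ge0.
have := represents_finite_energy (represents_comb c0' (represents_opp r) r1).
by rewrite (_ : (fun f => _) = fun f => c * nu f + nu1 f)//; apply/funext => f; ring.
Qed.

Lemma inner_combl c nu nu1 nu2 : finite_energy k nu -> finite_energy k nu1 ->
  finite_energy k nu2 ->
  inner (fun f => c * nu f + nu1 f) nu2 = c * inner nu nu2 + inner nu1 nu2.
Proof.
move=> /finite_energy_represents r /finite_energy_represents r1.
move=> /finite_energy_represents r2.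
have [_ _ E] := inner_represents r r2; have [_ _ E1] := inner_represents r1 r2.
have [eP eQ _] := r; have [eP1 eQ1 _] := r1; have [eP2 eQ2 _] := r2.
have [c0|/ltW c0] := leP 0 c.
  have [_ _ ->] := inner_represents (represents_comb c0 r r1) r2.
  have eZP := EpZ c0 eP; have eZQ := EpZ c0 eQ.
  rewrite E E1 (mutualDl eZP eP1 eP2) (mutualDl eZQ eQ1 eQ2).
  rewrite (mutualDl eZP eP1 eQ2) (mutualDl eZQ eQ1 eP2).
  rewrite (mutualZl c0 eP eP2) (mutualZl c0 eQ eQ2).
  by rewrite (mutualZl c0 eP eQ2) (mutualZl c0 eQ eP2); ring.
have c0' : 0 <= - c by rewrite oppr_ge0.
have := inner_represents (represents_comb c0' (represents_opp r) r1) r2.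
rewrite (_ : (fun f => - c * - nu f + nu1 f) = fun f => c * nu f + nu1 f); last first.
  by apply/funext => f; ring.
move=> [_ _ ->]; have eZP := EpZ c0' eP; have eZQ := EpZ c0' eQ.
rewrite E E1 (mutualDl eZQ eP1 eP2) (mutualDl eZP eQ1 eQ2).
rewrite (mutualDl eZQ eP1 eQ2) (mutualDl eZP eQ1 eP2).
rewrite (mutualZl c0' eP eP2) (mutualZl c0' eQ eQ2).
by rewrite (mutualZl c0' eP eQ2) (mutualZl c0' eQ eP2); ring.
Qed.

Lemma inner_combr c nu nu1 nu2 : finite_energy k nu -> finite_energy k nu1 ->
  finite_energy k nu2 ->
  inner nu2 (fun f => c * nu f + nu1 f) = c * inner nu2 nu + inner nu2 nu1.
Proof.
move=> f f1 f2; have fc := finite_energy_comb c f f1.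
by rewrite inner_sym// inner_combl// !(inner_sym f2).
Qed.

Lemma inner_pos P Q : Ep P -> Ep Q -> inner P Q = mutual P Q.
Proof.
move=> eP eQ.
have [_ _ ->] := inner_represents (represents_pos eP) (represents_pos eQ).
have z P1 : mutual (fun=> 0) P1 = 0.
  by rewrite /mutual (_ : tensor _ _ = fun=> 0)// (int0 ck).
by rewrite (mutual_sym eP Ep0) !z !addr0 subr0.
Qed.

Lemma inner_posl P nu : Ep P -> finite_energy k nu ->
  inner P nu = mutual P (mpos nu) - mutual P (mneg nu).
Proof.
move=> eP fnu; have r := finite_energy_represents fnu.
have [_ _ ->] := inner_represents (represents_pos eP) r.
have z P1 : mutual (fun=> 0) P1 = 0.
  by rewrite /mutual (_ : tensor _ _ = fun=> 0)// (int0 ck).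
by rewrite !z !addr0.
Qed.

Lemma inner_sq_comb c nu nu1 : finite_energy k nu -> finite_energy k nu1 ->
  inner (fun f => c * nu f + nu1 f) (fun f => c * nu f + nu1 f) =
  c ^+ 2 * inner nu nu + 2 * c * inner nu nu1 + inner nu1 nu1.
Proof.
move=> f f1; have fc := finite_energy_comb c f f1.
rewrite inner_combl// !inner_combr// (inner_sym f1 f); ring.
Qed.

End energy.

(** * Concentration, restriction and capacity zero *)

Section concentrated.
Context {R : realType} {T : topologicalType}.
Hypotheses (hT : hausdorff_space T) (lT : locally_compact [set: T]).
Implicit Types (nu tau : (T -> R) -> R) (E : set T).
Local Notation Int := pos_integral.

Lemma MplusP E nu : Mplus E nu <-> posf nu /\
  forall (K : set T) (e : R), compact K -> 0 < e ->
    exists G, [/\ open G, ~` E `&` K `<=` G & (Int nu (EFin \o \1_G) <= e%:E)%E].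
Proof.
split=> [M|[[r p] H]].
  have pnu := Mplus_posf M; have [_ _ ln] := M; split=> // K e cK e0.
  by have [G [? ? /ltW ?]] := outer_mass_small hT lT pnu (ln K cK) e0; exists G.
split=> // K cK; apply/eqP; rewrite eq_le; apply/andP; split.
  apply/lee_addgt0Pr => e e0; rewrite add0e; have [G [oG NG Ge]] := H K e cK e0.
  apply: le_trans Ge; apply: ereal_inf_lbound; exists G => //.
  by rewrite radon_integral_posf//; exact: (lscb_indic hT oG).2.
apply: le_ereal_inf_tmp => _ [G [oG NG] <-].
rewrite radon_integral_posf//; last exact: (lscb_indic hT oG).2.
apply: int_ge0 => //; first exact: radon_linear.
by move=> x /=; rewrite lee_fin indicE ler0n.
Qed.

Lemma MplusS E E' nu : E `<=` E' -> Mplus E nu -> Mplus E' nu.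
Proof.
move=> EE' /MplusP[p H]; apply/MplusP; split=> // K e cK e0.
have [G [oG NG Ge]] := H K e cK e0; exists G; split=> // x [nE Kx].
by apply: NG; split=> // /EE'.
Qed.

Lemma Mplus_setT nu : posf nu -> Mplus setT nu.
Proof.
move=> pnu; apply/MplusP; split=> // K e cK e0; exists set0; split.
- exact: open0.
- by move=> x [/(_ Logic.I)].
rewrite (_ : \1_set0 = fun=> 0); last by apply/funext => x; rewrite indicE in_set0.
by rewrite (int_EFin hT)//; [rewrite lin0 ?lee_fin ?ltW//; exact: posf_linear|exact: Cc0].
Qed.

Lemma Cc_bounded_below_indic (G : set T) : Cc_bounded_below (EFin \o \1_G : T -> \bar R).
Proof.
by apply: (Cc_bounded_below_ge0 hT) => x /=; rewrite lee_fin indicE ler0n.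
Qed.

Lemma MplusD E nu nu1 : Mplus E nu -> Mplus E nu1 ->
  Mplus E (fun f => nu f + nu1 f).
Proof.
move=> /MplusP[p H] /MplusP[p1 H1]; apply/MplusP; split; first exact: posfD.
move=> K e cK e0; have e20 : 0 < e / 2 by lra.
have [G [oG NG Ge]] := H K _ cK e20; have [G1 [oG1 NG1 Ge1]] := H1 K _ cK e20.
exists (G `&` G1); split; [exact: openI|by move=> x Nx; split; [exact: NG|exact: NG1]|].
rewrite (int_addf hT)//; last exact: Cc_bounded_below_indic.
rewrite [e]splitr EFinD; apply: leeD.
  apply: le_trans Ge; apply: int_mono => x /=; rewrite lee_fin !indicE ler_nat.
  by case: (asboolP (G x)) => Gx; rewrite ?(mem_set Gx) ?leq_b1// memNset// => -[].
apply: le_trans Ge1; apply: int_mono => x /=; rewrite lee_fin !indicE ler_nat.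
by case: (asboolP (G1 x)) => Gx; rewrite ?(mem_set Gx) ?leq_b1// memNset// => -[].
Qed.

Lemma MplusZ E c nu : 0 <= c -> Mplus E nu -> Mplus E (fun f => c * nu f).
Proof.
move=> c0 /MplusP[p H]; apply/MplusP; split; first exact: posfZ.
move=> K e cK e0; have d0 : 0 < e / (c + 1) by rewrite divr_gt0// ltr_wpDl.
have [G [oG NG Ge]] := H K _ cK d0; exists G; split=> //.
move: c0 d0 Ge; rewrite le_eqVlt => /predU1P[<- _ _|c0 d0 Ge].
  rewrite (_ : (fun f => _) = fun=> 0); last by apply/funext => f; rewrite mul0r.
  by rewrite (int0 (Cc_bounded_below_indic G)) lee_fin ltW.
rewrite int_scalef// -lee_pdivlMl// (le_trans Ge)// -EFinM lee_fin.
rewrite mulrC ler_pM// ?invr_ge0 ?ltW// ?addr_gt0//.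
by rewrite ltf_pV2 ?posrE ?addr_gt0// ltrDl.
Qed.

Lemma Mplus_dominated E nu tau : posf tau -> posf (fun f => nu f - tau f) ->
  Mplus E nu -> Mplus E tau.
Proof.
move=> pt pd /MplusP[p H]; apply/MplusP; split=> // K e cK e0.
have [G [oG NG Ge]] := H K _ cK e0; exists G; split=> //.
apply: le_trans Ge.
rewrite (int_eq_Cc _ (_ : eq_Cc nu (fun f => tau f + (nu f - tau f)))); last first.
  by move=> f _; ring.
rewrite (int_addf hT)//; last exact: Cc_bounded_below_indic.
rewrite leeDl//; apply: int_ge0 => //; first exact: posf_linear.
by move=> x /=; rewrite lee_fin indicE ler0n.
Qed.

Lemma MplusI E E' nu : Mplus E nu -> Mplus E' nu -> Mplus (E `&` E') nu.
Proof.
move=> /MplusP[p H] /MplusP[_ H1]; apply/MplusP; split=> // K e cK e0.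
have e20 : 0 < e / 2 by lra.
have [G [oG NG Ge]] := H K _ cK e20; have [G1 [oG1 NG1 Ge1]] := H1 K _ cK e20.
exists (G `|` G1); split; [exact: openU| |].
  move=> x [/not_andP[nE|nE] Kx]; [left; exact: NG|right; exact: NG1].
rewrite [e]splitr EFinD; apply: le_trans (leeD Ge Ge1).
rewrite -int_add//; try exact: lscb_indic.
apply: int_mono => x /=; rewrite -EFinD lee_fin !indicE in_setU -natrD ler_nat.
by case: (x \in G); case: (x \in G1).
Qed.

Lemma Cc_of_cont (C : set T) : compact C -> exists F : T -> R,
  [/\ Cc F, forall x, 0 <= F x <= 1 & forall x, C x -> F x = 1].
Proof.
move=> cC; have [F [? ? ? _]] := @Cc_bump R _ hT lT C setT cC openT (@subsetT _ _).
by exists F.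
Qed.

(* [tau F] is the infimum of [nu (F h)] over the [h] in [Cc] with
   [1_C <= h <= 1], for [F >= 0]. *)
Lemma restrict_compact nu (C : set T) : posf nu -> compact C ->
  exists tau, [/\ posf tau, posf (fun f => nu f - tau f), Mplus C tau &
   forall F e, Cc F -> (forall x, 0 <= F x) -> 0 < e ->
   exists h, [/\ Cc h, forall x, 0 <= h x <= 1, forall x, C x -> h x = 1 &
     nu (fun x => F x * h x) < tau F + e]].
Proof.
move=> pnu cC; have lnu := posf_linear pnu.
pose H := [set h : T -> R |
  [/\ Cc h, forall x, 0 <= h x <= 1 & forall x, C x -> h x = 1]].
have [F0 HF0] := Cc_of_cont cC; have HF0' : H F0 by [].
pose S f := inf [set nu (fun x => f x * h x) | h in H].
have CM f h : Cc f -> H h -> Cc (fun x => f x * h x).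
  by move=> Cf [Ch _ _]; apply: Cc_mul => //; exact: Cc_continuous.
have h0 (h : T -> R) x : H h -> 0 <= h x by move=> [_ h01 _]; case/andP: (h01 x).
have h1 (h : T -> R) x : H h -> h x <= 1 by move=> [_ h01 _]; case/andP: (h01 x).
have hinf f : Cc f -> (forall x, 0 <= f x) ->
    has_inf [set nu (fun x => f x * h x) | h in H].
  move=> Cf f0; split; first by exists (nu (fun x => f x * F0 x)); exists F0.
  exists 0 => _ [h Hh <-]; apply: pnu.2; first exact: CM.
  by move=> x; rewrite mulr_ge0//; exact: h0.
have S_le f h : Cc f -> (forall x, 0 <= f x) -> H h -> S f <= nu (fun x => f x * h x).
  by move=> Cf f0 Hh; apply: ge_inf; [exact: (hinf f Cf f0).2|exists h].
have S_ge f y : (forall h, H h -> y <= nu (fun x => f x * h x)) -> y <= S f.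
  move=> Hy; apply: lb_le_inf; first by exists (nu (fun x => f x * F0 x)); exists F0.
  by move=> _ [h Hh <-]; exact: Hy.
have S_ap f (e : R) : Cc f -> (forall x, 0 <= f x) -> 0 < e ->
    exists2 h, H h & nu (fun x => f x * h x) < S f + e.
  move=> Cf f0 e0; have [_ [h Hh <-] ?] := inf_adherent e0 (hinf f Cf f0).
  by exists h.
have S0 f : Cc f -> (forall x, 0 <= f x) -> 0 <= S f.
  move=> Cf f0; apply: S_ge => h Hh; apply: pnu.2; first exact: CM.
  by move=> x; rewrite mulr_ge0//; exact: h0.
have S_nu f : Cc f -> (forall x, 0 <= f x) -> S f <= nu f.
  move=> Cf f0; apply: le_trans (S_le f F0 Cf f0 HF0') _; apply: posf_le => //.
    exact: CM.
  by move=> x; rewrite ler_piMr//; exact: h1.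
(* The minimum of two cutoffs that are near-optimal for two functions is near-optimal for both,
   which gives the additivity of [S]. *)
have Hmin (h h' : T -> R) : H h -> H h' -> H (fun x => Num.min (h x) (h' x)).
  move=> Hh Hh'; have [Ch _ hC] := Hh; have [Ch' _ hC'] := Hh'; split.
  - exact: Cc_min.
  - by move=> x; rewrite le_min !h0//= ge_min h1.
  - by move=> x Cx; rewrite hC// hC'// minxx.
have [||//|pS SE] := @cone_extension R T hT lT S.
- move=> f g Cf Cg f0 g0; apply/eqP; rewrite eq_le; apply/andP; split.
    apply/ler_addgt0Pr => e e0; have e20 : 0 < e / 2 by lra.
    have [h Hh hf] := S_ap f _ Cf f0 e20; have [h' Hh' hg] := S_ap g _ Cg g0 e20.
    have Hm := Hmin h h' Hh Hh'.
    have := S_le (fun x => f x + g x) _ (CcD hT Cf Cg)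
      (fun x => addr_ge0 (f0 x) (g0 x)) Hm.
    rewrite (_ : (fun x => _ * _) = fun x => f x * Num.min (h x) (h' x) +
      g x * Num.min (h x) (h' x)); last by apply/funext => x; rewrite mulrDl.
    rewrite (linD lnu (CM _ _ Cf Hm) (CM _ _ Cg Hm)).
    have m1 : nu (fun x => f x * Num.min (h x) (h' x)) <= nu (fun x => f x * h x).
      apply: (posf_le hT pnu (CM _ _ Cf Hm) (CM _ _ Cf Hh)) => x.
      by rewrite ler_wpM2l// ge_min lexx.
    have m2 : nu (fun x => g x * Num.min (h x) (h' x)) <= nu (fun x => g x * h' x).
      apply: (posf_le hT pnu (CM _ _ Cg Hm) (CM _ _ Cg Hh')) => x.
      by rewrite ler_wpM2l// ge_min lexx orbT.
    by lra.
  apply: S_ge => h Hh.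
  rewrite (_ : (fun x => _ * _) = fun x => f x * h x + g x * h x); last first.
    by apply/funext => x; rewrite mulrDl.
  by rewrite (linD lnu (CM _ _ Cf Hh) (CM _ _ Cg Hh)) lerD//; exact: S_le.
- move=> c f c0 Cf f0.
  have E h : H h -> nu (fun x => c * f x * h x) = c * nu (fun x => f x * h x).
    move=> Hh; rewrite -(linZ hT lnu c (CM _ _ Cf Hh)).
    by congr nu; apply/funext => x; rewrite mulrA.
  apply/eqP; rewrite eq_le; apply/andP; split; last first.
    apply: S_ge => h Hh; rewrite E// ler_wpM2l//; exact: S_le.
  apply/ler_addgt0Pr => e e0.
  have d0 : 0 < e / (c + 1) by rewrite divr_gt0// ltr_wpDl.
  have [h Hh hf] := S_ap f _ Cf f0 d0.
  have := S_le (fun x => c * f x) h (CcZ hT c Cf) (fun x => mulr_ge0 c0 (f0 x)) Hh.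
  rewrite E// => /le_trans; apply.
  apply: le_trans (ler_wpM2l c0 (ltW hf)) _; rewrite mulrDr lerD2l.
  by rewrite mulrA ler_pdivrMr ?ltr_wpDl// mulrC ler_pM2l// lerDl.
set tau := fun f => _ in pS; exists tau.
have tauE f : Cc f -> (forall x, 0 <= f x) -> tau f = S f by exact: SE.
have pd : posf (fun f => nu f - tau f).
  apply: (pos_radon hT lT); first exact: (radon_sub pnu pS).1.
  by move=> f Cf f0; rewrite tauE// subr_ge0; exact: S_nu.
split=> //.
- apply/MplusP; split=> // K e cK e0; exists (~` C); split.
  + by apply: closed_openC; exact: compact_closed.
  + by move=> x [].
  apply: int_le => phi Cphi phiC.
  have Cp : Cc phi^\+ by exact: Cc_pos.
  have p0 x : 0 <= phi^\+ x by rewrite /funrpos le_max lexx orbT.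
  rewrite lee_fin; apply: le_trans (_ : tau phi^\+ <= _).
    by apply: posf_le => // x; rewrite /funrpos le_max lexx.
  rewrite tauE//.
  have nF0 : 0 <= nu F0 by apply: pnu.2; [case: HF0'|move=> x; exact: h0].
  pose d := e / (nu F0 + 1).
  have d0 : 0 < d by rewrite divr_gt0// ltr_wpDl.
  (* A test function below the indicator of the complement of [C] is nonpositive on [C], so its
     positive part is below [d] on a neighbourhood of [C]; a cutoff living there makes the infimum
     [S] small. *)
  have CU : C `<=` [set x | phi^\+ x < d].
    move=> x Cx /=; rewrite /funrpos max_r//.
    by have := phiC x; rewrite /= lee_fin indicE memNset//; apply.
  have oU : open [set x | phi^\+ x < d].
    by apply: (@open_comp _ _ phi^\+ [set y | y < d]);
      [move=> x _; exact: Cc_continuous|exact: open_lt].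
  have [b [Cb b01 b1 bU]] := @Cc_bump R _ hT lT C _ cC oU CU.
  have Hb : H (fun x => F0 x * b x).
    have [CF0 F01 F1] := HF0'; split.
    - by apply: Cc_mul => //; exact: Cc_continuous.
    - move=> x; have /andP[? ?] := F01 x; have /andP[? ?] := b01 x.
      by rewrite mulr_ge0//= mulr_ile1.
    - by move=> x Cx; rewrite F1// b1// mulr1.
  apply: le_trans (S_le _ _ Cp p0 Hb) _.
  apply: (@le_trans _ _ (nu (fun x => d * F0 x))); last first.
    rewrite (linZ hT lnu); last by case: HF0'.
    by rewrite /d mulrAC ler_pdivrMr ?ltr_wpDl// ler_pM2l// lerDl.
  apply: posf_le => //; [exact: CM|by apply: CcZ => //; case: HF0'|move=> x].
  have [Ux|/bU ->] := pselect (phi^\+ x < d); last first.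
    by rewrite !mulr0 mulr_ge0 ?(ltW d0)//; exact: h0.
  have /andP[bx0 bx1] := b01 x.
  have F00 := h0 _ x HF0'.
  by apply: ler_pM => //; [rewrite mulr_ge0|exact: ltW|rewrite ler_piMr].
- move=> F e CF F0' e0; rewrite tauE//.
  by have [h [? ? ?] ?] := S_ap F e CF F0' e0; exists h.
Qed.

Lemma total_mass_compact nu (C : set T) F : Mplus C nu -> Cc F ->
  (forall x, 0 <= F x <= 1) -> (forall x, C x -> F x = 1) ->
  total_mass nu = (nu F)%:E.
Proof.
move=> M CF F01 F1; have pnu := Mplus_posf M.
have l1 : lscb (cst 1%E : T -> \bar R).
  apply: (lscb_EFin hT (f := fun=> 1)) => //; by move=> x; exact: cvg_cst.
rewrite /total_mass radon_integral_posf//; last exact: l1.2.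
rewrite -(int_EFin hT pnu CF); apply/eqP; rewrite eq_le; apply/andP; split.
  apply: (Mplus_le hT lT M) => //; first exact: lscb_Cc.
  by move=> x Cx /=; rewrite F1.
by apply: int_mono => x /=; rewrite lee_fin; case/andP: (F01 x).
Qed.

End concentrated.

(** * Integration of inequalities valid nearly everywhere *)

Section nearly_everywhere.
Context {R : realType} {X : topologicalType}.
Hypotheses (hX : hausdorff_space X) (lX : locally_compact [set: X]).
Variable k : X * X -> \bar R.
Hypotheses (kerk : is_kernel k) (pdk : positive_definite k).
Local Notation Int := pos_integral.

(** Capacity zero means that the infimum of energies is [+oo]; as the competing measures have finite
    energy, there can be none. *)
Lemma capacity0P (E : set X) : capacity k E = 0%E <->
  forall nu, Eplus k E nu -> total_mass nu <> 1%E.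
Proof.
have E0 : capacity k E = 0%E <-> [set energy k nu |
    nu in [set nu | Eplus k E nu /\ total_mass nu = 1%E]] `<=` [set +oo%E].
  rewrite -ereal_inf_pinfty /capacity; split=> [/eqP|->]; last exact: invey.
  by rewrite inve_eq0 => /eqP.
rewrite E0; split=> [H nu En m1|H]; last by move=> y [nu [En m1] _]; case: (H nu En m1).
have [_ [_ _ f]] := En; have /= Ey := H (energy k nu).
by move: f; rewrite Ey//; exists nu.
Qed.

Lemma EplusP (E : set X) nu : Eplus k E nu <-> Mplus E nu /\ Ep k nu.
Proof.
by split=> -[M H]; split=> //; have p := Mplus_posf M;
  apply/(Ep_finite_energy hX lX kerk pdk p).
Qed.

(* Otherwise [mu psi > Int mu u] for some [psi <= v] in [Cc]; then [mu] charges a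
   compact set [C] on which [u <= psi - d], and its normalized restriction to
   [C] is carried by the exceptional set. *)
Lemma nearly_everywhere_int_le (E : set X) (Pr : X -> Prop) mu u v :
  Mplus E mu -> Ep k mu -> lscb u -> lscb v -> nearly_everywhere k E Pr ->
  (forall x, E x -> Pr x -> (v x <= u x)%E) -> (Int mu v <= Int mu u)%E.
Proof.
move=> M eM lu lv /capacity0P ne uv; have pmu := Mplus_posf M.
have lmu := posf_linear pmu.
rewrite leNgt; apply/negP => Iuv.
have fu : Int mu u \is a fin_num.
  by apply: int_fin; [case: lu|apply: lt_le_trans Iuv _; exact: leey].
move: Iuv; rewrite -(fineK fu); set U := fine _ => /int_gt[psi [Cpsi psiv] Upsi].
have [_ [chi Cchi chiu]] := lu.
have Cd := CcB hX Cpsi Cchi; have [B B0 dB] := Cc_bounded hX Cd.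
have [_ [K cK dK]] := (CcP _ hX).1 Cd.
have [F [CF F01 F1]] := @Cc_of_cont R X hX lX K cK.
have F0 x : 0 <= F x by case/andP: (F01 x).
have mF0 : 0 <= mu F by exact: pmu.2.
pose dl := mu psi - U; have dl0 : 0 < dl by rewrite subr_gt0.
(* Each of the two corrections below is made to cost at most [dl / 4], so that [mu phi] stays above
   [mu psi - dl = U]. *)
pose d := dl / (4 * (mu F + 1)).
have d0 : 0 < d by rewrite divr_gt0// mulr_gt0// ltr_wpDl.
have dF : d * mu F <= dl / 4.
  rewrite /d invfM mulrA -mulrA ler_piMr ?divr_ge0 ?(ltW dl0)//.
  by rewrite mulrC ler_pdivrMr ?ltr_wpDl// mul1r lerDl.
have lupsi : lscb (fun x => u x + (- psi x)%:E)%E.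
  by apply: lscbD => //; apply: lscb_Cc => //; exact: CcN.
pose C := K `&` ~` [set x | ((- d)%:E < u x + (- psi x)%:E)%E].
have cC : compact C.
  apply: compact_closedI => //; apply: open_closedC.
  by move: lupsi.1 => /lower_semicontinuousP.
have CN : C `&` E `<=` E `&` [set x | ~ Pr x].
  move=> x [[Kx nux] Ex]; split=> //= Px; apply: nux => /=.
  have := uv x Ex Px; have := psiv x; have := chiu x.
  case: (u x) => [r||]//; case: (v x) => [s||]//;
    rewrite -?EFinD ?lte_fin ?lee_fin ?ltry//.
  by lra.
have [tau [pt pd MC tF]] := restrict_compact hX lX pmu cC.
have MN : Mplus (E `&` [set x | ~ Pr x]) tau.
  by apply: MplusS CN _ => //; apply: MplusI => //; exact: Mplus_dominated M.
have et : Ep k tau by exact: Ep_le eM.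
have FC x : C x -> F x = 1 by move=> [/F1].
have mass := total_mass_compact hX lX MC CF F01 FC.
have tF0 : 0 <= tau F by exact: pt.2.
have [t0|] := ltP 0 (tau F).
  pose t := (tau F)^-1; have t0' : 0 <= t by rewrite invr_ge0.
  have Mn : Mplus (E `&` [set x | ~ Pr x]) (fun f => t * tau f) by exact: MplusZ.
  have En : Ep k (fun f => t * tau f) by exact: EpZ.
  apply: (ne (fun f => t * tau f)); first exact/EplusP.
  rewrite (total_mass_compact hX lX (MplusZ hX lX t0' MC) CF F01 FC).
  by rewrite /t mulVf// gt_eqF.
move=> t0; have {t0 tF0}t0 : tau F = 0 by apply/eqP; rewrite eq_le t0.
have e0 : 0 < dl / (4 * (B + 1)) by rewrite divr_gt0// mulr_gt0// ltr_wpDl.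
have [h [Ch h01 hC]] := tF F _ CF F0 e0; rewrite t0 add0r => mh.
have Ck : Cc (fun x => F x * h x) by apply: Cc_mul => //; exact: Cc_continuous.
(* This test function lies below [u]: off [K] because [psi = chi] there, on [C] because subtracting
   [B] brings [psi] below [chi], and on the rest of [K] because [psi - d < u]. Since [C] carries no
   mass, the cutoff [h] makes the term with [B] cheap. *)
pose phi x := psi x - d * F x - B * (F x * h x).
have Cphi : Cc phi by apply: CcB => //; [apply: CcB => //|]; exact: CcZ.
have phiu x : ((phi x)%:E <= u x)%E.
  have /andP[h0 h1] := h01 x.
  have k0 : 0 <= F x * h x by rewrite mulr_ge0.
  have dF0 : 0 <= d * F x by rewrite mulr_ge0// ltW.
  have Bk0 : 0 <= B * (F x * h x) by rewrite mulr_ge0.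
  have [Kx|/dK dx] := pselect (K x); last first.
    by apply: le_trans (chiu x); rewrite lee_fin /phi; lra.
  have [Cx|nCx] := pselect (C x).
    apply: le_trans (chiu x); rewrite lee_fin /phi FC// hC// !mulr1.
    by have := dB x; rewrite ler_norml => /andP[]; lra.
  have : ((- d)%:E < u x + (- psi x)%:E)%E.
    by apply: contrapT => nu; apply: nCx.
  rewrite /phi F1// mulr1; move: Bk0; rewrite F1// mul1r; have := chiu x.
  case: (u x) => [r||]//; rewrite ?leey//.
  by rewrite -EFinD lte_fin !lee_fin; lra.
have := int_ub mu Cphi phiu; rewrite -(fineK fu) -/U lee_fin.
have -> : mu phi = mu psi - d * mu F - B * mu (fun x => F x * h x).
  have CdF := CcZ hX d CF; have CBk := CcZ hX B Ck.
  by rewrite /phi (linB hX lmu (CcB hX Cpsi CdF) CBk) (linB hX lmu Cpsi CdF) !linZ.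
have Bm : B * mu (fun x => F x * h x) <= dl / 4.
  apply: le_trans (ler_wpM2l B0 (ltW mh)) _.
  rewrite mulrA ler_pdivrMr ?mulr_gt0 ?ltr_wpDl//.
  by rewrite (_ : dl / 4 * _ = dl * (B + 1)); [rewrite mulrC ler_pM2l// lerDl|field].
by move: dF Bm dl0; rewrite /dl; lra.
Qed.

End nearly_everywhere.

(** * The energy form and vague compactness *)

(** Freezing all coordinates but one at [b0] bounds that coordinate from below; near-minimizers
    taken in all coordinates at once bound the sum of the infima. This decouples the plates. *)
Lemma sum_inf_ge (R : realType) n (B : 'I_n -> set R) (b0 : 'I_n -> R) (L : R) :
  (forall i, B i (b0 i)) ->
  (forall b : 'I_n -> R, (forall i, B i (b i)) -> L <= \sum_(i < n) b i) ->
  (forall i, has_inf (B i)) /\ L <= \sum_(i < n) inf (B i).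
Proof.
move=> Bb0 HL.
have hB i : has_inf (B i).
  split; first by exists (b0 i).
  exists (L - \sum_(j < n | j != i) b0 j) => y By.
  pose b j := if j == i then y else b0 j.
  have Bb j : B j (b j) by rewrite /b; case: eqVneq => [->|].
  have := HL b Bb; rewrite (bigD1 i)//= {1}/b eqxx lerBlDr => /le_trans; apply.
  by rewrite lerD2l; apply: ler_sum => j ji; rewrite /b (negPf ji).
split=> //; apply/ler_addgt0Pr => e e0.
have d0 : 0 < e / n.+1%:R by rewrite divr_gt0.
have ap i : exists y, B i y /\ y < inf (B i) + e / n.+1%:R.
  by have [y ? ?] := inf_adherent d0 (hB i); exists y.
have [b Hb] := choice ap.
apply: le_trans (HL b (fun i => (Hb i).1)) _.
apply: le_trans (ler_sum _ (fun i _ => ltW (Hb i).2)) _.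
rewrite big_split/= lerD2l sumr_const card_ord -[leLHS]mulr_natr mulrAC.
by rewrite ler_pdivrMr// ler_pM2l// ler_nat.
Qed.

(** Passes to the limit in [inner_sq_near], with [d] as the weight of that inequality and [e] as a
    bound on the squared distance. *)
Lemma le_of_perturbation (R : realType) (x Q : R) : 0 <= Q ->
  (forall d e : R, 0 < d -> 0 < e -> x <= (1 + d) * (Q + e) + (1 + d^-1) * e) ->
  x <= Q.
Proof.
move=> Q0 H; apply/ler_addgt0Pr => e e0.
(* With the squared distance set to [d / c], where [c] is the total coefficient of the error, the
   bound becomes [Q + d * (Q + 1)], which is at most [Q + e]. *)
pose d := e / (Q + 4); have Q4 : 0 < Q + 4 by lra.
have d0 : 0 < d by rewrite divr_gt0.
pose c := 1 + d + (1 + d^-1); have c0 : 0 < c.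
  by rewrite /c; have : 0 < d^-1; [rewrite invr_gt0|lra].
have E : c * (d / c) = d by rewrite mulrC divfK ?gt_eqF.
have := H d (d / c) d0 (divr_gt0 d0 c0); set y := d / c in E *.
have -> : (1 + d) * (Q + y) + (1 + d^-1) * y = Q + d * (Q + 1).
  by transitivity (Q + d * Q + c * y); [rewrite /c|rewrite E]; ring.
move=> /le_trans; apply; rewrite lerD2l /d mulrAC ler_pdivrMr// ler_pM2l//; lra.
Qed.

Section inner_algebra.
Context {R : realType} {X : topologicalType}.
Hypotheses (hX : hausdorff_space X) (lX : locally_compact [set: X]).
Variable k : X * X -> \bar R.
Hypotheses (kerk : is_kernel k) (pdk : positive_definite k).
Local Notation measure := ((X -> R) -> R).
Implicit Types (u v nu : measure).
Local Notation FE := (finite_energy k).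
Local Notation "'[ u , v ]" := (inner k u v).

Lemma finite_energy0 : FE (fun=> 0).
Proof. by apply/(Ep_finite_energy hX lX kerk pdk); [exact: posf0|exact: Ep0]. Qed.

Lemma inner0l v : FE v -> '[fun=> 0, v] = 0.
Proof.
move=> fv; have f0 := finite_energy0.
have := inner_combl hX lX kerk pdk (-1) f0 f0 fv.
rewrite (_ : (fun f => _) = fun=> 0); last by apply/funext => f; rewrite mulr0 addr0.
by lra.
Qed.

Lemma finite_energyZ c u : FE u -> FE (fun f => c * u f).
Proof.
move=> fu; have := finite_energy_comb hX lX kerk pdk c fu finite_energy0.
by rewrite (_ : (fun f => _) = fun f => c * u f)//; apply/funext => f; rewrite addr0.
Qed.

Lemma innerZl c u v : FE u -> FE v -> '[fun f => c * u f, v] = c * '[u, v].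
Proof.
move=> fu fv; have := inner_combl hX lX kerk pdk c fu finite_energy0 fv.
rewrite inner0l// addr0 => <-; congr inner; apply/funext => f; by rewrite addr0.
Qed.

Lemma innerZr c u v : FE u -> FE v -> '[v, fun f => c * u f] = c * '[v, u].
Proof.
move=> fu fv; have fZ := finite_energyZ c fu.
by rewrite inner_sym// innerZl// (inner_sym hX lX kerk pdk fu fv).
Qed.

Lemma finite_energyB u v : FE u -> FE v -> FE (fun f => u f - v f).
Proof.
move=> fu fv; have := finite_energy_comb hX lX kerk pdk (-1) fv fu.
by rewrite (_ : (fun f => _) = fun f => u f - v f)//; apply/funext => f; ring.
Qed.

Lemma finite_energy_sum n (c : 'I_n -> R) (u : 'I_n -> measure) :
  (forall i, FE (u i)) -> FE (fun f => \sum_(i < n) c i * u i f).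
Proof.
elim: n c u => [|n IH] c u fu.
  rewrite (_ : (fun f => _) = fun=> 0); first exact: finite_energy0.
  by apply/funext => f; rewrite big_ord0.
rewrite (_ : (fun f => _) = fun f =>
  c ord_max * u ord_max f +
  \sum_(i < n) c (widen_ord (leqnSn n) i) * u (widen_ord (leqnSn n) i) f).
  apply: (finite_energy_comb hX lX kerk pdk (c ord_max) (fu ord_max)).
  exact: (IH (fun i => c (widen_ord (leqnSn n) i)) (fun i => u (widen_ord (leqnSn n) i))).
by apply/funext => f; rewrite big_ord_recr/= addrC.
Qed.

Lemma inner_suml n (c : 'I_n -> R) (u : 'I_n -> measure) v :
  (forall i, FE (u i)) -> FE v ->
  '[fun f => \sum_(i < n) c i * u i f, v] = \sum_(i < n) c i * '[u i, v].
Proof.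
move=> + fv; elim: n c u => [|n IH] c u fu.
  rewrite big_ord0 (_ : (fun f => _) = fun=> 0); first exact: inner0l.
  by apply/funext => f; rewrite big_ord0.
pose c' i := c (widen_ord (leqnSn n) i); pose u' i := u (widen_ord (leqnSn n) i).
have fu' i : FE (u' i) by exact: fu.
rewrite (_ : (fun f => _) = fun f =>
  c ord_max * u ord_max f + (fun f => \sum_(i < n) c' i * u' i f) f).
  have fs := finite_energy_sum c' fu'.
  rewrite (inner_combl hX lX kerk pdk (c ord_max) (fu ord_max) fs fv).
  by rewrite (IH c' u' fu') big_ord_recr/= addrC.
by apply/funext => f; rewrite big_ord_recr/= addrC.
Qed.

Lemma inner_sqB u v : FE u -> FE v ->
  '[fun f => u f - v f, fun f => u f - v f] = '[u, u] - 2 * '[u, v] + '[v, v].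
Proof.
move=> fu fv; have := inner_sq_comb hX lX kerk pdk (-1) fv fu.
rewrite (_ : (fun f => _) = fun f => u f - v f); last by apply/funext => f; ring.
by move=> ->; rewrite (inner_sym hX lX kerk pdk fv fu); ring.
Qed.

Lemma inner_sqB_le u v : FE u -> FE v ->
  '[fun f => u f - v f, fun f => u f - v f] <= 2 * '[u, u] + 2 * '[v, v].
Proof.
move=> fu fv; rewrite inner_sqB//.
have := inner_ge0 pdk (finite_energy_comb hX lX kerk pdk 1 fv fu).
rewrite inner_sq_comb// (inner_sym hX lX kerk pdk fv fu); lra.
Qed.

(** Young's inequality, read off from the nonnegativity of the energy of [w - d v] with [w = u - v];
    it serves as continuity of the energy without square roots. *)
Lemma inner_sq_near (d : R) u v : 0 < d -> FE u -> FE v ->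
  '[u, u] <= (1 + d) * '[v, v] +
    (1 + d^-1) * '[fun f => u f - v f, fun f => u f - v f].
Proof.
move=> d0 fu fv; have fw := finite_energyB fu fv.
rewrite {1 2}(_ : u = fun f => 1 * v f + (u f - v f)); last first.
  by apply/funext => f; ring.
set w := fun f => u f - v f in fw *.
rewrite (inner_sq_comb hX lX kerk pdk 1 fv fw).
have := inner_ge0 pdk (finite_energy_comb hX lX kerk pdk (- d) fv fw).
rewrite inner_sq_comb// => H.
have : 0 <= d^-1 * ((- d) ^+ 2 * '[v, v] + 2 * - d * '[v, w] + '[w, w]).
  by rewrite mulr_ge0// invr_ge0 ltW.
rewrite (_ : d^-1 * _ = d * '[v, v] - 2 * '[v, w] + d^-1 * '[w, w]).
  by rewrite !mulrDl; lra.
by field; rewrite gt_eqF.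
Qed.

Lemma inner_parallelogram u v : FE u -> FE v ->
  '[fun f => u f - v f, fun f => u f - v f] =
  2 * '[u, u] + 2 * '[v, v] -
  4 * '[fun f => 2^-1 * u f + 2^-1 * v f, fun f => 2^-1 * u f + 2^-1 * v f].
Proof.
move=> fu fv; rewrite inner_sqB//.
have fZ := finite_energyZ 2^-1 fv.
rewrite (inner_sq_comb hX lX kerk pdk 2^-1 fu fZ).
by rewrite (innerZr _ fv fu) (innerZr _ fv fZ) (innerZl _ fv fv); field.
Qed.

Lemma sdistE u v : FE u -> FE v ->
  sdist k u v = Num.sqrt '[fun f => u f - v f, fun f => u f - v f].
Proof.
by move=> fu fv; rewrite /sdist /snorm (inner_energy (finite_energyB fu fv)).
Qed.

(** Cauchy-Schwarz in a form that also excludes zero energy: if [u] had energy 0, the energy of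
    [c u + v] would be affine in [c] with slope at least 2, hence negative somewhere. The bound then
    follows by taking [c] to be minus the inverse energy of [u]. *)
Lemma inner_ge1_le u v : FE u -> FE v -> 1 <= '[u, v] ->
  0 < '[u, u] /\ '[u, u]^-1 <= '[v, v].
Proof.
move=> fu fv uv; have u0 := inner_ge0 pdk fu; have v0 := inner_ge0 pdk fv.
have H c : 0 <= c ^+ 2 * '[u, u] + 2 * c * '[u, v] + '[v, v].
  rewrite -(inner_sq_comb hX lX kerk pdk c fu fv); apply: (inner_ge0 pdk).
  exact: finite_energy_comb.
have upos : 0 < '[u, u].
  rewrite lt_neqAle u0 andbT; apply/negP => /eqP E.
  have := H (- ('[v, v] + 1)); rewrite -E mulr0 add0r.
  have : 0 <= ('[u, v] - 1) * ('[v, v] + 1) by rewrite mulr_ge0//; lra.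
  by lra.
split=> //; have := H (- '[u, u]^-1).
rewrite (_ : (- _) ^+ 2 * _ = '[u, u]^-1); last by field; rewrite gt_eqF.
have : 0 <= ('[u, v] - 1) * '[u, u]^-1.
  by rewrite mulr_ge0 ?invr_ge0 ?(ltW upos)//; lra.
by lra.
Qed.

End inner_algebra.

Definition leq_rel (i j : nat) : Prop := (i <= j)%N.

(** * Vague cluster points of bounded sequences *)

Section vague_compactness.
Context {R : realType} {X : topologicalType}.
Hypotheses (hX : hausdorff_space X) (lX : locally_compact [set: X]).
Local Notation measure := ((X -> R) -> R).
Lemma directed_nat : directed leq_rel.
Proof.
split; [exact: (inhabits 0%N)|by move=> j; exact: leqnn| |].
  by move=> i j l; exact: leq_trans.
by move=> i j; exists (maxn i j); [exact: leq_maxl|exact: leq_maxr].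
Qed.

Lemma proper_tails : ProperFilter (tails leq_rel).
Proof.
split; first by move=> [j0] /(_ j0); apply; exact: leqnn.
split.
- by exists 0%N.
- move=> P Q [i Pi] [j Qj]; exists (maxn i j) => n; rewrite /leq_rel geq_max.
  by move=> /andP[? ?]; split; [exact: Pi|exact: Qj].
- by move=> P Q PQ [i Pi]; exists i => j ij; apply: PQ; exact: Pi.
Qed.

(** Tychonoff's theorem on a product of compact intervals. Linearity and positivity survive at a
    cluster point because each instance involves finitely many test functions, on which some [nu n]
    is arbitrarily close. *)
Lemma vague_cluster (nu : nat -> measure) : (forall n, posf (nu n)) ->
  (forall f, Cc f -> exists M, forall n, `|nu n f| <= M) ->
  exists2 nu0, posf nu0 &
    cluster ((fun n => vague (nu n)) @ tails leq_rel) (vague nu0).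
Proof.
move=> pnu bnd.
have bnd' (f : Cc) : exists M, forall n, `|nu n (\val f)| <= M.
  by apply: bnd; exact: set_valP.
have [M HM] := choice bnd'.
pose box := [set u : prod_topology (fun _ : @Cc R X => R) |
  forall f, `[- M f, M f]%classic (u f)].
have cbox : compact box.
  apply: (@tychonoff _ (fun _ => R) (fun f => `[- M f, M f]%classic)) => f.
  exact: segment_compact.
have PF := proper_tails.
have [u [_ clu]] := cbox ((fun n => vague (nu n)) @ tails leq_rel) _
  (ltac:(by exists 0%N => n _ f; rewrite /= in_itv/= -ler_norml; exact: HM)).
have ap (s : seq Cc) (e : R) : 0 < e ->
    exists n, forall f, f \in s -> `|u f - nu n (\val f)| < e.
  move=> e0.
  have nB : nbhs u [set v : {ptws Cc -> R} | forall f, f \in s -> `|u f - v f| < e].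
    elim: s => [|f s IH]; first by apply: filterS filterT => v _ f; rewrite in_nil.
    have nf : nbhs u [set v : {ptws Cc -> R} | `|u f - v f| < e].
      exact: (@proj_continuous Cc (fun=> R) f u _ (nbhsx_ballx (u f) e e0)).
    apply: filterS (filterI nf IH) => v [/= vf vs] f'; rewrite in_cons.
    by move=> /predU1P[->//|]; exact: vs.
  have [|v [[n _ <-] Bn]] := clu ((fun n => vague (nu n)) @` setT) _ _ nB.
    by exists 0%N => n _; exists n.
  by exists n.
pose nu0 f : R := if pselect (Cc f) is left H then u (exist _ f (mem_set H)) else 0.
have nu0E (f : Cc) : nu0 (\val f) = u f.
  rewrite /nu0; case: pselect => [H|nH]; last by case: nH; exact: set_valP.
  by congr u; apply: val_inj.
have nu0E' f (H : Cc f) : nu0 f = u (exist _ f (mem_set H)).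
  by rewrite -nu0E.
have pos0 : posf nu0.
  apply: (pos_radon hX lX).
    move=> c f g Cf Cg; have Cfg : Cc (fun x => c * f x + g x).
      by apply: CcD => //; exact: CcZ.
    rewrite (nu0E' _ Cf) (nu0E' _ Cg) (nu0E' _ Cfg).
    set f' : Cc := exist _ _ _; set f1 : Cc := exist _ _ _; set f2 : Cc := exist _ _ _.
    apply/eqP; rewrite -subr_eq0 -normr_le0; apply/ler_addgt0Pr => e e0; rewrite add0r.
    have d0 : 0 < e / (`|c| + 2) by rewrite divr_gt0// ltr_wpDl.
    have [n Hn] := ap [:: f'; f1; f2] _ d0.
    have h0 := Hn f' (ltac:(by rewrite !inE eqxx)).
    have h1 := Hn f1 (ltac:(by rewrite !inE eqxx orbT)).
    have h2 := Hn f2 (ltac:(by rewrite !inE eqxx !orbT)).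
    have E : nu n (\val f') = c * nu n (\val f1) + nu n (\val f2).
      exact: (posf_linear (pnu n)).
    rewrite (_ : u f' - _ = (u f' - nu n (\val f')) - c * (u f1 - nu n (\val f1))
      - (u f2 - nu n (\val f2))); last by rewrite E; ring.
    apply: le_trans (ler_normB _ _) _.
    apply: le_trans (lerD (ler_normB _ _) (lexx _)) _; rewrite normrM.
    have h1' : `|c| * `|u f1 - nu n (\val f1)| <= `|c| * (e / (`|c| + 2)).
      by rewrite ler_wpM2l// ltW.
    have -> : e = e / (`|c| + 2) + `|c| * (e / (`|c| + 2)) + e / (`|c| + 2).
      by field; rewrite gt_eqF// ltr_wpDl.
    by rewrite !lerD// ltW.
  move=> f Cf f0; rewrite (nu0E' _ Cf); set f' : Cc := exist _ _ _.
  apply/ler_addgt0Pr => e e0; have [n Hn] := ap [:: f'] e e0.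
  have := Hn f' (ltac:(by rewrite inE)); rewrite ltr_norml => /andP[h _].
  by have := (pnu n).2 f Cf f0; move: h; rewrite /f'/=; lra.
exists nu0 => //; rewrite (_ : vague nu0 = u)//.
by apply/funext => f; exact: nu0E.
Qed.

End vague_compactness.

(** * Integrating the inequalities defining the class *)

Section potential_inequality.
Context {R : realType}.

(** [U] and [V] are the potentials of the positive and negative parts, and [m0] tells the sign of
    the plate. Where both are infinite the potential is undefined, so [Pr] fails, in agreement with
    [u = v = +oo]. *)
Lemma potential_ineqP (m0 : bool) (U V : \bar R) (a g cp cn : R) :
  (-oo < U)%E -> (-oo < V)%E -> 0 < a ->
  let al := if m0 then 1 else -1 in
  let u := (a%:E * (if m0 then U else V) + (cn * g)%:E)%E in
  let v := (a%:E * (if m0 then V else U) + (cp * g)%:E)%E in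
  let Pr := (U +? - V)%E /\ (((cp - cn) * g)%:E <= (al * a)%:E * (U - V))%E in
  (Pr -> (v <= u)%E) /\ (~ Pr -> (u <= v)%E).
Proof.
move=> U0 V0 a0 al u v Pr.
have ay : (a%:E * +oo = +oo :> \bar R)%E by rewrite gt0_muley ?lte_fin.
have any : ((- a)%:E * +oo = -oo :> \bar R)%E.
  by rewrite lt0_muley// lte_fin oppr_lt0.
have anyy : ((- a)%:E * -oo = +oo :> \bar R)%E.
  by rewrite lt0_muleNy// lte_fin oppr_lt0.
have aNy : (a%:E * -oo = -oo :> \bar R)%E by rewrite gt0_muleNy ?lte_fin.
rewrite /Pr /u /v /al {Pr u v al}; case: m0; rewrite ?mul1r ?mulN1r.
- case: U U0 => [U||] // _; case: V V0 => [V||] // _; rewrite ?ay /=.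
  + rewrite -!EFinM -!EFinD !lee_fin; split=> [[_]|H]; first by lra.
    by rewrite leNgt; apply/negP => ?; apply: H; split=> //; lra.
  + by rewrite ?aNy ?ay ?anyy ?any; split=> [[//]|]; rewrite ?leey.
  + by rewrite ?aNy ?ay ?anyy ?any; split=> [|[]]; rewrite ?leey.
  + by split=> [[]|].
- case: U U0 => [U||] // _; case: V V0 => [V||] // _; rewrite ?ay /=.
  + rewrite -!EFinM -!EFinD !lee_fin; split=> [[_]|H]; first by lra.
    by rewrite leNgt; apply/negP => ?; apply: H; split=> //; lra.
  + by rewrite ?aNy ?ay ?anyy ?any; split=> [|[]]; rewrite ?leey.
  + by rewrite ?aNy ?ay ?anyy ?any; split=> [[//]|]; rewrite ?leey.
  + by split=> [[]|].
Qed.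

End potential_inequality.

Section potentials.
Context {R : realType} {X : topologicalType}.
Hypotheses (hX : hausdorff_space X) (lX : locally_compact [set: X]).
Variable k : X * X -> \bar R.
Hypotheses (kerk : is_kernel k) (pdk : positive_definite k).
Variable g : X -> R.
Hypotheses (contg : continuous g) (g_gt0 : forall x, 0 < g x).
Local Notation measure := ((X -> R) -> R).
Local Notation Int := pos_integral.

Let lk : lscb k. Proof. exact: kernel_lscb. Qed.

Lemma lscb_g : lscb (EFin \o g).
Proof. by apply: lscb_EFin => // x; exact: ltW. Qed.

Lemma int_potential tau P : Ep k tau -> Ep k P ->
  Int tau (fun x => Int P (fun y => k (x, y))) = (mutual k tau P)%:E.
Proof.
move=> et eP; rewrite -(mutualE hX lX kerk pdk et eP).
by rewrite (int_tensor hX lX hX lX lk (EpP et) (EpP eP)).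
Qed.

Lemma int_potential_plus tau P (a c G : R) : Ep k tau -> Ep k P ->
  0 < a -> 0 < c -> Int tau (EFin \o g) = G%:E ->
  lscb (fun x => a%:E * Int P (fun y => k (x, y)) + (c * g x)%:E)%E /\
  Int tau (fun x => a%:E * Int P (fun y => k (x, y)) + (c * g x)%:E)%E =
  (a * mutual k tau P + c * G)%:E.
Proof.
move=> et eP a0 c0 IG; have pt := EpP et.
have l1 := lscbZ hX a0 (lscb_int hX lX hX lX lk (EpP eP)).
have l2 := lscbZ hX c0 lscb_g.
split; first exact: (lscbD hX l1 l2).
rewrite (int_add hX lX pt l1 l2) !(int_scale hX _ _ pt)//.
by rewrite int_potential// IG EFinD !EFinM.
Qed.

(** The two halves serve the two bounds of the theorem: the first is applied to members of the
    class, the second to measures carried by an exceptional set. *)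
Lemma int_potential_le (E : set X) (m0 : bool) tau nu (a c G : R) :
  Mplus E tau -> Ep k tau -> finite_energy k nu -> 0 < a ->
  Int tau (EFin \o g) = G%:E ->
  let al := if m0 then 1 else -1 in
  let Pr x := potential_defined k nu x /\
    ((c * g x)%:E <= (al * a)%:E * potential k nu x)%E in
  (nearly_everywhere k E Pr -> c * G <= a * (al * inner k tau nu)) /\
  ((forall x, E x -> ~ Pr x) -> a * (al * inner k tau nu) <= c * G).
Proof.
move=> M et fnu a0 IG al Pr; have pt := EpP et.
have [eP eQ _] := finite_energy_represents hX lX kerk fnu.
(* Moving the terms with a minus sign to the other side yields an inequality
   between lower semicontinuous functions, also where both potentials are
   infinite; [c = cp - cn] with positive [cp] and [cn]. *)
pose cp := `|c| + 1 + c; pose cn := `|c| + 1.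
have cn0 : 0 < cn by rewrite ltr_wpDl.
have cp0 : 0 < cp by rewrite /cp; have := ler_norm (- c); rewrite normrN; lra.
have cE : c = cp - cn by rewrite /cp /cn; ring.
have cG : c * G = cp * G - cn * G by rewrite -mulrBl -cE.
have [eA eB] : Ep k (if m0 then mpos nu else mneg nu) /\
  Ep k (if m0 then mneg nu else mpos nu) by case: m0 {al Pr}.
have [lu Iu] := int_potential_plus et eA a0 cn0 IG.
have [lv Iv] := int_potential_plus et eB a0 cp0 IG.
have bb x : Cc_bounded_below (fun y => k (x, y)) := (lscb_slice hX hX lk x).2.
have pw x := potential_ineqP m0 (g x) cp cn
  (int_gtNy (mpos nu) (bb x)) (int_gtNy (mneg nu) (bb x)) a0.
have e : a * (al * inner k tau nu) =
    a * mutual k tau (if m0 then mpos nu else mneg nu) -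
    a * mutual k tau (if m0 then mneg nu else mpos nu).
  by rewrite inner_posl// /al; case: m0 {al Pr eA eB lu Iu lv Iv pw}; ring.
pose w (P : measure) (c' : R) x : \bar R :=
  (a%:E * Int P (fun y => k (x, y)) + (c' * g x)%:E)%E.
split=> H.
- have : (Int tau (w (if m0 then mneg nu else mpos nu) cp) <=
    Int tau (w (if m0 then mpos nu else mneg nu) cn))%E.
    apply: (nearly_everywhere_int_le hX lX kerk pdk M et lu lv H) => x _.
    rewrite /Pr cE => Px; have [/(_ Px) + _] := pw x.
    by rewrite /w; case: (m0).
  by rewrite Iu Iv lee_fin e cG; lra.
- have : (Int tau (w (if m0 then mpos nu else mneg nu) cn) <=
    Int tau (w (if m0 then mneg nu else mpos nu) cp))%E.
    apply: (Mplus_le hX lX M lu lv) => x Ex.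
    have := H x Ex; rewrite /Pr cE => nPx; have [_ /(_ nPx) +] := pw x.
    by rewrite /w; case: (m0).
  by rewrite Iu Iv lee_fin e cG; lra.
Qed.

Lemma Cc_le_g f : Cc f -> exists2 M, 0 < M & forall x, `|f x| <= M * g x.
Proof.
move=> Cf; have Cfg : Cc (fun x => (g x)^-1 * f x).
  by apply: Cc_mul => // x; apply: cvgV; [rewrite gt_eqF|exact: contg].
have [M M0 fM] := Cc_bounded hX Cfg; exists (M + 1); first by rewrite ltr_wpDl.
move=> x; have := fM x; rewrite normrM gtr0_norm ?invr_gt0//.
rewrite ler_pdivrMl// => /le_trans; apply.
by rewrite [leRHS]mulrC ler_pM2l// lerDl.
Qed.

(** Provides the boundedness required for vague compactness: up to a factor, [g] dominates every
    function in [Cc], and its integrals over the plates are prescribed. *)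
Lemma mass_bound f : Cc f -> exists2 M, 0 < M & forall nu (G : R),
  posf nu -> Int nu (EFin \o g) = G%:E -> `|nu f| <= M * G.
Proof.
move=> Cf; have [M M0 fM] := Cc_le_g Cf; exists M => // nu G pnu IG.
have Ca := Cc_abs hX Cf; have lnu := posf_linear pnu.
apply: le_trans (lin_norm_le hX lnu pnu.2 Cf Ca (fun x => lexx _)) _.
rewrite -ler_pdivrMl// -(linZ hX lnu _ Ca) -lee_fin -IG.
apply: int_ub => [|x]; first exact: CcZ.
by rewrite lee_fin ler_pdivrMl.
Qed.

(* Cuts [tau] down by a compactly supported density, so that [g] becomes
   integrable, and rescales. *)
Lemma normalized_restriction (N : set X) tau (a : R) : Mplus N tau -> Ep k tau ->
  total_mass tau = 1%E -> 0 < a ->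
  exists rho, [/\ Mplus N rho, Ep k rho & Int rho (EFin \o g) = a%:E].
Proof.
move=> M et m1 a0; have pt := EpP et; have lt := posf_linear pt.
have l1 : lscb (cst 1%E : X -> \bar R).
  by apply: (lscb_EFin hX (f := fun=> 1)) => // x; exact: cvg_cst.
move: m1; rewrite /total_mass radon_integral_posf//; last exact: l1.2.
move=> m1; have : (0%:E < Int tau (cst 1%E))%E by rewrite m1 lte_fin.
move=> /int_gt[phi [Cphi phi1] tphi].
pose f := phi^\+; have Cf : Cc f by exact: Cc_pos.
have f0 x : 0 <= f x by rewrite /f /funrpos le_max lexx orbT.
have f1 x : f x <= 1.
  by rewrite /f /funrpos ge_max ler01 andbT -lee_fin; exact: phi1.
have tf : 0 < tau f.
  by apply: lt_le_trans tphi _; apply: posf_le => // x; rewrite /f /funrpos le_max lexx.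
have Cmul h : Cc h -> Cc (fun x => f x * h x).
  by move=> Ch; apply: Cc_mul => //; exact: Cc_continuous.
pose rho (h : X -> R) := tau (fun x => f x * h x).
have pr : posf rho.
  apply: (pos_radon hX lX).
    move=> c h h' Ch Ch'; rewrite /rho.
    rewrite -(lt c _ _ (Cmul _ Ch) (Cmul _ Ch')); congr tau.
    by apply/funext => x; ring.
  by move=> h Ch h0; apply: pt.2; [exact: Cmul|move=> x; rewrite mulr_ge0].
have pd : posf (fun h => tau h - rho h).
  apply: (pos_radon hX lX); first exact: (radon_sub pt pr).1.
  move=> h Ch h0; rewrite subr_ge0; apply: (posf_le hX pt (Cmul _ Ch) Ch).
  by move=> x; rewrite ler_piMl.
have Cgf : Cc (fun x => g x * f x) by exact: Cc_mul.
pose G := tau (fun x => g x * f x).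
have [_ [K cK fK]] := (CcP _ hX).1 Cf.
have [F [CF F01 F1]] := @Cc_of_cont R X hX lX K cK.
have fF x : f x * F x = f x.
  by have [/F1 ->|/fK ->] := pselect (K x); rewrite ?mulr1// mul0r.
have F0 x : 0 <= F x by case/andP: (F01 x).
have CgF : Cc (fun x => g x * F x) by exact: Cc_mul.
have IG : Int rho (EFin \o g) = G%:E.
  apply/eqP; rewrite eq_le; apply/andP; split.
    apply: int_le => h Ch hg; rewrite lee_fin.
    apply: (posf_le hX pt (Cmul _ Ch) Cgf).
    by move=> x; rewrite mulrC ler_wpM2r// -lee_fin; exact: hg.
  have -> : G = rho (fun x => g x * F x).
    by congr tau; apply/funext => x; rewrite mulrCA fF.
  apply: int_ub => // x; rewrite lee_fin ler_piMr ?(ltW (g_gt0 x))//.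
  by case/andP: (F01 x).
have [B B0 FB] := Cc_le_g CF.
have G0 : 0 < G.
  rewrite -(pmulr_rgt0 _ B0); apply: lt_le_trans tf _.
  rewrite -(linZ hX lt _ Cgf); apply: posf_le => //; first exact: CcZ.
  move=> x; rewrite -[leLHS]fF mulrC mulrA ler_wpM2r//.
  by rewrite (le_trans _ (FB x))// ler_norm.
have c0 : 0 < a / G by rewrite divr_gt0.
exists (fun h => a / G * rho h); split.
- by apply: MplusZ => //; [exact: ltW|exact: Mplus_dominated M].
- by apply: EpZ => //; [exact: ltW|exact: Ep_le et].
- by rewrite int_scalef// IG -EFinM divfK// gt_eqF.
Qed.

End potentials.

(** * Condensers *)

Lemma null_sequence (R : realType) : exists iv : nat -> R,
  [/\ forall n, 0 < iv n, forall n, iv n <= 1,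
      forall i j, (i <= j)%N -> iv j <= iv i &
      forall e, 0 < e -> exists n0, forall n, (n0 <= n)%N -> iv n < e].
Proof.
exists (fun n => n.+1%:R^-1); split=> [n|n|i j ij|e e0].
- by rewrite invr_gt0.
- by rewrite invf_le1// ler1n.
- by rewrite lef_pV2 ?posrE// ler_nat.
have [n0 _ H] := near_infty_natSinv_lt (PosNum e0).
by exists n0 => n n0n; exact: H.
Qed.

Section condensers.
Context {R : realType} {X : topologicalType}.
Hypotheses (hX : hausdorff_space X) (lX : locally_compact [set: X]).
Variable k : X * X -> \bar R.
Hypotheses (kerk : is_kernel k) (pdk : positive_definite k).
Variables (m p : nat) (A : 'I_(m + p) -> set X).
Hypothesis condA : is_condenser A.
Local Notation I := 'I_(m + p).
Local Notation measure := ((X -> R) -> R).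
Local Notation FE := (finite_energy k).
Local Notation "'[ u , v ]" := (inner k u v).
Local Notation Int := pos_integral.
Implicit Types (mu z : I -> measure).

(** The positive measures formed by the plates of one sign; the boolean index allows both to be
    treated by the same argument. *)
Definition side (b : bool) mu : measure :=
  fun f => \sum_(i < m + p) ((i < m)%N == b)%:R * mu i f.

Lemma Rmeasure_side mu : Rmeasure mu = fun f => side true mu f - side false mu f.
Proof.
apply/funext => f; rewrite /Rmeasure /side -sumrB; apply: eq_bigr => i _.
by rewrite /alpha; case: (i < m)%N; rewrite /= ?mul0r ?mul1r ?mulN1r ?subr0 ?sub0r.
Qed.

Lemma posf_side b mu : (forall i, posf (mu i)) -> posf (side b mu).
Proof.
move=> pm; apply: (pos_radon hX lX).
  move=> c f h Cf Ch; rewrite /side mulr_sumr -big_split/=; apply: eq_bigr => i _.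
  by rewrite (posf_linear (pm i))//; ring.
move=> f Cf f0; apply: sumr_ge0 => i _; rewrite mulr_ge0//.
exact: (pm i).2.
Qed.

Lemma Ep_side b mu : (forall i, Ep k (mu i)) -> Ep k (side b mu).
Proof.
move=> em; apply: (Ep_sum hX lX kerk pdk (P := fun i f => ((i < m)%N == b)%:R * mu i f)).
by move=> i; exact: EpZ.
Qed.

(** The closures of the positive plates have a closed union, disjoint from that of the negative
    ones. A bump equal to 1 on the compact part of the first and vanishing on the second splits [f]
    exactly. *)
Lemma side_singular mu : cond_measures A mu ->
  singular (side true mu) (side false mu).
Proof.
move=> M f e Cf f0 e0.
have [_ [K cK fK]] := (CcP _ hX).1 Cf.
pose Cp := \bigcup_(i in [set i : I | (i < m)%N]) closure (A i).
pose Cn := \bigcup_(i in [set i : I | (m <= i)%N]) closure (A i).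
have clp : closed Cp.
  by apply: closed_bigcup => [|i _]; [exact: finite_finset|exact: closed_closure].
have cln : closed Cn.
  by apply: closed_bigcup => [|i _]; [exact: finite_finset|exact: closed_closure].
have sub : K `&` Cp `<=` ~` Cn.
  move=> x [_ [i /= im Aix]] [j /= mj Ajx].
  by have : (closure (A i) `&` closure (A j)) x by []; rewrite condA.2.
have [rho [Crho rho01 rho1 rho0]] := @Cc_bump R _ hX lX (K `&` Cp) (~` Cn)
  (compact_closedI cK clp) (closed_openC cln) sub.
have Cu : Cc (fun x => f x * rho x) by apply: Cc_mul => //; exact: Cc_continuous.
have C0 := @Cc0 R X hX.
exists (fun x => f x * rho x); split => //.
- by move=> x; have /andP[? ?] := rho01 x; rewrite mulr_ge0//= ler_piMr.
- apply: le_trans (ltW e0); apply: sumr_le0 => i _.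
  case: ltnP => im; rewrite /= ?mul0r// mul1r.
  rewrite -(lin0 hX (posf_linear (Mplus_posf (M i)))).
  apply: (Mplus_Cc_le hX lX (M i) Cu C0) => x Ax.
  by rewrite rho0 ?mulr0//; apply; exists i => //; exact: subset_closure.
- apply: le_trans (ltW e0); apply: sumr_le0 => i _.
  case: ltnP => im; rewrite /= ?mul0r// mul1r.
  rewrite -(lin0 hX (posf_linear (Mplus_posf (M i)))).
  apply: (Mplus_Cc_le hX lX (M i) (CcB hX Cf Cu) C0) => x Ax.
  have [Kx|/fK ->] := pselect (K x); last by rewrite mul0r subrr.
  rewrite rho1 ?mulr1 ?subrr//; split=> //; exists i => //; exact: subset_closure.
Qed.

Lemma finite_energy_Rmeasure mu : (forall i, Ep k (mu i)) -> FE (Rmeasure mu).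
Proof.
move=> em; apply: (finite_energy_sum hX lX kerk pdk) => i.
exact/(Ep_finite_energy hX lX kerk pdk (EpP (em i))).
Qed.

(** Cancellation cannot hide infinite energies: the sides are singular, hence agree with the Jordan
    parts of [Rmeasure mu], and each component is dominated by its side. *)
Lemma cond_energyP mu :
  cond_energy k A mu <-> forall i, Mplus (A i) (mu i) /\ Ep k (mu i).
Proof.
split=> [[M fR] i|H]; last first.
  by split=> [i|]; [exact: (H i).1|apply: finite_energy_Rmeasure => i; exact: (H i).2].
split; first exact: M.
have pm j : posf (mu j) := Mplus_posf (M j).
have [e1 e0] : Ep k (side true mu) /\ Ep k (side false mu).
  apply: (singular_finite_energy hX lX kerk (posf_side true pm)
    (posf_side false pm) (side_singular M) _ fR).
  by move=> f _; rewrite Rmeasure_side.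
suff pd : posf (fun f => side (i < m)%N mu f - mu i f).
  by apply: (Ep_le hX lX kerk (pm i) pd); case: (i < m)%N.
apply: (pos_radon hX lX); first exact: (radon_sub (posf_side _ pm) (pm i)).1.
move=> f Cf f0; rewrite /side (bigD1 i)//= eqxx mul1r addrAC subrr add0r.
by apply: sumr_ge0 => j _; rewrite mulr_ge0//; exact: (pm j).2.
Qed.

Lemma inner_Rmeasurel mu v : (forall i, Ep k (mu i)) -> FE v ->
  '[Rmeasure mu, v] = \sum_(i < m + p) alpha i * '[mu i, v].
Proof.
move=> em fv; apply: (inner_suml hX lX kerk pdk) => // i.
exact/(Ep_finite_energy hX lX kerk pdk (EpP (em i))).
Qed.

Lemma Ep_FE P : Ep k P -> FE P.
Proof. by move=> eP; apply/(Ep_finite_energy hX lX kerk pdk (EpP eP)). Qed.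

Variables (a : I -> R) (g : X -> R).
Hypotheses (a_gt0 : forall i, 0 < a i).
Hypotheses (contg : continuous g) (g_gt0 : forall x, 0 < g x).

Definition plate (i : I) (tau : measure) :=
  [/\ Mplus (A i) tau, Ep k tau & Int tau (EFin \o g) = (a i)%:E].

Lemma cond_admissibleP mu :
  cond_admissible k A a g mu <-> forall i, plate i (mu i).
Proof.
have lg := lscb_g hX contg g_gt0; split=> [[/cond_energyP H Ig] i|H].
  have [M E] := H i; split=> //.
  by rewrite -(Ig i) radon_integral_posf//; [exact: EpP E|exact: lg.2].
split; first by apply/cond_energyP => i; have [] := H i.
move=> i; have [M E <-] := H i.
by rewrite radon_integral_posf//; [exact: EpP E|exact: lg.2].
Qed.

Definition mix (t : R) mu mu' : I -> measure :=
  fun i f => t * mu i f + (1 - t) * mu' i f.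

Lemma plate_mix t mu mu' : 0 < t < 1 -> (forall i, plate i (mu i)) ->
  (forall i, plate i (mu' i)) -> forall i, plate i (mix t mu mu' i).
Proof.
move=> /andP[t0 t1] H H' i; have [M E Ig] := H i; have [M' E' Ig'] := H' i.
have s0 : 0 < 1 - t by lra.
have lg := lscb_g hX contg g_gt0.
have Z := posfZ hX lX (ltW t0) (EpP E); have Z' := posfZ hX lX (ltW s0) (EpP E').
split.
- by apply: MplusD => //; apply: MplusZ => //; exact: ltW.
- by apply: EpD => //; apply: EpZ => //; exact: ltW.
- rewrite /mix (int_addf hX Z Z' lg.2) (int_scalef _ t0 (EpP E)).
  rewrite (int_scalef _ s0 (EpP E')) Ig Ig' -!EFinM -EFinD.
  by congr EFin; ring.
Qed.

Lemma side_mix b t mu mu' :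
  side b (mix t mu mu') = fun f => t * side b mu f + (1 - t) * side b mu' f.
Proof.
apply/funext => f; rewrite /side !mulr_sumr -big_split/=; apply: eq_bigr => i _.
by rewrite /mix; ring.
Qed.

Lemma Rmeasure_mix t mu mu' :
  Rmeasure (mix t mu mu') = fun f => t * Rmeasure mu f + (1 - t) * Rmeasure mu' f.
Proof.
apply/funext => f; rewrite /Rmeasure !mulr_sumr -big_split/=; apply: eq_bigr => i _.
by rewrite /mix; ring.
Qed.

Lemma Rmeasure_ge1 nu mu : Gamma_hat k A a g nu -> (forall i, plate i (mu i)) ->
  1 <= '[Rmeasure mu, nu].
Proof.
move=> [fnu [c [Hc c1]]] H; apply: (le_trans c1).
rewrite inner_Rmeasurel//; last by move=> i; have [] := H i.
apply: ler_sum => i _; have [M E Ig] := H i.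
have [/(_ (Hc i)) + _] := int_potential_le hX lX kerk pdk contg g_gt0
  (i < m)%N (c i) M E fnu (a_gt0 i) Ig.
by rewrite mulrC ler_pM2l.
Qed.

(** Without negative plates the second side is zero. Otherwise [kappa <= S <= (S / gam) g] between
    plates of opposite sign, so the constraints on the integrals of [g] replace bounds on the
    masses. *)
Lemma mutual_energy_sides_bound : p = 0%N \/
    (0 < inf [set g x | x in plates A] /\
     (ereal_sup [set k (x, y) | x in plates_pos A & y in plates_neg A] < +oo)%E) ->
  exists2 B, 0 <= B & forall z, (forall i, plate i (z i)) ->
    '[side true z, side false z] <= B.
Proof.
case=> [p0|[g0 supk]].
  exists 0 => // z Hz.
  have e1 : Ep k (side true z) by apply: Ep_side => i; have [] := Hz i.
  rewrite (_ : side false z = fun=> 0); last first.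
    apply/funext => f; rewrite /side big1// => i _.
    have im : (i < m)%N by have := ltn_ord i; rewrite [X in (_ < _ + X)%N]p0 addn0.
    by rewrite im mul0r.
  rewrite (inner_sym hX lX kerk pdk (Ep_FE e1) (finite_energy0 hX lX kerk pdk)).
  by rewrite (inner0l hX lX kerk pdk)//; exact: Ep_FE.
set gam := inf _ in g0; set S0 := ereal_sup _ in supk.
(* The bound is enlarged to a positive real, as the scaling of integrals requires; the supremum
   could be negative or [-oo]. *)
have [S S1 kS] : exists2 S : R, 0 < S & forall x y, plates_pos A x ->
    plates_neg A y -> (k (x, y) <= S%:E)%E.
  have kS0 x y : plates_pos A x -> plates_neg A y -> (k (x, y) <= S0)%E.
    by move=> Ax Ay; apply: ereal_sup_ubound; exists x => //; exists y.
  case: S0 supk kS0 => [S||]// _ kS0.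
    exists (`|S| + 1) => [|x y Ax Ay]; first by rewrite ltr_wpDl.
    by rewrite (le_trans (kS0 x y Ax Ay))// lee_fin ler_wpDr// ler_norm.
  by exists 1 => // x y Ax Ay; rewrite (le_trans (kS0 x y Ax Ay))// leNye.
have gam_le i x : A i x -> gam <= g x.
  move=> Aix; apply: ge_inf; last by exists x => //; exists i.
  by exists 0 => _ [y _ <-]; exact: ltW.
have lg := lscb_g hX contg g_gt0; have lk := kernel_lscb hX kerk.
pose D i j := S * (a j / gam) * (a i / gam).
have D0 i j : 0 <= D i j by rewrite ltW// /D !mulr_gt0 ?invr_gt0//.
exists (\sum_(i < m + p) \sum_(j < m + p) D i j).
  by apply: sumr_ge0 => i _; exact: sumr_ge0.
move=> z Hz; have ez i : Ep k (z i) by have [] := Hz i.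
have pairwise_le (i j : I) : (i < m)%N -> (m <= j)%N -> '[z i, z j] <= D i j.
  move=> im mj; have [Mi ei Ii] := Hz i; have [Mj ej Ij] := Hz j.
  rewrite (inner_pos hX lX kerk pdk)// -lee_fin -(int_potential hX lX kerk pdk ei ej).
  have slice_le x : A i x -> (Int (z j) (fun y => k (x, y)) <= (S * (a j / gam))%:E)%E.
    move=> Aix; have Sg : 0 < S / gam by rewrite divr_gt0.
    have -> : (S * (a j / gam))%:E = Int (z j) (fun y => (S / gam)%:E * (EFin \o g) y)%E.
      by rewrite (int_scale hX _ Sg (EpP ej)) Ij -EFinM; congr EFin; ring.
    apply: (Mplus_le hX lX Mj (lscb_slice hX hX lk x) (lscbZ hX Sg lg)) => y Ajy.
    apply: (le_trans (kS x y _ _)); [by exists i|by exists j|].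
    rewrite -EFinM lee_fin mulrAC ler_pdivlMr// ler_pM2l//; exact: gam_le Ajy.
  have c0 : 0 < S * (a j / gam) / gam by rewrite !divr_gt0// mulr_gt0// divr_gt0.
  apply: (@le_trans _ _
      (Int (z i) (fun x => (S * (a j / gam) / gam)%:E * (EFin \o g) x)%E)).
    have lp := lscb_int hX lX hX lX lk (EpP ej).
    apply: (Mplus_le hX lX Mi lp (lscbZ hX c0 lg)) => x Aix.
    apply: (le_trans (slice_le x Aix)); rewrite -EFinM lee_fin mulrAC ler_pdivlMr//.
    by rewrite ler_pM2l ?(gam_le _ _ Aix)// mulr_gt0// divr_gt0.
  rewrite (int_scale hX _ c0 (EpP ei)) Ii -EFinM lee_fin /D.
  by rewrite le_eqVlt; apply/orP; left; apply/eqP; ring.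
have fs b : FE (side b z) by apply: Ep_FE; exact: Ep_side.
have fz i : FE (z i) := Ep_FE (ez i).
rewrite (inner_suml hX lX kerk pdk _ fz (fs false)); apply: ler_sum => i _.
rewrite (inner_sym hX lX kerk pdk (fz i) (fs false)).
rewrite (inner_suml hX lX kerk pdk _ fz (fz i)) mulr_sumr; apply: ler_sum => j _.
case: (ltnP i m) => im; case: (ltnP j m) => mj; rewrite /= ?mul0r ?mulr0// !mul1r.
by rewrite (inner_sym hX lX kerk pdk (fz j) (fz i)); exact: pairwise_le.
Qed.

Lemma Gamma_hat_scaled (r s : R) sigma mu0 : 0 < r -> 0 < s -> FE sigma ->
  (forall i, plate i (mu0 i)) ->
  (forall mu, (forall i, plate i (mu i)) -> r <= '[Rmeasure mu, sigma]) ->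
  Gamma_hat k A a g (fun f => (1 + s) / r * sigma f).
Proof.
move=> r0 s0 fsig H0 Hsig; set t := (1 + s) / r.
have t0 : 0 < t by rewrite divr_gt0// addr_gt0.
have fts := finite_energyZ hX lX kerk pdk t fsig.
set ts := (fun f => _) in fts *.
pose V i := [set alpha i * '[tau, ts] | tau in plate i].
have [|b Vb|Vinf sumV] := @sum_inf_ge R (m + p) V
    (fun i => alpha i * '[mu0 i, ts]) (1 + s).
- by move=> i; exists (mu0 i).
- have ex i : exists tau, plate i tau /\ alpha i * '[tau, ts] = b i.
    by have [tau ? ?] := Vb i; exists tau.
  have [mu Hmu] := choice ex.
  have pmu i : plate i (mu i) := (Hmu i).1.
  have emu i : Ep k (mu i) by have [] := pmu i.
  rewrite -(eq_bigr _ (fun i _ => (Hmu i).2)) -inner_Rmeasurel//.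
  rewrite (innerZr hX lX kerk pdk t fsig (finite_energy_Rmeasure emu)).
  rewrite (_ : 1 + s = t * r); last by rewrite divfK// gt_eqF.
  by rewrite ler_pM2l//; exact: Hsig.
split=> //.
(* The surplus [s] is shared among the plates, so that the constants still sum to at least 1. A
   positive [d] is needed because integration over an exceptional set gives only a weak
   inequality. *)
pose d := s / (m + p).+1%:R; have d0 : 0 < d by rewrite divr_gt0.
exists (fun i => inf (V i) - d); split; last first.
  rewrite big_split/= sumr_const card_ord.
  have : d *+ (m + p) <= s.
    by rewrite -mulr_natr /d mulrAC ler_pdivrMr// ler_pM2l// ler_nat.
  by rewrite mulNrn; lra.
move=> i; apply/capacity0P => tau /(EplusP hX lX kerk pdk)[M E] m1.
(* The measure on the exceptional set is turned into a competitor for the [i]-th plate, to which the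
   lower bound [inf (V i)] applies. *)
have [rho [Mr Er Ir]] :=
  normalized_restriction hX lX kerk pdk contg g_gt0 M E m1 (a_gt0 i).
have [_ /(_ _)] := int_potential_le hX lX kerk pdk contg g_gt0
  (i < m)%N (inf (V i) - d) Mr Er fts (a_gt0 i) Ir.
suff Vr : inf (V i) <= alpha i * '[rho, ts].
  move=> H; have {H} : a i * (alpha i * '[rho, ts]) <= (inf (V i) - d) * a i.
    by apply: H => x [].
  by rewrite mulrC ler_pM2r//; lra.
apply: ge_inf; first exact: (Vinf i).2.
exists rho => //; split=> //.
by apply: (MplusS hX lX _ Mr) => x [].
Qed.

Hypothesis consk : consistent k.

(* The minimizing sequence is chosen so as to minimize asymptotically also
   [N z = |side true z|^2 + |side false z|^2]: as all the sets involved are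
   convex, the parallelogram law then makes each of the two sequences
   [side b (z n)] strongly Cauchy, and consistency applies to both. *)
Lemma extremal_measure (r B : R) : 0 <= r ->
  (forall z, (forall i, plate i (z i)) -> r <= '[Rmeasure z, Rmeasure z]) ->
  (forall e : R, 0 < e -> exists2 z, (forall i, plate i (z i)) &
     '[Rmeasure z, Rmeasure z] <= r + e) ->
  0 <= B ->
  (forall z, (forall i, plate i (z i)) -> '[side true z, side false z] <= B) ->
  exists sigma, [/\ FE sigma, '[sigma, sigma] <= r &
    forall mu, (forall i, plate i (mu i)) -> r <= '[Rmeasure mu, sigma]].
Proof.
move=> r0 rmin rap B0 HB.
pose adm z := forall i, plate i (z i).
have ez z : adm z -> forall i, Ep k (z i) by move=> Hz i; have [] := Hz i.
have fs b z : adm z -> FE (side b z).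
  by move=> /ez Hz; apply: Ep_FE; exact: Ep_side.
have fR z : adm z -> FE (Rmeasure z) by move=> /ez; exact: finite_energy_Rmeasure.
have [iv [iv0 iv1 ivmono ivlt]] := null_sequence R.
pose N z := '[side true z, side true z] + '[side false z, side false z].
have N0 z : adm z -> 0 <= N z.
  by move=> az; rewrite addr_ge0//; exact: inner_ge0 (fs _ _ az).
pose S n := [set z | adm z /\ '[Rmeasure z, Rmeasure z] <= r + iv n].
have NE z : adm z -> N z = '[Rmeasure z, Rmeasure z] + 2 * '[side true z, side false z].
  move=> az; rewrite Rmeasure_side inner_sqB//; try exact: fs.
  by rewrite /N; ring.
(* The energy is [N z] minus twice the mutual energy of the sides, so the bound [B] is what controls
   [N] along the sequence. *)
have S_bnd n z : S n z -> N z <= r + 1 + 2 * B.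
  move=> [az qz]; rewrite NE//; have := HB z az.
  by have := iv1 n; move: qz; lra.
have Sinf n : has_inf [set N z | z in S n].
  split; last by exists 0 => _ [z [az _] <-]; exact: N0.
  have [z az qz] := rap (iv n) (iv0 n).
  by exists (N z); exists z.
(* As the sets [S n] shrink, these infima increase to a finite limit [D]. *)
pose d n := inf [set N z | z in S n].
have dle n z : S n z -> d n <= N z.
  by move=> Sz; apply: ge_inf; [exact: (Sinf n).2|exists z].
have Smono i j : (i <= j)%N -> S j `<=` S i.
  move=> ij z [az qz]; split=> //; apply: (le_trans qz).
  by rewrite lerD2l ivmono.
have dmono i j : (i <= j)%N -> d i <= d j.
  move=> ij; apply: lb_le_inf; first exact: (Sinf j).1.
  by move=> _ [z Sz <-]; apply: dle; exact: Smono Sz.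
have dsup : has_sup (range d).
  split; first by exists (d 0%N); exists 0%N.
  exists (r + 1 + 2 * B) => _ [n _ <-]; have [y [z Sz _]] := (Sinf n).1.
  exact: le_trans (dle n z Sz) (S_bnd n z Sz).
pose D := sup (range d).
have dD n : d n <= D by apply: ub_le_sup; [exact: dsup.2|exists n].
have zex n : exists z, S n z /\ N z < d n + iv n.
  have [_ [z Sz <-] ?] := inf_adherent (iv0 n) (Sinf n).
  by exists z.
have [z Hz] := choice zex.
have az n : adm (z n) := (Hz n).1.1.
pose diff b i j f := side b (z i) f - side b (z j) f.
have fdiff b i j : FE (diff b i j) by apply: finite_energyB => //; exact: fs.
have cauchy (e : R) : 0 < e -> exists n0, forall i j b, (n0 <= i)%N -> (n0 <= j)%N ->
    '[diff b i j, diff b i j] < e.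
  move=> e0; have e80 : 0 < e / 8 by lra.
  (* The midpoint of [z i] and [z j] lies in [S n0], so the parallelogram law bounds the squared
     distances of the two sides together by [4 (D + e/8) - 4 d n0], which is less than [e]. *)
  have [_ [n1 _ <-] dn1] := sup_adherent e80 dsup.
  have [n2 Hn2] := ivlt _ e80.
  pose n0 := maxn n1 n2; exists n0 => i j b n0i n0j.
  have dn0 : D - e / 8 < d n0 by apply: lt_le_trans dn1 (dmono _ _ (leq_maxl _ _)).
  have Ni l : (n0 <= l)%N -> S n0 (z l) /\ N (z l) <= D + e / 8.
    move=> n0l; split; first exact: Smono n0l _ (Hz l).1.
    have := (Hz l).2; have := dD l.
    have := Hn2 l (leq_trans (leq_maxr _ _) n0l); lra.
  have [Si NDi] := Ni i n0i; have [Sj NDj] := Ni j n0j.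
  have h01 : 0 < (2^-1 : R) < 1 by lra.
  pose w := mix 2^-1 (z i) (z j).
  have half : 1 - 2^-1 = 2^-1 :> R by lra.
  have aw : adm w by exact: plate_mix h01 (az i) (az j).
  have Sw : S n0 w.
    split=> //; rewrite /w Rmeasure_mix half.
    have := inner_parallelogram hX lX kerk pdk (fR _ (az i)) (fR _ (az j)).
    have := inner_ge0 pdk (finite_energyB hX lX kerk pdk (fR _ (az i)) (fR _ (az j))).
    by have := Si.2; have := Sj.2; lra.
  have := dle n0 w Sw.
  have Pb b' := inner_parallelogram hX lX kerk pdk (fs b' _ (az i)) (fs b' _ (az j)).
  have := Pb true; have := Pb false.
  rewrite /N /w !side_mix half -/(diff true i j) -/(diff false i j).
  have := inner_ge0 pdk (fdiff true i j); have := inner_ge0 pdk (fdiff false i j).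
  move: NDi NDj; rewrite /N.
  clear -dn0.
  case: b; move: (inner k (diff true i j) _) (inner k (diff false i j) _);
    move: (inner k _ _) (inner k _ _) (inner k _ _) (inner k _ _)
      (inner k _ _) (inner k _ _) => *; lra.
have lim b : exists2 s, FE s & forall e : R, 0 < e -> exists n0, forall n, (n0 <= n)%N ->
    '[fun f => side b (z n) f - s f, fun f => side b (z n) f - s f] < e.
  have es n : Ep k (side b (z n)) by apply: Ep_side; exact: ez.
  have [||s ps cl] := @vague_cluster R X hX lX (fun n => side b (z n)).
  - by move=> n; exact: EpP.
  - move=> f Cf; have [M M0 HM] := mass_bound hX contg g_gt0 Cf.
    exists (\sum_(i < m + p) M * a i) => n.
    apply: le_trans (ler_norm_sum _ _ _) _; apply: ler_sum => i _.
    have [_ E Ig] := az n i; have := HM _ _ (EpP E) Ig.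
    rewrite normrM; case: (_ == _) => /=; rewrite ?normr1 ?mul1r// normr0 mul0r.
    by move=> _; rewrite mulr_ge0// ltW.
  have [||fes cvs] := consk directed_nat _ _ ps.1 cl.
  - move=> n; apply/(EplusP hX lX kerk pdk); split=> //.
    by apply: Mplus_setT => //; exact: EpP.
  - move=> e e0; have [n0 Hn0] := cauchy (e ^+ 2) (ltac:(by rewrite exprn_gt0)).
    exists n0 => i j n0i n0j; rewrite sdistE//; try exact: Ep_FE.
    have -> : e = Num.sqrt (e ^+ 2) by rewrite sqrtr_sqr gtr0_norm.
    by rewrite ltr_sqrt ?exprn_gt0//; exact: Hn0.
  exists s => // e e0; move: cvs => /cvgrPdist_lt.
  have se0 : 0 < Num.sqrt e by rewrite sqrtr_gt0.
  have [_ FT] := proper_tails.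
  move=> /(_ FT _ se0)[n0 Hn0]; exists n0 => n n0n.
  have := Hn0 n n0n; rewrite sub0r normrN sdistE//; last exact: Ep_FE.
  by rewrite ger0_norm ?sqrtr_ge0// ltr_sqrt.
have [s1 fs1 lim1] := lim true; have [s0 fs0 lim0] := lim false.
pose sigma : measure := fun f => s1 f - s0 f.
have fsig : FE sigma by exact: finite_energyB.
have near e : 0 < e -> exists n, [/\ iv n < e &
    '[fun f => Rmeasure (z n) f - sigma f, fun f => Rmeasure (z n) f - sigma f] < e].
  move=> e0; have e40 : 0 < e / 4 by lra.
  have [n1 H1] := lim1 _ e40; have [n2 H2] := lim0 _ e40; have [n3 H3] := ivlt _ e0.
  pose n := maxn n1 (maxn n2 n3); exists n; split.
    by apply: H3; rewrite /n !leq_max leqnn !orbT.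
  have h1 := H1 n (leq_maxl _ _).
  have h2 : _ < e / 4 := H2 n (ltac:(by rewrite /n !leq_max leqnn orbT)).
  have fd1 := finite_energyB hX lX kerk pdk (fs true _ (az n)) fs1.
  have fd0 := finite_energyB hX lX kerk pdk (fs false _ (az n)) fs0.
  rewrite (_ : (fun f => Rmeasure (z n) f - sigma f) = fun f =>
    (side true (z n) f - s1 f) - (side false (z n) f - s0 f)); last first.
    by apply/funext => f; rewrite Rmeasure_side /sigma; ring.
  by have := inner_sqB_le hX lX kerk pdk fd1 fd0; lra.
have sqB_sym u v : FE u -> FE v -> '[fun f => u f - v f, fun f => u f - v f] =
    '[fun f => v f - u f, fun f => v f - u f].
  by move=> fu fv; rewrite !inner_sqB// (inner_sym hX lX kerk pdk fv fu); ring.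
have dV (c : R) : 0 < c -> 0 < c^-1 by rewrite invr_gt0.
have sig_le : '[sigma, sigma] <= r.
  apply: le_of_perturbation => // c e c0 e0; have [n [hn qn]] := near e e0.
  have := inner_sq_near hX lX kerk pdk c0 fsig (fR _ (az n)).
  rewrite sqB_sym//; last exact: fR.
  move=> /le_trans; apply; have := (Hz n).1.2 => qz.
  apply: lerD; rewrite ler_pM2l//; [lra|lra|by rewrite ltW|].
  by have := dV c c0; lra.
have sig_ge : r <= '[sigma, sigma].
  apply: le_of_perturbation; first exact: inner_ge0.
  move=> c e c0 e0; have [n [hn qn]] := near e e0.
  apply: (le_trans (rmin _ (az n))).
  apply: (le_trans (inner_sq_near hX lX kerk pdk c0 (fR _ (az n)) fsig)).
  have := dV c c0 => cV0.
  by apply: lerD; rewrite ler_pM2l; lra.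
exists sigma; split=> // mu amu.
have fmu := fR _ amu.
(* [sigma] need not come from an admissible measure, so [mu] is mixed with [z n], which is
   admissible, and the limit is taken afterwards. *)
have quad t : 0 < t < 1 -> r <= t ^+ 2 * '[Rmeasure mu, Rmeasure mu] +
    2 * t * (1 - t) * '[Rmeasure mu, sigma] + (1 - t) ^+ 2 * '[sigma, sigma].
  move=> t01; have /andP[t0 t1] := t01.
  have fZ := finite_energyZ hX lX kerk pdk (1 - t) fsig.
  have fst := finite_energy_comb hX lX kerk pdk t fmu fZ.
  set st := (fun f => _) in fst.
  have <- : '[st, st] = t ^+ 2 * '[Rmeasure mu, Rmeasure mu] +
    2 * t * (1 - t) * '[Rmeasure mu, sigma] + (1 - t) ^+ 2 * '[sigma, sigma].
    rewrite inner_sq_comb// (innerZr hX lX kerk pdk _ fsig fmu).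
    rewrite (innerZr hX lX kerk pdk _ fsig fZ) (innerZl hX lX kerk pdk _ fsig fsig).
    by ring.
  apply: le_of_perturbation; first exact: inner_ge0.
  move=> c e c0 e0; have [n [hn qn]] := near e e0.
  have aw : adm (mix t mu (z n)) by exact: plate_mix t01 amu (az n).
  apply: (le_trans (rmin _ aw)).
  apply: (le_trans (inner_sq_near hX lX kerk pdk c0 (fR _ aw) fst)).
  have fd := finite_energyB hX lX kerk pdk (fR _ (az n)) fsig.
  rewrite (_ : (fun f => Rmeasure (mix t mu (z n)) f - st f) =
    fun f => (1 - t) * (Rmeasure (z n) f - sigma f)); last first.
    by apply/funext => f; rewrite Rmeasure_mix /st; ring.
  rewrite (innerZl hX lX kerk pdk (1 - t) fd (finite_energyZ hX lX kerk pdk (1 - t) fd)).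
  rewrite (innerZr hX lX kerk pdk (1 - t) fd fd).
  have q0 := inner_ge0 pdk fd.
  have cV0 := dV c c0.
  have le_e : (1 - t) * ((1 - t) *
    '[fun f => Rmeasure (z n) f - sigma f, fun f => Rmeasure (z n) f - sigma f]) <= e.
    have t10 : 0 <= 1 - t by lra.
    apply: le_trans (ltW qn); rewrite mulrA ler_piMl// -expr2 expr_le1//; lra.
  by apply: lerD; rewrite ler_pM2l; lra.
have E : '[sigma, sigma] = r by apply/eqP; rewrite eq_le sig_le.
rewrite leNgt; apply/negP => br.
set b := '[Rmeasure mu, sigma] in br quad.
have W0 := inner_ge0 pdk (finite_energyB hX lX kerk pdk fmu fsig).
rewrite inner_sqB// -/b E in W0.
set q := '[Rmeasure mu, Rmeasure mu] in W0 quad.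
(* [W] is the squared distance from [mu] to [sigma]. The bound in [quad] equals
   [r + t (t W - 2 (r - b))], and this [t] lies in (0, 1) with [t W <= r - b], so the bound falls
   below [r]. *)
pose W := q - 2 * b + r; pose t := (r - b) / (W + (r - b) + 1).
have rb0 : 0 < r - b by lra.
have den0 : 0 < W + (r - b) + 1 by rewrite /W; lra.
have t0 : 0 < t by rewrite divr_gt0.
have t1 : t < 1 by rewrite ltr_pdivrMr// mul1r /W; lra.
have tW : t * W <= r - b.
  by rewrite /t mulrAC ler_pdivrMr// ler_pM2l// /W; lra.
have := quad t (ltac:(by rewrite t0)); rewrite E.
have -> : t ^+ 2 * q + 2 * t * (1 - t) * b + (1 - t) ^+ 2 * r =
    t * (t * W - 2 * (r - b)) + r by rewrite /W; ring.
have : 0 < t * (2 * (r - b) - t * W) by rewrite mulr_gt0//; lra.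
by lra.
Qed.

End condensers.

Theorem theorem2 (R : realType) (X : topologicalType)
    (hausX : hausdorff_space X) (lcX : locally_compact [set: X])
    (kappa : X * X -> \bar R) (kerk : is_kernel kappa)
    (pdk : positive_definite kappa) (consk : consistent kappa)
    (m p : nat) (m_ge1 : (1 <= m)%N)
    (A : 'I_(m + p) -> set X) (condA : is_condenser A)
    (g : X -> R) (contg : continuous g) (g_gt0 : forall x, 0 < g x)
    (a : 'I_(m + p) -> R) (a_gt0 : forall i, 0 < a i)
    (cap_gt0 : (0 < cond_capacity kappa A a g)%E)
    (hyp : p = 0%N \/
       (0 < inf [set g x | x in plates A] /\
        (ereal_sup [set kappa (x, y) | x in plates_pos A & y in plates_neg A]
           < +oo)%E)) :
  ereal_inf [set energy kappa nu | nu in Gamma_hat kappa A a g] =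
  cond_capacity kappa A a g.
Proof.
have admP mu := @cond_admissibleP R X hausX lcX kappa kerk pdk m p A condA
  a g contg g_gt0 mu.
pose adm mu := forall i, plate kappa A a g i (mu i).
have fR mu : adm mu -> finite_energy kappa (Rmeasure mu).
  move=> amu; apply: (finite_energy_Rmeasure hausX lcX kerk pdk) => i.
  by have [] := amu i.
set W := [set energy kappa (Rmeasure mu) | mu in cond_admissible kappa A a g].
(* Without admissible measures the infimum would be [+oo] and the capacity 0. *)
have [mu0 amu0] : exists mu, adm mu.
  apply: contrapT => none; move: cap_gt0; rewrite /cond_capacity -/W.
  rewrite (_ : W = set0) ?ereal_inf0 ?invey ?ltxx//.
  by apply/seteqP; split=> // x [mu /admP amu]; case: none; exists mu.
have W0 : (0 <= ereal_inf W)%E.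
  apply: le_ereal_inf_tmp => _ [mu /admP amu <-].
  by rewrite inner_energy ?lee_fin ?(inner_ge0 pdk)//; exact: fR.
have Wle mu : adm mu -> (ereal_inf W <= (inner kappa (Rmeasure mu) (Rmeasure mu))%:E)%E.
  move=> amu; rewrite -inner_energy; last exact: fR.
  by apply: ereal_inf_lbound; exists mu => //; exact/admP.
have [r Wr] : exists r, ereal_inf W = r%:E.
  move: W0 (Wle _ amu0); case: (ereal_inf W) => // r _ _; by exists r.
have r0 : 0 <= r by move: W0; rewrite Wr.
have rmin mu : adm mu -> r <= inner kappa (Rmeasure mu) (Rmeasure mu).
  by move=> /Wle; rewrite Wr lee_fin.
rewrite /cond_capacity -/W Wr inver.
apply/eqP; rewrite eq_le; apply/andP; split; last first.
  (* A member of the class has positive energy, and [r] is at least its inverse. So for [r = 0]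
     there is no member, and the bound by [+oo] is vacuous. *)
  apply: le_ereal_inf_tmp => _ [nu Gnu <-]; have fnu := Gnu.1.
  have H mu : adm mu -> 0 < inner kappa (Rmeasure mu) (Rmeasure mu) /\
      (inner kappa (Rmeasure mu) (Rmeasure mu))^-1 <= inner kappa nu nu.
    move=> amu; apply: (inner_ge1_le hausX lcX kerk pdk (fR _ amu) fnu).
    exact: (Rmeasure_ge1 hausX lcX kerk pdk a_gt0 contg g_gt0 Gnu amu).
  have [q0 qnu] := H _ amu0.
  have nu0 : 0 < inner kappa nu nu by apply: lt_le_trans qnu; rewrite invr_gt0.
  have nur : (inner kappa nu nu)^-1 <= r.
    rewrite -lee_fin -Wr; apply: le_ereal_inf_tmp => _ [mu /admP amu <-].
    rewrite inner_energy ?lee_fin; last exact: fR.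
    have [qmu0 qmu] := H _ amu.
    by rewrite -[leRHS]invrK lef_pV2 ?posrE ?invr_gt0.
  have rpos : 0 < r by apply: lt_le_trans nur; rewrite invr_gt0.
  rewrite gt_eqF// inner_energy// lee_fin.
  by rewrite -[leRHS]invrK lef_pV2 ?posrE ?invr_gt0.
case: eqVneq => [_|rn0]; first exact: leey.
have rpos : 0 < r by rewrite lt_neqAle eq_sym rn0.
have [B B0 HB] := mutual_energy_sides_bound hausX lcX kerk pdk a_gt0 contg g_gt0 hyp.
have rap e : 0 < e -> exists2 z, adm z &
    inner kappa (Rmeasure z) (Rmeasure z) <= r + e.
  move=> e0; have : (ereal_inf W < (r + e)%:E)%E by rewrite Wr lte_fin ltrDl.
  move=> /ereal_inf_lt[_ [z /admP az <-]].
  by rewrite inner_energy ?lte_fin; [move=> /ltW ?; exists z|exact: fR].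
have [sigma [fsig qsig Hsig]] :=
  extremal_measure hausX lcX kerk pdk a_gt0 contg g_gt0 consk r0 rmin rap B0 HB.
apply/lee_addgt0Pr => e e0.
(* For [s <= 1] one has [(1 + s)^2 <= 1 + 3 s], so the energy of the scaled measure is at most
   [(1 + 3 s) / r]; the second term of the minimum makes the excess at most [e]. *)
pose s := Num.min 1 (e * r / 3).
have s0 : 0 < s by rewrite lt_min ltr01 divr_gt0// mulr_gt0.
have s1 : s <= 1 by rewrite ge_min lexx.
have se : 3 * s / r <= e.
  rewrite ler_pdivrMr// -ler_pdivlMl// mulrC.
  by rewrite ge_min lexx orbT.
have Gs := Gamma_hat_scaled hausX lcX kerk pdk a_gt0 contg g_gt0 rpos s0 fsig amu0 Hsig.
apply: le_trans (ereal_inf_lbound _) _; first by exists (fun f => (1 + s) / r * sigma f).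
rewrite inner_energy; last exact: Gs.1.
have fZ := finite_energyZ hausX lcX kerk pdk ((1 + s) / r) fsig.
rewrite (innerZl hausX lcX kerk pdk _ fsig fZ) (innerZr hausX lcX kerk pdk _ fsig fsig).
rewrite -EFinD lee_fin.
apply: (@le_trans _ _ ((1 + s) / r * ((1 + s) / r * r))).
  have t0 : 0 < (1 + s) / r by rewrite divr_gt0// addr_gt0.
  by rewrite !ler_pM2l.
rewrite divfK ?gt_eqF//.
apply: (@le_trans _ _ (r^-1 + 3 * s / r)); last by rewrite lerD2l.
rewrite -{2}[r^-1]mul1r -mulrDl mulrAC ler_pM2r ?invr_gt0//.
have : 0 <= s * (1 - s) by rewrite mulr_ge0//; [exact: ltW|lra].
by lra.
Qed.
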